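(* Let $p:\mathsf{E}\to\mathsf{B}$ be a fibration with simple products and simple coproducts, and such that $\mathsf{B}$ is cartesian closed. Then there exists a fibration $p'$ over $\mathsf{B}$ such that $\mathfrak{Dial}(p')\simeq p$ (equivalence of fibrations over $\mathsf{B}$) if and only if $p$ is a Gödel fibration.
   Context: Conventions. All fibrations are cloven and split (reindexing is strictly functorial) and have a base category with finite products. For $p:\mathsf{E}\to\mathsf{B}$ and $I\in\mathsf{B}$, $\mathsf{E}_I$ is the fibre category over $I$ (its arrows are called vertical); for $u:A\to B$ in $\mathsf{B}$, $u^*:\mathsf{E}_B\to\mathsf{E}_A$ is reindexing. An equivalence of fibrations over $\mathsf{B}$ is a functor between total categories commuting with the projections to $\mathsf{B}$, preserving cartesian arrows, and which is an equivalence of categories. Simple (co)products. $p$ has simple coproducts if for every projection $\pi_I:I\times X\to I$ the functor $\pi_I^*$ has a left adjoint $\coprod_{\pi_I}$, and the Beck-Chevalley condition holds: for every $f:I\to J$ the canonical map $\coprod_{\pi_I}(f\times 1_X)^*\to f^*\coprod_{\pi_J}$ is invertible (with $\pi_J:J\times X\to J$). Dually, $p$ has simple products if each $\pi_I^*$ has a right adjoint $\prod_{\pi_I}$ satisfying the Beck-Chevalley condition. $\coprod$-quantifier-free. If $p$ has simple coproducts, $\alpha\in\mathsf{E}_I$ is $\coprod$-quantifier-free if for every $f:A\to I$, every projection $\pi_A:A\times B\to A$, every $\beta\in\mathsf{E}_{A\times B}$ and every vertical arrow $h:f^*\alpha\to\coprod_{\pi_A}\beta$ of $\mathsf{E}_A$,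 there exist a unique $g:A\to B$ in $\mathsf{B}$ and a unique vertical arrow $\overline h:f^*\alpha\to\langle 1_A,g\rangle^*\beta$ such that $h=(\langle 1_A,g\rangle^*\eta_\beta)\,\overline h$, where $\eta_\beta:\beta\to\pi_A^*\coprod_{\pi_A}\beta$ is the unit of $\coprod_{\pi_A}\dashv\pi_A^*$. $p$ has enough $\coprod$-quantifier-free objects if for every $I$ and every $\alpha\in\mathsf{E}_I$ there are an object $A$ and a $\coprod$-quantifier-free $\beta\in\mathsf{E}_{I\times A}$ with $\alpha\cong\coprod_{\pi_I}\beta$. $\prod$-quantifier-free. If $p$ has simple products, $\alpha\in\mathsf{E}_I$ is $\prod$-quantifier-free if for every $f:A\to I$, every projection $\pi_A:A\times B\to A$, every $\beta\in\mathsf{E}_{A\times B}$ and every vertical $h:\prod_{\pi_A}\beta\to f^*\alpha$, there exist a unique $g:A\to B$ and a unique vertical $\overline h:\langle 1_A,g\rangle^*\beta\to f^*\alpha$ such that $h=\overline h\,(\langle 1_A,g\rangle^*\varepsilon_\beta)$, where $\varepsilon_\beta:\pi_A^*\prod_{\pi_A}\beta\to\beta$ is the counit of $\pi_A^*\dashv\prod_{\pi_A}$. $p$ has enough $\prod$-quantifier-free objects if for every $I$ and $\alpha\in\mathsf{E}_I$ there are $A$ and a $\prod$-quantifier-free $\beta\in\mathsf{E}_{I\times A}$ with $\alpha\cong\prod_{\pi_I}\beta$. Skolem and Gödel fibrations. $p$ is a Skolem fibration if: $\mathsf{B}$ is cartesian closed; $p$ has simple products and simple coproducts; $p$ has enough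 $\coprod$-quantifier-free objects; and $\coprod$-quantifier-free objects are stable under simple products, i.e. if $\alpha\in\mathsf{E}_I$ is $\coprod$-quantifier-free then so is $\prod_\pi\alpha$ for every projection $\pi$ from $I$. In that case the full sub-fibration $p_0:\mathsf{E}_0\to\mathsf{B}$ of $p$ on the $\coprod$-quantifier-free objects has simple products (those of $p$). A Skolem fibration $p$ is a Gödel fibration if $p_0$ has enough $\prod$-quantifier-free objects (where $\prod$-quantifier-freeness is meant in $p_0$). Dialectica construction. For a fibration $q:\mathsf{D}\to\mathsf{B}$, the category $\mathfrak{Dial}(q)$ has as objects quadruples $(I,X,U,\alpha)$ with $I,X,U\in\mathsf{B}$ and $\alpha\in\mathsf{D}_{I\times X\times U}$; a morphism $(I,X,U,\alpha)\to(J,Y,V,\beta)$ is a quadruple $(f,f_0,f_1,\phi)$ with $f:I\to J$, $f_0:I\times X\to Y$, $f_1:I\times X\times V\to U$ in $\mathsf{B}$ and $\phi:\langle\pi_I,\pi_X,f_1\rangle^*\alpha\to\langle f\pi_I,f_0\langle\pi_I,\pi_X\rangle,\pi_V\rangle^*\beta$ in $\mathsf{D}_{I\times X\times V}$, with the evident composition. $\mathfrak{Dial}(q)$ is fibred over $\mathsf{B}$ by the first component. *)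

(* Defs.v *)
From Stdlib Require Import ssreflect ClassicalEpsilon.

Set Implicit Arguments.
Unset Strict Implicit.
Unset Printing Implicit Defensive.

Record Category := {
  ob :> Type;
  hom : ob -> ob -> Type;
  idc : forall x, hom x x;
  comp : forall x y z, hom y z -> hom x y -> hom x z;
  comp_idl : forall x y (f : hom x y), comp (idc y) f = f;
  comp_idr : forall x y (f : hom x y), comp f (idc x) = f;
  comp_assoc : forall x y z w (h : hom z w) (g : hom y z) (f : hom x y),
    comp h (comp g f) = comp (comp h g) f
}.
Arguments idc {c} x.
Arguments comp {c x y z}.
Notation "g ∘ f" := (comp g f) (at level 40, left associativity).

Definition is_iso (C : Category) (x y : C) (f : hom x y) : Prop :=
  exists g : hom y x, g ∘ f = idc x /\ f ∘ g = idc y.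

Definition isomorphic (C : Category) (x y : C) : Prop :=
  exists f : hom x y, is_iso f.

Record Functor (C D : Category) := {
  fobj :> C -> D;
  fmap : forall x y, hom x y -> hom (fobj x) (fobj y);
  fmap_id : forall x, fmap (idc x) = idc (fobj x);
  fmap_comp : forall x y z (g : hom y z) (f : hom x y),
    fmap (g ∘ f) = fmap g ∘ fmap f
}.
Arguments fmap {C D} f0 {x y}.

Definition idF (C : Category) : Functor C C.
Proof. by exists (fun x => x) (fun x y f => f). Defined.

Definition compF (C D E : Category) (G : Functor D E) (F : Functor C D) :
  Functor C E.
Proof.
exists (fun x => G (F x)) (fun x y f => fmap G (fmap F f)).
- by move=> x; rewrite !fmap_id.
- by move=> x y z g f; rewrite !fmap_comp.
Defined.

Record NatTrans (C D : Category) (F G : Functor C D) := {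
  ntc :> forall x, hom (F x) (G x);
  nt_natural : forall x y (f : hom x y), ntc y ∘ fmap F f = fmap G f ∘ ntc x
}.

Definition is_nat_iso (C D : Category) (F G : Functor C D)
  (t : NatTrans F G) : Prop := forall x, is_iso (t x).

Definition is_equivalence (C D : Category) (F : Functor C D) : Prop :=
  exists (G : Functor D C)
         (s : NatTrans (idF C) (compF G F)) (t : NatTrans (compF F G) (idF D)),
    is_nat_iso s /\ is_nat_iso t.

Record Adjunction (C D : Category) (L : Functor C D) (R : Functor D C) := {
  adj_unit : NatTrans (idF C) (compF R L);
  adj_counit : NatTrans (compF L R) (idF D);
  adj_triangle_l : forall x, adj_counit (L x) ∘ fmap L (adj_unit x) = idc (L x);
  adj_triangle_r : forall y, fmap R (adj_counit y) ∘ adj_unit (R y) = idc (R y)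
}.

Record FiniteProducts (B : Category) := {
  terminal : B;
  bang : forall x, hom x terminal;
  bang_unique : forall x (f : hom x terminal), f = bang x;
  product : B -> B -> B;
  p1 : forall x y, hom (product x y) x;
  p2 : forall x y, hom (product x y) y;
  pairing : forall z x y, hom z x -> hom z y -> hom z (product x y);
  p1_pairing : forall z x y (f : hom z x) (g : hom z y), p1 x y ∘ pairing f g = f;
  p2_pairing : forall z x y (f : hom z x) (g : hom z y), p2 x y ∘ pairing f g = g;
  pairing_unique : forall z x y (h : hom z (product x y)),
    pairing (p1 x y ∘ h) (p2 x y ∘ h) = h
}.
Arguments product {B} f : rename.
Arguments p1 {B f x y} : rename.
Arguments p2 {B f x y} : rename.
Arguments pairing {B f z x y} : rename.

Section ProductFacts.
Variables (B : Category) (FP : FiniteProducts B).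

Lemma pairing_comp z' z x y (f : hom z x) (g : hom z y) (u : hom z' z) :
  pairing (f := FP) f g ∘ u = pairing (f ∘ u) (g ∘ u).
Proof.
rewrite -[LHS]pairing_unique !comp_assoc.
by rewrite p1_pairing p2_pairing.
Qed.

Lemma pairing_id x y : pairing (f := FP) p1 p2 = idc (product FP x y).
Proof. by rewrite -[RHS]pairing_unique !comp_idr. Qed.

Definition times x x' y y' (f : hom x x') (g : hom y y') :
    hom (product FP x y) (product FP x' y') :=
  pairing (f ∘ p1) (g ∘ p2).

End ProductFacts.

Definition cartesian_closed (B : Category) (FP : FiniteProducts B) : Prop :=
  forall X Y : B, exists (E : B) (ev : hom (product FP E X) Y),
    forall (Z : B) (f : hom (product FP Z X) Y),
      exists! g : hom Z E, ev ∘ times FP g (idc X) = f.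

(** A category [E] with a functor [p : E -> B].  Its objects are sorted by
    their image: [fob I] is the collection of objects [α] with [p α = I].
    Arrows are those of [E], not sorted; [over] is the action of [p] on them.
    See [total] and [proj]. *)
Record CatOver (B : Category) := {
  fob :> B -> Type;
  thom : forall I J, fob I -> fob J -> Type;
  tid : forall I (a : fob I), thom a a;
  tcomp : forall I J K (a : fob I) (b : fob J) (c : fob K),
    thom b c -> thom a b -> thom a c;
  tcomp_idl : forall I J (a : fob I) (b : fob J) (f : thom a b),
    tcomp (tid b) f = f;
  tcomp_idr : forall I J (a : fob I) (b : fob J) (f : thom a b),
    tcomp f (tid a) = f;
  tcomp_assoc : forall I J K L (a : fob I) (b : fob J) (c : fob K) (d : fob L)
    (h : thom c d) (g : thom b c) (f : thom a b),
    tcomp h (tcomp g f) = tcomp (tcomp h g) f;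
  over : forall I J (a : fob I) (b : fob J), thom a b -> hom I J;
  over_id : forall I (a : fob I), over (tid a) = idc I;
  over_comp : forall I J K (a : fob I) (b : fob J) (c : fob K)
    (g : thom b c) (f : thom a b), over (tcomp g f) = over g ∘ over f
}.
Arguments tid {B c I} a : rename.
Arguments tcomp {B c I J K a b c0} : rename.
Arguments thom {B c I J} : rename.
Arguments over {B c I J a b} : rename.
Notation "g '•' f" := (tcomp g f) (at level 40, left associativity).

Definition total (B : Category) (E : CatOver B) : Category.
Proof.
refine {| ob := {I : B & E I};
          hom := fun a b => thom (projT2 a) (projT2 b);
          idc := fun a => tid (projT2 a);
          comp := fun a b c g f => g • f |}.
- by move=> *; apply: tcomp_idl.
- by move=> *; apply: tcomp_idr.
- by move=> *; apply: tcomp_assoc.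
Defined.

Definition proj (B : Category) (E : CatOver B) : Functor (total E) B.
Proof.
refine {| fobj := fun a : total E => projT1 a;
          fmap := fun a b f => over f |}.
- by move=> *; apply: over_id.
- by move=> *; apply: over_comp.
Defined.

Definition is_cartesian (B : Category) (E : CatOver B) (I J : B)
    (a : E I) (b : E J) (f : thom a b) : Prop :=
  forall (K : B) (c : E K) (w : hom K I) (g : thom c b),
    over g = over f ∘ w -> exists! h : thom c a, over h = w /\ f • h = g.

(** A splitting makes [u ↦ reindex u] strictly functorial: the chosen lifts
    (together with their domains) of identities and composites are the
    identities and the composites of the chosen lifts. *)
Record SplitFibration (B : Category) := {
  catover :> CatOver B;
  reindex : forall A C (u : hom A C), catover C -> catover A;
  lift : forall A C (u : hom A C) (a : catover C), thom (reindex u a) a;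
  over_lift : forall A C (u : hom A C) (a : catover C), over (lift u a) = u;
  lift_cartesian : forall A C (u : hom A C) (a : catover C),
    is_cartesian (lift u a);
  split_id : forall I (a : catover I),
    existT (fun c : catover I => thom c a) (reindex (idc I) a) (lift (idc I) a)
    = existT (fun c : catover I => thom c a) a (tid a);
  split_comp : forall A C I (u : hom A C) (v : hom C I) (a : catover I),
    existT (fun c : catover A => thom c a)
      (reindex (v ∘ u) a) (lift (v ∘ u) a)
    = existT (fun c : catover A => thom c a)
      (reindex u (reindex v a)) (lift v a • lift u (reindex v a))
}.
Arguments reindex {B s A C} : rename.
Arguments lift {B s A C} : rename.
Arguments over_lift {B s A C} u a : rename.
Arguments lift_cartesian {B s A C} u a : rename.
Arguments split_id {B s I} a : rename.
Arguments split_comp {B s A C I} u v a : rename.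

Definition Vert (B : Category) (E : CatOver B) (I : B) (a b : E I) :=
  {h : thom a b | over h = idc I}.

Definition varr (B : Category) (E : CatOver B) (I : B) (a b : E I)
  (h : Vert a b) : thom a b := proj1_sig h.
Coercion varr : Vert >-> thom.

Lemma over_varr (B : Category) (E : CatOver B) (I : B) (a b : E I)
  (h : Vert a b) : over (varr h) = idc I.
Proof. exact: proj2_sig h. Qed.

Lemma vert_ext (B : Category) (E : CatOver B) (I : B) (a b : E I)
  (h k : Vert a b) : varr h = varr k -> h = k.
Proof.
case: h k => [h hh] [k kk] /= e; subst k.
by rewrite (proof_irrelevance _ hh kk).
Qed.

Definition vid (B : Category) (E : CatOver B) (I : B) (a : E I) : Vert a a :=
  exist _ (tid a) (over_id a).

Definition vcomp (B : Category) (E : CatOver B) (I : B) (a b c : E I)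
  (g : Vert b c) (f : Vert a b) : Vert a c.
Proof.
exists (varr g • varr f).
by rewrite over_comp !over_varr comp_idl.
Defined.

Definition Fib (B : Category) (E : CatOver B) (I : B) : Category.
Proof.
refine {| ob := E I; hom := @Vert B E I; idc := @vid B E I;
          comp := @vcomp B E I |}.
- by move=> x y f; apply: vert_ext; apply: tcomp_idl.
- by move=> x y f; apply: vert_ext; apply: tcomp_idr.
- by move=> x y z w h g f; apply: vert_ext; apply: tcomp_assoc.
Defined.

Lemma varr_id (B : Category) (E : CatOver B) (I : B) (a : Fib E I) :
  varr (idc a) = tid a.
Proof. by []. Qed.

Lemma varr_comp (B : Category) (E : CatOver B) (I : B) (a b c : Fib E I)
  (g : hom b c) (f : hom a b) : varr (g ∘ f) = varr g • varr f.
Proof. by []. Qed.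

(** The vertical identity between equal objects; it mediates between, e.g.,
    [u^* v^* a] and [(v ∘ u)^* a], which are equal but not convertible. *)
Definition castv (B : Category) (E : CatOver B) (I : B) (a b : E I)
    (e : a = b) : hom (c := Fib E I) a b :=
  match e in _ = b return hom (c := Fib E I) a b with
  | eq_refl => idc (c := Fib E I) a
  end.

Definition cart_factor (B : Category) (E : CatOver B) (I J : B)
    (a : E I) (b : E J) (f : thom a b) (cf : is_cartesian f)
    (K : B) (c : E K) (w : hom K I) (g : thom c b) (e : over g = over f ∘ w) :
    {h : thom c a | over h = w /\ f • h = g} :=
  constructive_definite_description _ (cf K c w g e).

Section Reindexing.
Variables (B : Category) (E : SplitFibration B).

Lemma cart_eq (I J : B) (a : E I) (b : E J) (f : thom a b)
    (K : B) (c : E K) (h k : thom c a) :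
  is_cartesian f -> over h = over k -> f • h = f • k -> h = k.
Proof.
move=> cf e1 e2.
have [|x [_ Ux]] := cf K c (over k) (f • k); first by rewrite over_comp.
by rewrite -(Ux h) // -(Ux k).
Qed.

Lemma lift_eq (A C : B) (u : hom A C) (a : E C) (K : B) (c : E K)
    (h k : thom c (reindex u a)) :
  over h = over k -> lift u a • h = lift u a • k -> h = k.
Proof. exact: cart_eq (lift_cartesian u a). Qed.

Lemma reindex_factor_over (A C : B) (u : hom A C) (a b : E C)
    (h : hom (c := Fib E C) a b) :
  over (varr h • lift u a) = over (lift u b) ∘ idc A.
Proof. by rewrite over_comp over_varr !over_lift comp_idl comp_idr. Qed.

Definition reindex_map (A C : B) (u : hom A C) (a b : E C)
    (h : hom (c := Fib E C) a b) :
    hom (c := Fib E A) (reindex u a) (reindex u b) :=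
  let k := cart_factor (lift_cartesian u b) (reindex_factor_over u h) in
  exist _ (proj1_sig k) (proj1 (proj2_sig k)).

Lemma lift_reindex_map (A C : B) (u : hom A C) (a b : E C)
    (h : hom (c := Fib E C) a b) :
  lift u b • varr (reindex_map u h) = varr h • lift u a.
Proof.
rewrite /reindex_map /=.
by case: (cart_factor _ _) => k [].
Qed.

Definition Reidx (A C : B) (u : hom A C) : Functor (Fib E C) (Fib E A).
Proof.
refine {| fobj := @reindex B E A C u : Fib E C -> Fib E A;
          fmap := fun a b h => reindex_map u h |}.
- move=> a; apply: vert_ext; apply: (@lift_eq _ _ u); first by rewrite !over_varr.
  by rewrite lift_reindex_map !varr_id tcomp_idl tcomp_idr.
- move=> a b c g f; apply: vert_ext; apply: (@lift_eq _ _ u).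
    by rewrite !over_varr.
  rewrite lift_reindex_map !varr_comp tcomp_assoc lift_reindex_map.
  by rewrite -!tcomp_assoc lift_reindex_map.
Defined.

Lemma reindex_id (I : B) (a : E I) : reindex (idc I) a = a.
Proof. by have := f_equal (@projT1 _ _) (split_id a). Qed.

Lemma reindex_comp (A C I : B) (u : hom A C) (v : hom C I) (a : E I) :
  reindex (v ∘ u) a = reindex u (reindex v a).
Proof. by have := f_equal (@projT1 _ _) (split_comp u v a). Qed.

Lemma reindex_square (A C C' I : B) (u : hom A C) (v : hom C I)
    (u' : hom A C') (v' : hom C' I) (a : E I) :
  v ∘ u = v' ∘ u' -> reindex u (reindex v a) = reindex u' (reindex v' a).
Proof. by move=> e; rewrite -!reindex_comp e. Qed.

Lemma reindex_section (A C : B) (u : hom A C) (v : hom C A) (a : E A) :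
  v ∘ u = idc A -> reindex u (reindex v a) = a.
Proof. by move=> e; rewrite -reindex_comp e reindex_id. Qed.

End Reindexing.

(** A functor between total categories commuting (strictly) with the
    projections to the base; see [totalF]. *)
Record FunctorOver (B : Category) (D E : CatOver B) := {
  fo_ob :> forall I, D I -> E I;
  fo_map : forall I J (a : D I) (b : D J),
    thom a b -> thom (fo_ob a) (fo_ob b);
  fo_over : forall I J (a : D I) (b : D J) (f : thom a b),
    over (fo_map f) = over f;
  fo_id : forall I (a : D I), fo_map (tid a) = tid (fo_ob a);
  fo_comp : forall I J K (a : D I) (b : D J) (c : D K)
    (g : thom b c) (f : thom a b), fo_map (g • f) = fo_map g • fo_map f
}.
Arguments fo_map {B D E} f {I J a b} : rename.

Definition totalF (B : Category) (D E : CatOver B) (F : FunctorOver D E) :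
  Functor (total D) (total E).
Proof.
refine {| fobj := (fun a => existT _ (projT1 a) (F _ (projT2 a)))
                    : total D -> total E;
          fmap := fun a b f => fo_map F f |}.
- by move=> *; apply: fo_id.
- by move=> *; apply: fo_comp.
Defined.

Definition preserves_cartesian (B : Category) (D E : CatOver B)
    (F : FunctorOver D E) : Prop :=
  forall (I J : B) (a : D I) (b : D J) (f : thom a b),
    is_cartesian f -> is_cartesian (fo_map F f).

Definition equivalent_fibrations (B : Category) (D E : SplitFibration B) : Prop :=
  exists F : FunctorOver D E, preserves_cartesian F /\ is_equivalence (totalF F).

Section FullSub.
Variables (B : Category) (E : SplitFibration B) (P : forall I, E I -> Prop).
Hypothesis HP : forall A C (u : hom A C) (a : E C), P a -> P (reindex u a).

Definition full_sub_over : CatOver B.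
Proof.
refine {| fob := fun I => {a : E I | P a};
          thom := fun I J a b => thom (proj1_sig a) (proj1_sig b);
          tid := fun I a => tid (proj1_sig a);
          tcomp := fun I J K a b c g f => g • f;
          over := fun I J a b f => over f |}.
- by move=> *; apply: tcomp_idl.
- by move=> *; apply: tcomp_idr.
- by move=> *; apply: tcomp_assoc.
- by move=> *; apply: over_id.
- by move=> *; apply: over_comp.
Defined.

Lemma full_sub_sig_eq I J (b : {a : E J | P a}) (x y : {a : E I | P a})
    (f : thom (proj1_sig x) (proj1_sig b)) (g : thom (proj1_sig y) (proj1_sig b)) :
  existT (fun c : E I => thom c (proj1_sig b)) (proj1_sig x) f
  = existT (fun c : E I => thom c (proj1_sig b)) (proj1_sig y) g ->
  existT (fun c : full_sub_over I => thom (c := full_sub_over) c b) x f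
  = existT (fun c : full_sub_over I => thom (c := full_sub_over) c b) y g.
Proof.
case: x y f g => [x px] [y py] /= f g e.
have e1 : x = y := f_equal (@projT1 _ _) e.
subst y; rewrite (proof_irrelevance _ py px).
by rewrite (inj_pair2 _ _ _ _ _ e).
Qed.

Definition full_sub : SplitFibration B.
Proof.
refine {| catover := full_sub_over;
          reindex := fun A C u a =>
            exist _ (reindex u (proj1_sig a)) (HP u (proj2_sig a));
          lift := fun A C u a => lift u (proj1_sig a) |}.
- by move=> A C u a; apply: over_lift.
- by move=> A C u a K c; apply: lift_cartesian.
- by move=> I a; apply: full_sub_sig_eq; apply: split_id.
- by move=> A C I u v a; apply: full_sub_sig_eq; apply: split_comp.
Defined.

End FullSub.

Section Quantifiers.
Variables (B : Category) (FP : FiniteProducts B).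
Local Notation "x × y" := (product FP x y) (at level 39, left associativity).
Local Notation "⟨ f , g ⟩" := (pairing (f := FP) f g).

Lemma p1_times (I J X : B) (f : hom I J) :
  p1 ∘ times FP f (idc X) = f ∘ p1.
Proof. by rewrite p1_pairing. Qed.

Section Fixed.
Variable E : SplitFibration B.

(** The canonical map [∐_{π_I} (f × 1)^* b -> f^* ∐_{π_J} b] is the transpose
    of [(f × 1)^* η_b], where [(f × 1)^* π_J^* = π_I^* f^*] strictly. *)
Definition coprod_bc
    (cop : forall I X : B, Functor (Fib E (I × X)) (Fib E I))
    (adj : forall I X : B, Adjunction (cop I X) (Reidx E p1))
    (I J X : B) (f : hom I J) (b : Fib E (J × X)) :
    hom (cop I X (Reidx E (times FP f (idc X)) b)) (Reidx E f (cop J X b)) :=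
  adj_counit (adj I X) (Reidx E f (cop J X b))
  ∘ fmap (cop I X)
      (castv (reindex_square (cop J X b) (p1_times X f))
       ∘ fmap (Reidx E (times FP f (idc X))) (adj_unit (adj J X) b)).

Record SimpleCoproducts := {
  scoprod : forall I X : B, Functor (Fib E (I × X)) (Fib E I);
  coprod_adj : forall I X : B, Adjunction (scoprod I X) (Reidx E p1);
  coprod_beck_chevalley : forall (I J X : B) (f : hom I J) (b : Fib E (J × X)),
    is_iso (coprod_bc coprod_adj f b)
}.

(** Dually, the transpose of [(f × 1)^* ε_b]. *)
Definition prod_bc
    (pr : forall I X : B, Functor (Fib E (I × X)) (Fib E I))
    (adj : forall I X : B, Adjunction (Reidx E p1) (pr I X))
    (I J X : B) (f : hom I J) (b : Fib E (J × X)) :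
    hom (Reidx E f (pr J X b)) (pr I X (Reidx E (times FP f (idc X)) b)) :=
  fmap (pr I X)
    (fmap (Reidx E (times FP f (idc X))) (adj_counit (adj J X) b)
     ∘ castv (eq_sym (reindex_square (pr J X b) (p1_times X f))))
  ∘ adj_unit (adj I X) (Reidx E f (pr J X b)).

Record SimpleProducts := {
  sprod : forall I X : B, Functor (Fib E (I × X)) (Fib E I);
  prod_adj : forall I X : B, Adjunction (Reidx E p1) (sprod I X);
  prod_beck_chevalley : forall (I J X : B) (f : hom I J) (b : Fib E (J × X)),
    is_iso (prod_bc prod_adj f b)
}.

(** [⟨1, g⟩^* π_A^* c = c] strictly. *)
Lemma reindex_graph (A X : B) (g : hom A X) (c : E A) :
  reindex ⟨idc A, g⟩ (reindex p1 c) = c.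
Proof. by apply: reindex_section; rewrite p1_pairing. Qed.

(** Uniqueness of [g] and of [h'] is uniqueness of the dependent pair. *)
Definition coprod_qf (S : SimpleCoproducts) (I : B) (a : E I) : Prop :=
  forall (A : B) (f : hom A I) (X : B) (b : Fib E (A × X))
         (h : hom (Reidx E f a) (scoprod S A X b)),
    exists! gh : {g : hom A X & hom (Reidx E f a) (Reidx E ⟨idc A, g⟩ b)},
      let (g, h') := gh in
      h = castv (reindex_graph g (scoprod S A X b))
          ∘ fmap (Reidx E ⟨idc A, g⟩) (adj_unit (coprod_adj S A X) b)
          ∘ h'.

Definition enough_coprod_qf (S : SimpleCoproducts) : Prop :=
  forall (I : B) (a : Fib E I), exists (A : B) (b : Fib E (I × A)),
    coprod_qf S b /\ isomorphic a (scoprod S I A b).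

Definition prod_qf (P : SimpleProducts) (I : B) (a : E I) : Prop :=
  forall (A : B) (f : hom A I) (X : B) (b : Fib E (A × X))
         (h : hom (sprod P A X b) (Reidx E f a)),
    exists! gh : {g : hom A X & hom (Reidx E ⟨idc A, g⟩ b) (Reidx E f a)},
      let (g, h') := gh in
      h = h'
          ∘ fmap (Reidx E ⟨idc A, g⟩) (adj_counit (prod_adj P A X) b)
          ∘ castv (eq_sym (reindex_graph g (sprod P A X b))).

Definition enough_prod_qf (P : SimpleProducts) : Prop :=
  forall (I : B) (a : Fib E I), exists (A : B) (b : Fib E (I × A)),
    prod_qf P b /\ isomorphic a (sprod P I A b).

Lemma coprod_qf_reindex (S : SimpleCoproducts) (A C : B) (u : hom A C)
  (a : E C) : coprod_qf S a -> coprod_qf S (reindex u a).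
Proof.
move=> qa A' f; rewrite /= -reindex_comp; exact: qa.
Qed.

End Fixed.

Section SubProducts.
Variables (E : SplitFibration B) (P : forall I, E I -> Prop).
Hypothesis HP : forall A C (u : hom A C) (a : E C), P a -> P (reindex u a).
Variable pr : SimpleProducts E.
Hypothesis Hpr : forall I X (a : E (I × X)), P a -> P (sprod pr I X a).
Local Notation E0 := (full_sub HP).

(** Vertical arrows of the sub-fibration are those of [E]. *)
Definition sub_in (I : B) (a b : E0 I)
    (h : @hom (Fib E I) (proj1_sig a) (proj1_sig b)) : @hom (Fib E0 I) a b :=
  exist _ (varr h) (over_varr h).

Definition sub_out (I : B) (a b : E0 I) (h : @hom (Fib E0 I) a b) :
    @hom (Fib E I) (proj1_sig a) (proj1_sig b) :=
  exist _ (varr h) (over_varr h).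

Lemma sub_outK (I : B) (a b : E0 I) (h : @hom (Fib E0 I) a b) :
  sub_in (sub_out h) = h.
Proof. exact: vert_ext. Qed.

Lemma sub_inK (I : B) (a b : E0 I)
  (h : @hom (Fib E I) (proj1_sig a) (proj1_sig b)) :
  sub_out (a := a) (b := b) (sub_in h) = h.
Proof. exact: vert_ext. Qed.

Lemma sub_out_id (I : B) (a : Fib E0 I) :
  sub_out (idc a) = idc (proj1_sig a : Fib E I).
Proof. exact: vert_ext. Qed.

Lemma sub_out_comp (I : B) (a b c : Fib E0 I) (g : hom b c) (f : hom a b) :
  sub_out (g ∘ f) = sub_out g ∘ sub_out f.
Proof. exact: vert_ext. Qed.

Lemma sub_out_inj (I : B) (a b : E0 I) (h k : @hom (Fib E0 I) a b) :
  sub_out h = sub_out k -> h = k.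
Proof. by move=> e; rewrite -(sub_outK h) e sub_outK. Qed.

Lemma sub_out_castv (I : B) (a b : E0 I) (e : a = b)
  (e' : proj1_sig a = proj1_sig b) :
  sub_out (castv (E := E0) e) = castv (E := E) e'.
Proof.
case: b / e e' => e'; rewrite (proof_irrelevance _ e' eq_refl).
exact: vert_ext.
Qed.

Lemma sub_out_reindex (A C : B) (u : hom A C) (a b : Fib E0 C) (h : hom a b) :
  sub_out (fmap (Reidx E0 u) h) = fmap (Reidx E u) (sub_out h).
Proof.
apply: vert_ext; apply: (@lift_eq _ _ _ _ u); first by rewrite !over_varr.
by rewrite [RHS]lift_reindex_map; apply: (lift_reindex_map (E := E0) u h).
Qed.

Definition sub_prod_ob (I X : B) (a : Fib E0 (I × X)) : Fib E0 I :=
  exist _ (sprod pr I X (proj1_sig a)) (Hpr (proj2_sig a)).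

Definition sub_prod (I X : B) : Functor (Fib E0 (I × X)) (Fib E0 I).
Proof.
refine {| fobj := @sub_prod_ob I X;
          fmap := fun a b h =>
            sub_in (a := sub_prod_ob a) (b := sub_prod_ob b)
              (fmap (sprod pr I X) (sub_out h)) |}.
- by move=> a; apply: sub_out_inj; rewrite sub_inK !sub_out_id; exact: fmap_id.
- move=> a b c g f; apply: sub_out_inj.
  rewrite !sub_out_comp !sub_inK; exact: fmap_comp.
Defined.

Definition sub_unit (I X : B) :
  NatTrans (idF (Fib E0 I)) (compF (sub_prod I X) (Reidx E0 p1)).
Proof.
refine (@Build_NatTrans _ _ (idF (Fib E0 I))
          (compF (sub_prod I X) (Reidx E0 p1))
          (fun a => sub_in (a := a) (b := sub_prod_ob (Reidx E0 p1 a))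
                      (adj_unit (prod_adj pr I X) (proj1_sig a))) _).
move=> a b f; apply: sub_out_inj.
rewrite !sub_out_comp !sub_inK sub_out_reindex.
exact: (nt_natural (adj_unit (prod_adj pr I X)) (sub_out f)).
Defined.

Definition sub_counit (I X : B) :
  NatTrans (compF (Reidx E0 p1) (sub_prod I X)) (idF (Fib E0 (I × X))).
Proof.
refine (@Build_NatTrans _ _ (compF (Reidx E0 p1) (sub_prod I X))
          (idF (Fib E0 (I × X)))
          (fun a => sub_in (a := Reidx E0 p1 (sub_prod_ob a)) (b := a)
                      (adj_counit (prod_adj pr I X) (proj1_sig a))) _).
move=> a b f; apply: sub_out_inj.
rewrite !sub_out_comp !sub_inK sub_out_reindex sub_inK.
exact: (nt_natural (adj_counit (prod_adj pr I X)) (sub_out f)).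
Defined.

Definition sub_adj (I X : B) : Adjunction (Reidx E0 p1) (sub_prod I X).
Proof.
refine {| adj_unit := sub_unit I X; adj_counit := sub_counit I X |}.
- move=> a; apply: sub_out_inj.
  rewrite sub_out_comp sub_out_reindex !sub_inK sub_out_id.
  exact: (adj_triangle_l (prod_adj pr I X) (proj1_sig a)).
- move=> a; apply: sub_out_inj.
  rewrite sub_out_comp !sub_inK sub_out_id.
  exact: (adj_triangle_r (prod_adj pr I X) (proj1_sig a)).
Defined.

Lemma sub_is_iso (I : B) (a b : Fib E0 I) (h : hom a b) :
  is_iso (sub_out h) -> is_iso h.
Proof.
case=> k [e1 e2]; exists (sub_in k); split; apply: sub_out_inj.
- by rewrite sub_out_comp sub_inK e1 sub_out_id.
- by rewrite sub_out_comp sub_inK e2 sub_out_id.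
Qed.

Lemma sub_prod_bc (I J X : B) (f : hom I J) (b : Fib E0 (J × X)) :
  sub_out (prod_bc sub_adj f b) = prod_bc (prod_adj pr) f (proj1_sig b).
Proof.
rewrite /prod_bc !sub_out_comp !sub_inK !sub_out_comp sub_out_reindex !sub_inK.
congr (fmap (sprod pr I X) (_ ∘ _) ∘ _).
exact: sub_out_castv.
Qed.

(** The functors and adjunctions are the restrictions of those of [pr]. *)
Definition sub_products : SimpleProducts E0.
Proof.
refine {| sprod := sub_prod; prod_adj := sub_adj |}.
move=> I J X f b; apply: sub_is_iso; rewrite sub_prod_bc.
exact: prod_beck_chevalley.
Defined.

End SubProducts.

(** The simple products and coproducts of [E] are parameters of both notions. *)
Section Goedel.
Variables (E : SplitFibration B) (P : SimpleProducts E) (S : SimpleCoproducts E).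

Definition coprod_qf_stable : Prop :=
  forall (I X : B) (a : Fib E (I × X)), coprod_qf S a -> coprod_qf S (sprod P I X a).

Record is_Skolem : Prop := {
  Skolem_ccc : cartesian_closed FP;
  Skolem_enough : enough_coprod_qf S;
  Skolem_stable : coprod_qf_stable
}.

Definition coprod_qf_sub : SplitFibration B :=
  full_sub (P := coprod_qf S) (coprod_qf_reindex (S := S)).

Definition coprod_qf_sub_products (sk : is_Skolem) :
    SimpleProducts coprod_qf_sub :=
  sub_products _ (Skolem_stable sk).

Definition is_Goedel : Prop :=
  exists sk : is_Skolem, enough_prod_qf (coprod_qf_sub_products sk).

End Goedel.

Lemma sig_castv (E : SplitFibration B) (A I : B) (a : E I) (x y : E A)
    (f : thom x a) (g : thom y a) (e : y = x) :
  existT (fun c : E A => thom c a) x f = existT (fun c : E A => thom c a) y g ->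
  f • varr (castv e) = g.
Proof.
subst x => e; rewrite -(inj_pair2 _ _ _ _ _ e); exact: tcomp_idr.
Qed.

Lemma lift_cast_comp (E : SplitFibration B) (A C I : B) (u : hom A C)
    (v : hom C I) (w : hom A I) (a : E I)
    (e : reindex w a = reindex u (reindex v a)) :
  v ∘ u = w ->
  lift v a • lift u (reindex v a) • varr (castv e) = lift w a.
Proof.
move=> ew; subst w.
exact: sig_castv (eq_sym (split_comp u v a)).
Qed.

Lemma lift_cast_comp' (E : SplitFibration B) (A C I : B) (u : hom A C)
    (v : hom C I) (w : hom A I) (a : E I)
    (e : reindex u (reindex v a) = reindex w a) :
  v ∘ u = w ->
  lift w a • varr (castv e) = lift v a • lift u (reindex v a).
Proof.
move=> ew; subst w.
exact: sig_castv (split_comp u v a).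
Qed.

Lemma lift_cast_square (E : SplitFibration B) (A C C' I : B) (u : hom A C)
    (v : hom C I) (u' : hom A C') (v' : hom C' I) (a : E I)
    (e : reindex u' (reindex v' a) = reindex u (reindex v a)) :
  v ∘ u = v' ∘ u' ->
  lift v a • lift u (reindex v a) • varr (castv e)
  = lift v' a • lift u' (reindex v' a).
Proof.
move=> ew; apply: sig_castv.
by rewrite -!split_comp ew.
Qed.

Lemma lift_cast_eq (E : SplitFibration B) (A C : B) (u v : hom A C) (a : E C)
    (e : reindex u a = reindex v a) :
  u = v -> lift v a • varr (castv e) = lift u a.
Proof.
move=> ew; subst v; rewrite (proof_irrelevance _ e eq_refl).
exact: tcomp_idr.
Qed.

Lemma reindex_comp_eq (E : SplitFibration B) (A C I : B) (u : hom A C)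
    (v : hom C I) (w : hom A I) (a : E I) :
  v ∘ u = w -> reindex w a = reindex u (reindex v a).
Proof. by move<-; apply: reindex_comp. Qed.

Section Dialectica.
Variable D : SplitFibration B.

Record DialOb (I : B) := {
  d_X : B;
  d_U : B;
  d_ob : D (I × d_X × d_U)
}.

(** [⟨π_I, π_X, f1⟩] and [⟨f π_I, f0 ⟨π_I, π_X⟩, π_V⟩]; note that the first
    projection [I × X × V -> I × X] is [⟨π_I, π_X⟩]. *)
Definition d_src (I X U V : B) (f1 : hom (I × X × V) U) :
  hom (I × X × V) (I × X × U) := ⟨p1, f1⟩.

Definition d_tgt (I X J Y V : B) (f : hom I J) (f0 : hom (I × X) Y) :
  hom (I × X × V) (J × Y × V) := ⟨⟨f ∘ (p1 ∘ p1), f0 ∘ p1⟩, p2⟩.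

Record DialHom (I J : B) (a : DialOb I) (b : DialOb J) := {
  d_f : hom I J;
  d_f0 : hom (I × d_X a) (d_X b);
  d_f1 : hom (I × d_X a × d_U b) (d_U a);
  d_phi : hom (Reidx D (d_src d_f1) (d_ob a))
              (Reidx D (d_tgt (d_U b) d_f d_f0) (d_ob b))
}.

Lemma d_src_p2 (I X U : B) : d_src (p2 : hom (I × X × U) U) = idc _.
Proof. exact: pairing_id. Qed.

Lemma d_tgt_p2 (I X U : B) : d_tgt U (idc I) (p2 : hom (I × X) X) = idc _.
Proof.
by rewrite /d_tgt comp_idl -pairing_comp pairing_id comp_idl pairing_id.
Qed.

Lemma d_id_eq (I : B) (a : DialOb I) :
  reindex (d_src p2) (d_ob a) = reindex (d_tgt (d_U a) (idc I) p2) (d_ob a).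
Proof. by rewrite d_src_p2 d_tgt_p2. Qed.

Definition DialId (I : B) (a : DialOb I) : DialHom a a :=
  {| d_f := idc I; d_f0 := p2; d_f1 := p2; d_phi := castv (d_id_eq a) |}.

Section Comp.
Variables (I J K X U Y V Z W : B).
Variables (f : hom I J) (f0 : hom (I × X) Y) (f1 : hom (I × X × V) U).
Variables (g : hom J K) (g0 : hom (J × Y) Z) (g1 : hom (J × Y × W) V).

Let m : hom (I × X × W) (J × Y × W) := d_tgt W f f0.
Let k : hom (I × X × W) (I × X × V) := d_src (g1 ∘ m).

Lemma d_comp_src : d_src f1 ∘ k = d_src (f1 ∘ k).
Proof. by rewrite /d_src pairing_comp p1_pairing. Qed.

Lemma d_comp_mid : d_tgt V f f0 ∘ k = d_src g1 ∘ m.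
Proof.
rewrite /d_src /d_tgt /k /m !pairing_comp -!comp_assoc /d_src !p1_pairing !p2_pairing.
by [].
Qed.

Lemma d_comp_tgt : d_tgt W g g0 ∘ m = d_tgt W (g ∘ f) (g0 ∘ ⟨f ∘ p1, f0⟩).
Proof.
rewrite /d_tgt /m !pairing_comp -!comp_assoc !p1_pairing !p2_pairing.
by rewrite pairing_comp -!comp_assoc.
Qed.
End Comp.

(** With [m = d_tgt f f0 : I × X × W -> J × Y × W] and
    [k = d_src (g1 m) : I × X × W -> I × X × V], the last component of the
    composite is [m^* ψ] after [k^* φ]. *)
Definition DialComp (I J K : B) (a : DialOb I) (b : DialOb J) (c : DialOb K)
    (G : DialHom b c) (F : DialHom a b) : DialHom a c :=
  let m := d_tgt (d_U c) (d_f F) (d_f0 F) in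
  let k := d_src (d_f1 G ∘ m) in
  {| d_f := d_f G ∘ d_f F;
     d_f0 := d_f0 G ∘ ⟨d_f F ∘ p1, d_f0 F⟩;
     d_f1 := d_f1 F ∘ k;
     d_phi :=
       castv (eq_sym (reindex_comp_eq (d_ob c)
                (d_comp_tgt (d_U c) (d_f F) (d_f0 F) (d_f G) (d_f0 G))))
       ∘ fmap (Reidx D m) (d_phi G)
       ∘ castv (reindex_square (d_ob b) (d_comp_mid (d_f F) (d_f0 F) (d_f1 G)))
       ∘ fmap (Reidx D k) (d_phi F)
       ∘ castv (reindex_comp_eq (d_ob a)
                (d_comp_src (d_f F) (d_f0 F) (d_f1 F) (d_f1 G))) |}.

(** The arrow [⟨π_I, π_X, f1⟩^* a -> b] over [⟨f π_I, f0 ⟨π_I, π_X⟩, π_V⟩]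
    determined by the last component. *)
Definition d_mate (I J : B) (a : DialOb I) (b : DialOb J) (F : DialHom a b) :
    thom (reindex (d_src (d_f1 F)) (d_ob a)) (d_ob b) :=
  lift (d_tgt (d_U b) (d_f F) (d_f0 F)) (d_ob b) • varr (d_phi F).

Lemma over_d_mate (I J : B) (a : DialOb I) (b : DialOb J) (F : DialHom a b) :
  over (d_mate F) = d_tgt (d_U b) (d_f F) (d_f0 F).
Proof. by rewrite over_comp over_varr over_lift comp_idr. Qed.

Lemma DialHom_ext (I J : B) (a : DialOb I) (b : DialOb J) (F G : DialHom a b) :
  d_f F = d_f G -> d_f0 F = d_f0 G -> d_f1 F = d_f1 G ->
  (forall x, over x = idc _ ->
     lift (d_src (d_f1 F)) (d_ob a) • x = lift (d_src (d_f1 G)) (d_ob a) ->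
     d_mate F • x = d_mate G) ->
  F = G.
Proof.
case: F G => [f f0 f1 p] [g g0 g1 q] /= e e0 e1; subst g g0 g1 => H.
congr Build_DialHom; apply: vert_ext.
apply: (@lift_eq _ _ _ _ (d_tgt (d_U b) f f0)); first by rewrite !over_varr.
have := H (tid _) (over_id _) (tcomp_idr _).
by rewrite tcomp_idr.
Qed.

Lemma DialHom_mate (I J : B) (a : DialOb I) (b : DialOb J) (F G : DialHom a b) :
  F = G -> forall x, over x = idc _ ->
     lift (d_src (d_f1 F)) (d_ob a) • x = lift (d_src (d_f1 G)) (d_ob a) ->
     d_mate F • x = d_mate G.
Proof.
move=> e; subst G => x ox l.
have -> : x = tid _.
  by apply: lift_eq; rewrite ?over_id // l tcomp_idr.
exact: tcomp_idr.
Qed.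

Lemma d_mate_id (I : B) (a : DialOb I) :
  d_mate (DialId a) = lift (d_src p2) (d_ob a).
Proof. by apply: lift_cast_eq; rewrite d_src_p2 d_tgt_p2. Qed.

Lemma d_mate_comp (I J K : B) (a : DialOb I) (b : DialOb J) (c : DialOb K)
    (G : DialHom b c) (F : DialHom a b)
    (m := d_tgt (d_U c) (d_f F) (d_f0 F)) (k := d_src (d_f1 G ∘ m))
    (x : thom (reindex (d_src (d_f1 (DialComp G F))) (d_ob a))
              (reindex (d_src (d_f1 F)) (d_ob a)))
    (z : thom (reindex (d_src (d_f1 (DialComp G F))) (d_ob a))
              (reindex (d_src (d_f1 G)) (d_ob b))) :
  over x = k ->
  lift (d_src (d_f1 F)) (d_ob a) • x
    = lift (d_src (d_f1 (DialComp G F))) (d_ob a) ->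
  over z = m ->
  lift (d_src (d_f1 G)) (d_ob b) • z = d_mate F • x ->
  d_mate (DialComp G F) = d_mate G • z.
Proof.
move=> ox lx oz lz.
rewrite /d_mate; cbn [d_phi d_f d_f0 d_f1 DialComp]; rewrite -/m -/k.
rewrite !varr_comp !tcomp_assoc.
rewrite lift_cast_comp'; first exact: d_comp_tgt.
rewrite -(tcomp_assoc (lift _ (d_ob c)) (lift m _) (varr (reindex_map m _))).
rewrite lift_reindex_map tcomp_assoc -!(tcomp_assoc (lift _ _ • varr (d_phi G))).
congr (_ • _); apply: lift_eq.
  by rewrite !over_comp !over_varr over_lift !comp_idr oz.
rewrite lz !tcomp_assoc.
rewrite lift_cast_square; first by rewrite d_comp_mid.
rewrite -(tcomp_assoc (lift _ (d_ob b)) (lift k _) (varr (reindex_map k _))).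
rewrite lift_reindex_map tcomp_assoc -!(tcomp_assoc (lift _ _ • varr (d_phi F))).
congr (_ • _); apply: lift_eq.
  by rewrite !over_comp !over_varr over_lift !comp_idr ox.
by rewrite lx tcomp_assoc lift_cast_comp; first exact: d_comp_src.
Qed.

Lemma d_mate_comp_ex (I J K : B) (a : DialOb I) (b : DialOb J) (c : DialOb K)
    (G : DialHom b c) (F : DialHom a b)
    (m := d_tgt (d_U c) (d_f F) (d_f0 F)) (k := d_src (d_f1 G ∘ m)) :
  exists (x : thom (reindex (d_src (d_f1 (DialComp G F))) (d_ob a))
                   (reindex (d_src (d_f1 F)) (d_ob a)))
         (z : thom (reindex (d_src (d_f1 (DialComp G F))) (d_ob a))
                   (reindex (d_src (d_f1 G)) (d_ob b))),
    over x = k /\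
    lift (d_src (d_f1 F)) (d_ob a) • x
      = lift (d_src (d_f1 (DialComp G F))) (d_ob a) /\
    over z = m /\
    lift (d_src (d_f1 G)) (d_ob b) • z = d_mate F • x /\
    d_mate (DialComp G F) = d_mate G • z.
Proof.
have [|x [[ox lx] _]] := lift_cartesian (d_src (d_f1 F)) (d_ob a) _
  (reindex (d_src (d_f1 (DialComp G F))) (d_ob a)) k (lift _ _).
  by rewrite !over_lift d_comp_src.
have [|z [[oz lz] _]] := lift_cartesian (d_src (d_f1 G)) (d_ob b) _
  (reindex (d_src (d_f1 (DialComp G F))) (d_ob a)) m (d_mate F • x).
  by rewrite over_comp over_d_mate ox over_lift d_comp_mid.
by exists x, z; do 4!split => //; apply: d_mate_comp ox lx oz lz.
Qed.

Lemma DialComp_idl (I J : B) (a : DialOb I) (b : DialOb J) (F : DialHom a b) :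
  DialComp (DialId b) F = F.
Proof.
have [x0 [z0 [ox0 [lx0 [oz0 [lz0 E]]]]]] := d_mate_comp_ex (DialId b) F.
apply: DialHom_ext => [/=|/=|/=|x ox lx].
- exact: comp_idl.
- exact: p2_pairing.
- by rewrite /d_tgt p2_pairing d_src_p2 comp_idr.
- rewrite E d_mate_id lz0 -tcomp_assoc.
have -> : x0 • x = tid _; last exact: tcomp_idr.
apply: lift_eq; last by rewrite tcomp_assoc lx0 lx tcomp_idr.
by rewrite over_comp ox ox0 over_id comp_idr /= /d_tgt p2_pairing d_src_p2.
Qed.

Lemma DialComp_idr (I J : B) (a : DialOb I) (b : DialOb J) (F : DialHom a b) :
  DialComp F (DialId a) = F.
Proof.
have [x0 [z0 [ox0 [lx0 [oz0 [lz0 E]]]]]] := d_mate_comp_ex F (DialId a).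
have e1 : d_tgt (d_U b) (idc I) (p2 : hom (I × d_X a) _) = idc _.
  exact: d_tgt_p2.
apply: DialHom_ext => [/=|/=|/=|x ox lx].
- exact: comp_idr.
- by rewrite comp_idl pairing_id comp_idr.
- by rewrite /d_src p2_pairing e1 comp_idr.
- rewrite E -tcomp_assoc.
have -> : z0 • x = tid _; last exact: tcomp_idr.
apply: lift_eq.
  by rewrite over_comp ox oz0 over_id comp_idr.
by rewrite tcomp_assoc lz0 d_mate_id lx0 lx tcomp_idr.
Qed.

Lemma DialComp_assoc (I J K L : B) (a : DialOb I) (b : DialOb J) (c : DialOb K)
    (d : DialOb L) (H : DialHom c d) (G : DialHom b c) (F : DialHom a b) :
  DialComp H (DialComp G F) = DialComp (DialComp H G) F.
Proof.
have [x0 [z0 [ox0 [lx0 [oz0 [lz0 E0]]]]]] := d_mate_comp_ex G F.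
have [x1 [z1 [ox1 [lx1 [oz1 [lz1 E1]]]]]] := d_mate_comp_ex H (DialComp G F).
have [x2 [z2 [ox2 [lx2 [oz2 [lz2 E2]]]]]] := d_mate_comp_ex (DialComp H G) F.
have [x3 [z3 [ox3 [lx3 [oz3 [lz3 E3]]]]]] := d_mate_comp_ex H G.
have ef0 : d_f0 (DialComp H (DialComp G F)) = d_f0 (DialComp (DialComp H G) F).
  by rewrite /= -!comp_assoc pairing_comp -!comp_assoc p1_pairing.
have et : d_tgt (d_U d) (d_f (DialComp G F)) (d_f0 (DialComp G F))
     = d_tgt (d_U d) (d_f G) (d_f0 G) ∘ d_tgt (d_U d) (d_f F) (d_f0 F).
  by rewrite d_comp_tgt.
have em : d_tgt (d_U c) (d_f F) (d_f0 F)
     ∘ d_src (d_f1 H ∘ d_tgt (d_U d) (d_f (DialComp G F)) (d_f0 (DialComp G F)))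
   = d_src (d_f1 H ∘ d_tgt (d_U d) (d_f G) (d_f0 G))
     ∘ d_tgt (d_U d) (d_f F) (d_f0 F).
  by rewrite et comp_assoc d_comp_mid.
have es : d_src (d_f1 G ∘ d_tgt (d_U c) (d_f F) (d_f0 F))
     ∘ d_src (d_f1 H ∘ d_tgt (d_U d) (d_f (DialComp G F)) (d_f0 (DialComp G F)))
   = d_src (d_f1 (DialComp H G) ∘ d_tgt (d_U d) (d_f F) (d_f0 F)).
  by rewrite d_comp_src; congr d_src; rewrite /= -!comp_assoc em.
apply: DialHom_ext => [/=|/=|/=|x ox lx].
- exact: comp_assoc.
- exact: ef0.
- rewrite -comp_assoc; congr (_ ∘ _); exact: es.
- rewrite E1 E2 E3; move: (d_mate H) => mH; rewrite -!tcomp_assoc; congr (_ • _).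
apply: lift_eq; first by rewrite !over_comp ox oz1 oz2 oz3 comp_idr et.
rewrite !tcomp_assoc lz1 lz3 E0; move: (d_mate G) => mG; rewrite -!tcomp_assoc; congr (_ • _).
apply: lift_eq; first by rewrite !over_comp ox oz0 ox1 oz2 ox3 comp_idr em.
rewrite !tcomp_assoc lz0 lx3 lz2; move: (d_mate F) => mF; rewrite -!tcomp_assoc; congr (_ • _).
apply: lift_eq; first by rewrite !over_comp ox ox0 ox1 ox2 comp_idr es.
by rewrite !tcomp_assoc lx0 lx1 lx lx2.
Qed.

Definition DialOver : CatOver B.
Proof.
refine {| fob := DialOb; thom := DialHom; tid := DialId; tcomp := DialComp;
          over := d_f |}.
- exact: DialComp_idl.
- exact: DialComp_idr.
- exact: DialComp_assoc.
- by [].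
- by [].
Defined.

Definition d_reindex (I J : B) (u : hom I J) (b : DialOb J) : DialOb I :=
  {| d_X := d_X b; d_U := d_U b;
     d_ob := reindex (times FP (times FP u (idc (d_X b))) (idc (d_U b))) (d_ob b) |}.

Lemma d_lift_eq (I J X U : B) (u : hom I J) :
  times FP (times FP u (idc X)) (idc U) ∘ d_src p2 = d_tgt U u p2.
Proof.
rewrite d_src_p2 comp_idr /d_tgt /times !comp_idl pairing_comp.
by rewrite -!comp_assoc.
Qed.

Definition d_lift (I J : B) (u : hom I J) (b : DialOb J) :
    DialHom (d_reindex u b) b :=
  @Build_DialHom I J (d_reindex u b) b u p2 p2
    (castv (eq_sym (reindex_comp_eq (d_ob b) (d_lift_eq _ _ u)))).

Lemma d_mate_lift (I J : B) (u : hom I J) (b : DialOb J) :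
  d_mate (d_lift u b)
  = lift (times FP (times FP u (idc (d_X b))) (idc (d_U b))) (d_ob b)
    • lift (d_src p2) (d_ob (d_reindex u b)).
Proof. by apply: lift_cast_comp'; apply: d_lift_eq. Qed.

Lemma d_factor_eq (K I J X U Y : B) (u : hom I J) (w : hom K I)
    (f0 : hom (K × Y) X) :
  times FP (times FP u (idc X)) (idc U) ∘ d_tgt U w f0 = d_tgt U (u ∘ w) f0.
Proof.
rewrite /d_tgt /times !comp_idl !pairing_comp -!comp_assoc !p1_pairing !p2_pairing.
by [].
Qed.

Lemma d_comp_lift_f1 (K I J : B) (u : hom I J) (b : DialOb J) (c : DialOb K)
    (M : DialHom c (d_reindex u b)) :
  d_f1 (DialComp (d_lift u b) M) = d_f1 M.
Proof. by rewrite /= /d_tgt p2_pairing d_src_p2 comp_idr. Qed.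

Lemma d_mate_comp_lift (K I J : B) (u : hom I J) (b : DialOb J) (c : DialOb K)
    (M : DialHom c (d_reindex u b))
    (x : thom (reindex (d_src (d_f1 M)) (d_ob c))
              (reindex (d_src (d_f1 (DialComp (d_lift u b) M))) (d_ob c))) :
  over x = idc _ ->
  lift (d_src (d_f1 (DialComp (d_lift u b) M))) (d_ob c) • x
    = lift (d_src (d_f1 M)) (d_ob c) ->
  d_mate (DialComp (d_lift u b) M) • x
    = lift (times FP (times FP u (idc (d_X b))) (idc (d_U b))) (d_ob b)
      • d_mate M.
Proof.
move=> ox lx.
have [x0 [z0 [ox0 [lx0 [oz0 [lz0 E]]]]]] := d_mate_comp_ex (d_lift u b) M.
rewrite E d_mate_lift; move: (d_mate M) lz0 => mM lz0.
rewrite -!tcomp_assoc (tcomp_assoc _ z0) lz0 -tcomp_assoc.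
have -> : x0 • x = tid _; last by rewrite tcomp_idr.
apply: lift_eq; last by rewrite tcomp_assoc lx0 lx tcomp_idr.
by rewrite over_comp ox ox0 over_id comp_idr /= /d_tgt p2_pairing d_src_p2.
Qed.

Lemma lift_transport (A C : B) (u v : hom A C) (a : D C) : u = v ->
  exists x : thom (reindex u a) (reindex v a),
    over x = idc A /\ lift v a • x = lift u a.
Proof.
by move=> ->; exists (tid _); rewrite over_id tcomp_idr.
Qed.

Lemma d_comp_lift_inj (K I J : B) (u : hom I J) (b : DialOb J) (c : DialOb K)
    (M N : DialHom c (d_reindex u b)) :
  d_f M = d_f N -> DialComp (d_lift u b) M = DialComp (d_lift u b) N -> M = N.
Proof.
move=> ef E.
have e0 : d_f0 M = d_f0 N.
  by have := f_equal (@d_f0 _ _ _ _) E; rewrite /= !p2_pairing.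
have e1 : d_f1 M = d_f1 N by rewrite -!(d_comp_lift_f1 (u := u)) E.
apply: DialHom_ext => // x ox lx.
have [y [oy ly]] := lift_transport (d_ob c)
  (f_equal (@d_src _ _ _ _) (eq_sym (d_comp_lift_f1 M))).
have [z [oz lz]] := lift_transport (d_ob c)
  (f_equal (@d_src _ _ _ _) (eq_sym (d_comp_lift_f1 N))).
have [t [ot lt]] := lift_transport (d_ob c)
  (f_equal (@d_src _ _ _ _) (f_equal (@d_f1 _ _ _ _) (eq_sym E))).
have Em := d_mate_comp_lift oy ly.
have En := d_mate_comp_lift oz lz.
have Emn := DialHom_mate E ot lt.
have oMN : over (d_mate M • x) = over (d_mate N).
  by rewrite over_comp ox comp_idr !over_d_mate ef e0.
apply: lift_eq oMN _.
rewrite tcomp_assoc -Em -En -Emn; move: (d_mate (DialComp _ M)) => mM.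
rewrite -!tcomp_assoc; congr (_ • _).
apply: lift_eq; first by rewrite !over_comp ox oy ot oz.
by rewrite !tcomp_assoc ly lx lt lz.
Qed.

Lemma d_lift_cartesian (I J : B) (u : hom I J) (b : DialOb J) :
  is_cartesian (E := DialOver) (a := d_reindex u b : DialOver I)
    (b := b : DialOver J) (d_lift u b).
Proof.
move=> K c w G /= eG.
case: G eG => f f0 f1 phi /= eG; subst f.
pose e := reindex_comp_eq (d_ob b) (d_factor_eq (d_U b) u w f0).
pose M := @Build_DialHom K I c (d_reindex u b) w f0 f1 (castv e ∘ phi).
have EM : DialComp (d_lift u b) M = @Build_DialHom K J c b (u ∘ w) f0 f1 phi.
{ apply: DialHom_ext => [/=|/=||x ox lx].
  - by [].
  - exact: p2_pairing.
  - exact: d_comp_lift_f1.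
  - rewrite (@d_mate_comp_lift K I J u b c M x ox lx) /d_mate varr_comp !tcomp_assoc.
    rewrite (lift_cast_comp (u := d_tgt (d_U b) w f0)) //.
    exact: d_factor_eq. }
exists M; split; first by split.
by move=> N [ef EN]; apply: d_comp_lift_inj; rewrite ?EM.
Qed.

Lemma Dial_sig_eq (I J X U : B) (x y : D (I × X × U)) (b : DialOb J)
    (F : DialHom {| d_ob := x |} b) (G : DialHom {| d_ob := y |} b)
    (e : x = y) :
  d_f F = d_f G -> d_f0 F = d_f0 G -> d_f1 F = d_f1 G ->
  (forall t, over t = idc _ ->
     lift (d_src (d_f1 F)) x • t = varr (castv (eq_sym e)) • lift (d_src (d_f1 G)) y ->
     d_mate F • t = d_mate G) ->
  existT (fun c : DialOver I => thom c (b : DialOver J)) {| d_ob := x |} F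
  = existT (fun c : DialOver I => thom c (b : DialOver J)) {| d_ob := y |} G.
Proof.
subst y => e e0 e1 H; congr existT; apply: DialHom_ext => // t ot lt.
by apply: H; rewrite //= tcomp_idl.
Qed.

Lemma times_id (X Y : B) : times FP (idc X) (idc Y) = idc _.
Proof. by rewrite /times !comp_idl pairing_id. Qed.

Lemma times_comp (X X' X'' Y : B) (f : hom X X') (g : hom X' X'') :
  times FP g (idc Y) ∘ times FP f (idc Y) = times FP (g ∘ f) (idc Y).
Proof.
by rewrite /times pairing_comp -!comp_assoc p1_pairing p2_pairing !comp_idl.
Qed.

Lemma lift_cast_id (A : B) (u : hom A A) (a : D A) (e : a = reindex u a) :
  u = idc A -> lift u a • varr (castv e) = tid a.
Proof. by move=> eu; subst u; apply: sig_castv (split_id a). Qed.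

Lemma Dial_split_id (I : B) (a : DialOb I) :
  existT (fun c : DialOver I => thom c (a : DialOver I))
    (d_reindex (idc I) a) (d_lift (idc I) a)
  = existT (fun c : DialOver I => thom c (a : DialOver I)) a (DialId a).
Proof.
case: a => X U a.
have et : times FP (times FP (idc I) (idc X)) (idc U) = idc _.
  by rewrite !times_id.
have e : reindex (times FP (times FP (idc I) (idc X)) (idc U)) a = a.
  by rewrite et reindex_id.
apply: (Dial_sig_eq (F := d_lift (idc I) {| d_ob := a |})
          (G := DialId {| d_ob := a |}) (e := e)) => // t ot lt.
rewrite d_mate_lift -tcomp_assoc d_mate_id.
by rewrite [X in _ • X]lt tcomp_assoc lift_cast_id // tcomp_idl.
Qed.

Lemma Dial_split_comp (A C I : B) (u : hom A C) (v : hom C I) (a : DialOb I) :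
  existT (fun c : DialOver A => thom c (a : DialOver I))
    (d_reindex (v ∘ u) a) (d_lift (v ∘ u) a)
  = existT (fun c : DialOver A => thom c (a : DialOver I))
    (d_reindex u (d_reindex v a))
    (DialComp (d_lift v a) (d_lift u (d_reindex v a))).
Proof.
have et : times FP (times FP v (idc (d_X a))) (idc (d_U a))
     ∘ times FP (times FP u (idc (d_X a))) (idc (d_U a))
   = times FP (times FP (v ∘ u) (idc (d_X a))) (idc (d_U a)).
  by rewrite !times_comp.
pose e := reindex_comp_eq (d_ob a) et.
apply: (Dial_sig_eq (F := d_lift (v ∘ u) a)
  (G := DialComp (d_lift v a) (d_lift u (d_reindex v a))) (e := e))
  => [/=|/=||t ot lt].
- by [].
- by rewrite p2_pairing.
- by rewrite d_comp_lift_f1.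
- set G := DialComp _ _.
have e1 : d_f1 G = p2 := d_comp_lift_f1 (d_lift u (d_reindex v a)).
pose y := d_ob (d_reindex u (d_reindex v a)).
have [x [ox lx]] := lift_transport y (f_equal (@d_src _ _ _ _) (eq_sym e1)).
have [z [oz lz]] := lift_transport y (f_equal (@d_src _ _ _ _) e1).
have EG := @d_mate_comp_lift A C I v a _ (d_lift u (d_reindex v a)) x ox lx.
have xz : x • z = tid _.
  apply: lift_eq; first by rewrite over_comp ox oz over_id comp_idl.
  by rewrite tcomp_assoc lx lz tcomp_idr.
have -> : d_mate G = d_mate G • x • z by rewrite -tcomp_assoc xz tcomp_idr.
rewrite EG !d_mate_lift -!tcomp_assoc.
move: lt; rewrite /= => lt; rewrite [X in _ • X]lt.
rewrite [X in _ = _ • (_ • X)]lz !tcomp_assoc; congr (_ • _).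
exact: lift_cast_comp'.
Qed.

Definition Dial : SplitFibration B.
Proof.
refine {| catover := DialOver; reindex := d_reindex; lift := d_lift |}.
- by [].
- exact: d_lift_cartesian.
- exact: Dial_split_id.
- exact: Dial_split_comp.
Defined.

End Dialectica.
End Quantifiers.

(* Main.v *)
From Stdlib Require Import ssreflect ClassicalEpsilon.
Require Import Defs.

Set Implicit Arguments.
Unset Strict Implicit.
Unset Printing Implicit Defensive.
Set Bullet Behavior "None".

(** Write [I; X; U; α] for the object of [Dial p'] with components [X], [U] and
    matrix [α].  It should be thought of as [∐_X ∏_U α], and the theorem
    characterizes the fibrations all of whose objects and arrows arise in this way.

    In [Dial p'] every object [I; X; U; α] is a coproduct over [X] of
    [I × X; 1; U; α], and the latter is a product over [U] of [I × X × U; 1; 1; α].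
    An arrow out of [A; 1; U; a] has a second component defined on [A × 1], i.e. on
    [A], so an arrow into a coproduct comes with exactly one witness: objects with
    [X] terminal are [∐]-quantifier-free, and, up to isomorphism, nothing else is.
    In the same way an arrow from [I; 1; W; a] to [J; 1; 1; c] has a third component
    defined on [I × 1 × 1], which names the instance of a product that it uses:
    objects [J; 1; 1; c] are [∏]-quantifier-free among the [∐]-quantifier-free ones.
    The product over [X] of [I × X; 1; U; a] is [I; 1; X × U; a], so that
    [∐]-quantifier-free objects are stable under products.  Hence [Dial p'] satisfies
    the conditions on a Goedel fibration ([dial_intrinsic_Goedel]), and these are
    invariant under equivalence ([intrinsic_Goedel_transport]).

    Conversely let [p] be a Goedel fibration and let [p'] be its full subfibration on
    the objects that are quantifier-free in both senses.  Every object of [p] is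
    isomorphic to some [∐_X ∏_U α] with [α] in [p'].  An arrow
    [∐_X ∏_U α -> ∐_Y ∏_V β] over [f] is an arrow [∏_U α -> ∐_Y ∏_V β]; as [∏_U α]
    is [∐]-quantifier-free it is an arrow [∏_U α -> ∏_V β] together with a witness
    [f0 : I × X -> Y]; by the universal property of [∏_V] it is an arrow
    [π_V^* ∏_U α -> β]; and as [β] is [∏]-quantifier-free it is an arrow out of an
    instance [⟨π_I, π_X, f1⟩^* α] together with [f1 : I × X × V -> U].  This is an
    arrow of [Dial p'] ([interpret_full], [interpret_faithful]), and the
    correspondence respects composition ([realizes_comp]).

    All of this is carried out in the total category, where a coproduct is a
    universal arrow [β -> ∐β] over the projection and a product is a universal span
    [∏β <- π^*∏β -> β].  Vertical arrows into a reindexed object are arrows over the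
    reindexing map, so that the chosen reindexings, their strictness and the
    canonical maps of the Beck-Chevalley conditions enter only in the comparison
    with the adjoint description ([is_GoedelP]). *)

(** * Cartesian arrows and isomorphisms of a total category *)

Ltac splits := lazymatch goal with |- _ /\ _ => split; [|splits] | |- _ => idtac end.

Section Arrows.
Variables (B : Category) (E : CatOver B).

Definition tiso I J (a : E I) (b : E J) (f : thom a b) : Prop :=
  exists g : thom b a, g • f = tid a /\ f • g = tid b.

Lemma cart_lift (I J : B) (a : E I) (b : E J) (f : thom a b) (K : B) (c : E K)
    (w : hom K I) (g : thom c b) :
  is_cartesian f -> over g = over f ∘ w ->
  exists h : thom c a, over h = w /\ f • h = g.
Proof. by move=> cf e; have [h [H _]] := cf K c w g e; exists h. Qed.

Lemma cart_inj (I J : B) (a : E I) (b : E J) (f : thom a b)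
    (K : B) (c : E K) (h k : thom c a) :
  is_cartesian f -> over h = over k -> f • h = f • k -> h = k.
Proof.
move=> cf e1 e2.
have [|x [_ Ux]] := cf K c (over k) (f • k); first by rewrite over_comp.
by rewrite -(Ux h) // -(Ux k).
Qed.

Lemma tiso_epi I J (a : E I) (b : E J) (f : thom a b) K (c : E K) (x y : thom b c) :
  tiso f -> x • f = y • f -> x = y.
Proof.
by move=> [g [_ fg]] e; rewrite -(tcomp_idr x) -(tcomp_idr y) -fg !tcomp_assoc e.
Qed.

Lemma tiso_mono I J (a : E I) (b : E J) (f : thom a b) K (c : E K) (x y : thom c a) :
  tiso f -> f • x = f • y -> x = y.
Proof.
by move=> [g [gf _]] e; rewrite -(tcomp_idl x) -(tcomp_idl y) -gf -!tcomp_assoc e.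
Qed.

Lemma tiso_id I (a : E I) : tiso (tid a).
Proof. by exists (tid a); rewrite tcomp_idl. Qed.

Lemma tiso_comp I J K (a : E I) (b : E J) (c : E K) (g : thom b c) (f : thom a b) :
  tiso g -> tiso f -> tiso (g • f).
Proof.
move=> [g' [g1 g2]] [f' [f1 f2]]; exists (f' • g'); split.
- by rewrite -tcomp_assoc (tcomp_assoc g') g1 tcomp_idl.
- by rewrite -tcomp_assoc (tcomp_assoc f) f2 tcomp_idl.
Qed.

Lemma tiso_cartesian I J (a : E I) (b : E J) (f : thom a b) :
  tiso f -> is_cartesian f.
Proof.
move=> [g [gf fg]] K c w h e.
exists (g • h); split; first split.
- have e1 : over g ∘ over f = idc I by rewrite -over_comp gf over_id.
  by rewrite over_comp e comp_assoc e1 comp_idl.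
- by rewrite tcomp_assoc fg tcomp_idl.
- by move=> h' [_ <-]; rewrite tcomp_assoc gf tcomp_idl.
Qed.

Lemma cartesian_comp I J K (a : E I) (b : E J) (c : E K) (g : thom b c) (f : thom a b) :
  is_cartesian g -> is_cartesian f -> is_cartesian (g • f).
Proof.
move=> cg cf L d w h; rewrite over_comp -comp_assoc => e.
have [k [ok ek]] := cart_lift cg e.
have [m [om em]] := cart_lift cf ok.
exists m; split; first by rewrite -tcomp_assoc em.
move=> m' [om' em']; apply: (cart_inj cf); first by rewrite om.
rewrite em; apply: (cart_inj cg); first by rewrite over_comp om' ok.
by rewrite ek -em' tcomp_assoc.
Qed.

Lemma cartesian_cancel I J K (a : E I) (b : E J) (c : E K) (g : thom b c) (f : thom a b) :
  is_cartesian g -> is_cartesian (g • f) -> is_cartesian f.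
Proof.
move=> cg cgf L d w h e.
have [|k [ok ek]] := cart_lift cgf (g := g • h) (w := w).
  by rewrite !over_comp e comp_assoc.
exists k; split; first split => //.
- apply: (cart_inj cg); last by rewrite tcomp_assoc.
  by rewrite over_comp ok.
- move=> k' [ok' ek']; apply: (cart_inj cgf); first by rewrite ok.
  by rewrite ek -tcomp_assoc ek'.
Qed.

Lemma cartesian_tiso I J (a : E I) (b : E J) (f : thom a b) :
  is_cartesian f -> is_iso (over f) -> tiso f.
Proof.
move=> cf [v [vf fv]].
have [|g [og eg]] := cart_lift cf (g := tid b) (w := v).
  by rewrite over_id fv.
exists g; split => //; apply: (cart_inj cf).
- by rewrite over_comp og vf over_id.
- by rewrite tcomp_assoc eg tcomp_idl tcomp_idr.
Qed.

Lemma cartesian_compare I J (a a' : E I) (b : E J) (f : thom a b) (f' : thom a' b) :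
  is_cartesian f -> is_cartesian f' -> over f = over f' ->
  exists x : thom a' a, over x = idc I /\ f • x = f' /\ tiso x.
Proof.
move=> cf cf' e.
have [|x [ox ex]] := cart_lift cf (g := f') (w := idc I).
  by rewrite comp_idr e.
exists x; split=> //; split=> //; apply: cartesian_tiso.
- by apply: (cartesian_cancel cf); rewrite ex.
- by rewrite ox; exists (idc I); rewrite comp_idl.
Qed.

Lemma tiso_inv I J (a : E I) (b : E J) (f : thom a b) :
  tiso f -> exists g, g • f = tid a /\ f • g = tid b /\ tiso g.
Proof. by move=> [g [gf fg]]; exists g; splits=> //; exists f. Qed.

Lemma tiso_inv_vert I (a b : E I) (f : thom a b) :
  over f = idc I -> tiso f ->
  exists g, over g = idc I /\ g • f = tid a /\ f • g = tid b /\ tiso g.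
Proof.
move=> of0 /tiso_inv [g [gf [fg ig]]]; exists g.
have og : over g = idc I by have := over_id a; rewrite -gf over_comp of0 comp_idr.
by splits=> //.
Qed.

Lemma over_inv (I J : B) (a : E I) (b : E J) (f : thom a b) (g : thom b a)
  (v : hom J I) : g • f = tid a -> over f ∘ v = idc J -> over g = v.
Proof.
move=> e ev; rewrite -[LHS]comp_idr -ev comp_assoc -over_comp e over_id.
exact: comp_idl.
Qed.

End Arrows.

Section ProductArrows.
Variables (B : Category) (FP : FiniteProducts B).
Local Notation "x × y" := (product FP x y) (at level 39, left associativity).
Local Notation "⟨ f , g ⟩" := (pairing (f := FP) f g).

Lemma pair_ext (Z X Y : B) (h k : hom Z (X × Y)) :
  p1 ∘ h = p1 ∘ k -> p2 ∘ h = p2 ∘ k -> h = k.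
Proof.
by move=> e1 e2; rewrite -(pairing_unique h) -(pairing_unique k) e1 e2.
Qed.

Lemma pairing_graph (Z X Y : B) (u : hom Z X) (h : hom Z (X × Y)) :
  p1 ∘ h = u -> h = ⟨u, p2 ∘ h⟩.
Proof. by move=> <-; rewrite pairing_unique. Qed.

Lemma terminal_unique (Z : B) (f g : hom Z (terminal FP)) : f = g.
Proof. by rewrite (bang_unique f) (bang_unique g). Qed.

Lemma pairing_terminal (Z X : B) (h : hom Z (X × terminal FP)) (f : hom Z (terminal FP)) :
  ⟨p1 ∘ h, f⟩ = h.
Proof. by rewrite -[RHS]pairing_unique (terminal_unique f (p2 ∘ h)). Qed.

Lemma over_graph (Z X Y : B) (f : hom Z X) (g : hom Z Y) :
  times FP f (idc Y) ∘ ⟨idc Z, g⟩ = ⟨f, g⟩.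
Proof.
by rewrite /times pairing_comp -!comp_assoc p1_pairing p2_pairing comp_idl comp_idr.
Qed.

End ProductArrows.

(** Normal form for arrows between products: composites associate to the right and
    a pairing absorbs what precedes it. *)
Ltac bsimp :=
  rewrite /d_src /d_tgt /times ?(pairing_comp, comp_idl, comp_idr);
  repeat (progress (rewrite -?comp_assoc ?(pairing_comp, p1_pairing, p2_pairing, comp_idl, comp_idr))).

(** * Quantifiers without casts *)

Section Intrinsic.
Variables (B : Category) (FP : FiniteProducts B).
Local Notation "x × y" := (product FP x y) (at level 39, left associativity).
Local Notation "⟨ f , g ⟩" := (pairing (f := FP) f g).

Section Notions.
Variable E : CatOver B.

(** The unit of [∐] followed by the cartesian arrow [π^*∐b -> ∐b].  Testing against
    all [w], not only vertical arrows, is the same by cartesian factorization and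
    dispenses with reindexing the test object. *)
Definition coproduct_arrow (I X : B) (b : E (I × X)) (s : E I) (e : thom b s) : Prop :=
  over e = p1 /\
  forall (K : B) (c : E K) (w : hom I K) (g : thom b c),
    over g = w ∘ p1 -> exists! h : thom s c, over h = w /\ h • e = g.

(** Think of [s] as [∏b], of [d] as [π^*s] and of [ev] as the counit.  An arrow [r]
    into [s] and an arrow [z] of the base over the same map amount to an arrow
    [c -> π^*s], and [v] is its composite with the counit: the instance at [z] of what
    [r] proves for all values in [X]. *)
Definition evaluates (I X : B) (b : E (I × X)) (s : E I) (d : E (I × X))
    (l : thom d s) (ev : thom d b)
    (K : B) (c : E K) (r : thom c s) (z : hom K (I × X)) (v : thom c b) : Prop :=
  exists q : thom c d, over q = z /\ l • q = r /\ ev • q = v.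

(** Because [w] is arbitrary, this says that every reindexing of [s] is a product of
    the corresponding reindexing of [b]: it contains the Beck-Chevalley condition. *)
Definition product_cone (I X : B) (b : E (I × X)) (s : E I) (d : E (I × X))
    (l : thom d s) (ev : thom d b) : Prop :=
  over l = p1 /\ is_cartesian l /\ over ev = idc _ /\
  forall (K : B) (c : E K) (c' : E (K × X)) (lc : thom c' c),
    over lc = p1 -> is_cartesian lc ->
    forall (w : hom K I) (g : thom c' b), over g = times FP w (idc X) ->
    exists! h : thom c s,
      over h = w /\ evaluates l ev (h • lc) (times FP w (idc X)) g.

(** Vertical arrows from [f^*a] to [∐b] are replaced by arrows over an arbitrary map
    [u], and the pair of a witness [g] and an arrow into [⟨1, g⟩^*b] by the single
    arrow [k], whose image in the base is [⟨u, g⟩]. *)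
Definition coprod_free (I : B) (a : E I) : Prop :=
  forall (A : B) (a' : E A) (r : thom a' a), is_cartesian r ->
  forall (J X : B) (b : E (J × X)) (s : E J) (e : thom b s), coproduct_arrow e ->
  forall h : thom a' s, exists! k : thom a' b, e • k = h.

(** [m] exhibits [b'] as the instance of [b] at [g], [n] is the instantiation
    [s' -> b'] of the product, and [h] is [k] after [n]. *)
Definition prod_factor (I X : B) (b : E (I × X)) (s : E I) (d : E (I × X))
    (l : thom d s) (ev : thom d b) (A : B) (s' : E A) (r : thom s' s)
    (J : B) (a : E J) (h : thom s' a)
    (g : hom A X) (b' : E A) (m : thom b' b) (k : thom b' a) : Prop :=
  is_cartesian m /\ over m = ⟨over r, g⟩ /\
  exists n : thom s' b', over n = idc A /\
    evaluates l ev r ⟨over r, g⟩ (m • n) /\ k • n = h.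

(** The object [b'] is only determined up to isomorphism, hence so is [k]. *)
Definition unique_prod_factor (I X : B) (b : E (I × X)) (s : E I) (d : E (I × X))
    (l : thom d s) (ev : thom d b) (A : B) (s' : E A) (r : thom s' s)
    (J : B) (a : E J) (h : thom s' a) : Prop :=
  (exists g b' (m : thom b' b) k, prod_factor l ev r h g m k) /\
  (forall g1 b1 (m1 : thom b1 b) k1 g2 b2 (m2 : thom b2 b) k2,
     prod_factor l ev r h g1 m1 k1 -> prod_factor l ev r h g2 m2 k2 ->
     g1 = g2 /\ exists x : thom b1 b2, over x = idc A /\ m2 • x = m1 /\ k2 • x = k1).

(** Quantifier-freeness in the subfibration of [∐]-quantifier-free objects, which is
    why only products of such objects are tested. *)
Definition prod_free (J : B) (a : E J) : Prop :=
  forall (I X : B) (b : E (I × X)) (s : E I) (d : E (I × X))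
    (l : thom d s) (ev : thom d b), coprod_free b -> product_cone l ev ->
  forall h : thom s a, unique_prod_factor l ev (tid s) h.

(** The conditions on a Goedel fibration without reference to chosen products and
    coproducts.  The isomorphisms [a ≅ ∐b] and [a ≅ ∏b] are absorbed by letting [a]
    itself be the vertex. *)
Record intrinsic_Goedel : Prop := {
  enough_coprod_free : forall (I : B) (a : E I),
    exists (X : B) (b : E (I × X)) (e : thom b a), coprod_free b /\ coproduct_arrow e;
  coprod_free_product : forall (I X : B) (b : E (I × X)) (s : E I) (d : E (I × X))
    (l : thom d s) (ev : thom d b),
    coprod_free b -> product_cone l ev -> coprod_free s;
  enough_prod_free : forall (I : B) (a : E I), coprod_free a ->
    exists (X : B) (b : E (I × X)) (d : E (I × X)) (l : thom d a) (ev : thom d b),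
      coprod_free b /\ prod_free b /\ product_cone l ev
}.

Lemma coproduct_arrow_comp_l (I X : B) (b : E (I × X)) (s t : E I) (e : thom b s)
    (i : thom s t) : over i = idc I -> tiso i -> coproduct_arrow e ->
  coproduct_arrow (i • e).
Proof.
move=> oi ti [oe ue]; split; first by rewrite over_comp oi oe comp_idl.
have [j [oj [ji [ij tj]]]] := tiso_inv_vert oi ti.
move=> K c w g og; have [h [[oh he] uh]] := ue K c w g og.
exists (h • j); split; first split.
- by rewrite over_comp oh oj comp_idr.
- by rewrite -tcomp_assoc (tcomp_assoc j) ji tcomp_idl.
- move=> h' [oh' he']; apply: (tiso_epi ti); rewrite -tcomp_assoc ji tcomp_idr.
  by apply: uh; rewrite over_comp oh' oi comp_idr -tcomp_assoc.
Qed.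

Lemma coproduct_arrow_comp_r (I X : B) (b b' : E (I × X)) (s : E I) (e : thom b s)
    (i : thom b' b) : over i = idc _ -> tiso i -> coproduct_arrow e ->
  coproduct_arrow (e • i).
Proof.
move=> oi ti [oe ue]; split; first by rewrite over_comp oi oe comp_idr.
have [j [oj [ji [ij tj]]]] := tiso_inv_vert oi ti.
move=> K c w g og.
have [|h [[oh he] uh]] := ue K c w (g • j); first by rewrite over_comp og oj comp_idr.
exists h; split; first split=> //.
- by rewrite tcomp_assoc he -tcomp_assoc ji tcomp_idr.
- move=> h' [oh' he']; apply: uh; split=> //.
  by rewrite -he' -!tcomp_assoc ij tcomp_idr.
Qed.

Lemma coproduct_arrow_inj (I X : B) (b : E (I × X)) (s : E I) (e : thom b s)
    K (c : E K) (h h' : thom s c) :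
  coproduct_arrow e -> over h = over h' -> h • e = h' • e -> h = h'.
Proof.
move=> [oe ue] oh he.
have [|x [_ ux]] := ue K c (over h') (h' • e); first by rewrite over_comp oe.
by rewrite -(ux h) // -(ux h').
Qed.

Lemma coproduct_arrow_unique (I X : B) (b : E (I × X)) (s t : E I) (e : thom b s)
    (e' : thom b t) : coproduct_arrow e -> coproduct_arrow e' ->
  exists i : thom s t, over i = idc I /\ tiso i /\ i • e = e'.
Proof.
move=> ce ce'; have [oe ue] := ce; have [oe' ue'] := ce'.
have [|i [[oi ei] _]] := ue _ t (idc I) e'; first by rewrite comp_idl.
have [|j [[oj ej] _]] := ue' _ s (idc I) e; first by rewrite comp_idl.
exists i; splits=> //; exists j; split.
- apply: (coproduct_arrow_inj ce); first by rewrite over_comp oi oj comp_idl over_id.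
  by rewrite -tcomp_assoc ei ej tcomp_idl.
- apply: (coproduct_arrow_inj ce'); first by rewrite over_comp oi oj comp_idl over_id.
  by rewrite -tcomp_assoc ej ei tcomp_idl.
Qed.

Lemma coprod_free_cartesian (I J : B) (a' : E J) (a : E I) (r : thom a' a) :
  is_cartesian r -> coprod_free a -> coprod_free a'.
Proof.
move=> cr fa A a'' r' cr'; apply: fa; exact: (cartesian_comp cr cr').
Qed.

Section Eval.
Variables (I X : B) (b : E (I × X)) (s : E I) (d : E (I × X)).
Variables (l : thom d s) (ev : thom d b).

Lemma evaluates_ex (K : B) (c : E K) (r : thom c s) (z : hom K (I × X)) :
  over l = p1 -> is_cartesian l -> over r = p1 ∘ z ->
  exists v, evaluates l ev r z v.
Proof.
move=> ol cl e; have [|q [oq eq]] := cart_lift cl (g := r) (w := z); first by rewrite ol.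
by exists (ev • q), q.
Qed.

Lemma evaluates_fun (K : B) (c : E K) (r : thom c s) (z : hom K (I × X)) v v' :
  is_cartesian l -> evaluates l ev r z v -> evaluates l ev r z v' -> v = v'.
Proof.
move=> cl [q [oq [lq <-]]] [q' [oq' [lq' <-]]]; congr (_ • _).
by apply: (cart_inj cl); rewrite ?oq ?lq.
Qed.

Lemma evaluates_over (K : B) (c : E K) (r : thom c s) (z : hom K (I × X)) v :
  over ev = idc _ -> evaluates l ev r z v -> over v = z.
Proof. by move=> oe [q [oq [lq <-]]]; rewrite over_comp oe oq comp_idl. Qed.

Lemma evaluates_comp (K L : B) (c : E K) (c' : E L) (r : thom c s) (z : hom K (I × X)) v
    (k : thom c' c) :
  evaluates l ev r z v -> evaluates l ev (r • k) (z ∘ over k) (v • k).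
Proof.
move=> [q [oq [lq <-]]]; exists (q • k).
by rewrite over_comp oq !tcomp_assoc lq.
Qed.

(** Two cartesian arrows into [c] over the projection differ by an isomorphism, so
    that one of them suffices for each test object. *)
Lemma product_cone_intro :
  over l = p1 -> is_cartesian l -> over ev = idc _ ->
  (forall (K : B) (c : E K), exists (c' : E (K × X)) (lc : thom c' c),
    over lc = p1 /\ is_cartesian lc /\
    forall (w : hom K I) (g : thom c' b), over g = times FP w (idc X) ->
    (exists h : thom c s,
      over h = w /\ evaluates l ev (h • lc) (times FP w (idc X)) g) /\
    forall h h' : thom c s, over h = w -> over h' = w ->
      evaluates l ev (h • lc) (times FP w (idc X)) g ->
      evaluates l ev (h' • lc) (times FP w (idc X)) g -> h = h') ->
  product_cone l ev.
Proof.
move=> ol cl oe H; rewrite /product_cone; splits=> //.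
move=> K c c1 lc1 olc1 clc1 w g og.
have [c' [lc [olc [clc U]]]] := H K c.
have [|x [ox [ex tx]]] := cartesian_compare clc1 clc; first by rewrite olc.
have [y [oy [yx [xy ty]]]] := tiso_inv_vert ox tx.
have [|[h [oh eh]] uh] := U w (g • x); first by rewrite over_comp og ox comp_idr.
exists h; split; first split=> //.
  have := evaluates_comp y eh.
  by rewrite oy comp_idr -!tcomp_assoc xy tcomp_idr -ex -tcomp_assoc xy tcomp_idr.
move=> h' [oh' eh']; apply: uh => //.
by have := evaluates_comp x eh'; rewrite ox comp_idr -tcomp_assoc ex.
Qed.

Lemma product_cone_inj (K : B) (c : E K) (c' : E (K × X)) (lc : thom c' c)
    (h h' : thom c s) v : product_cone l ev ->
  over lc = p1 -> is_cartesian lc -> over h = over h' ->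
  evaluates l ev (h • lc) (times FP (over h) (idc X)) v ->
  evaluates l ev (h' • lc) (times FP (over h) (idc X)) v -> h = h'.
Proof.
move=> [ol [cl [oe U]]] olc clc oh e1 e2.
have ov := evaluates_over oe e1.
have [x [_ ux]] := U _ _ _ lc olc clc _ v ov.
by rewrite -(ux h) // -(ux h').
Qed.

End Eval.

Lemma product_cone_iso (I X : B) (b b' : E (I × X)) (s : E I) (d d' : E (I × X))
    (l : thom d s) (ev : thom d b) (i : thom d' d) (j : thom b b') :
  over i = idc _ -> tiso i -> over j = idc _ -> tiso j ->
  product_cone l ev -> product_cone (l • i) (j • (ev • i)).
Proof.
move=> oi ti oj tj [ol [cl [oe U]]].
have [i' [oi' [i'i [ii' _]]]] := tiso_inv_vert oi ti.
have [j' [oj' [j'j [jj' _]]]] := tiso_inv_vert oj tj.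
have H : forall K (c : E K) (r : thom c s) z v,
    evaluates (l • i) (j • (ev • i)) r z v <-> evaluates l ev r z (j' • v).
  move=> K c r z v; split.
  - move=> [q [oq [lq <-]]]; exists (i • q).
    rewrite over_comp oi comp_idl oq tcomp_assoc lq; splits=> //.
    by rewrite -!tcomp_assoc (tcomp_assoc j') j'j tcomp_idl.
  - move=> [q [oq [lq eq]]]; exists (i' • q).
    rewrite over_comp oi' comp_idl oq -!tcomp_assoc (tcomp_assoc i) ii' tcomp_idl lq.
    by rewrite eq tcomp_assoc jj' tcomp_idl.
refine (conj _ (conj _ (conj _ _))).
- by rewrite over_comp ol oi comp_idr.
- exact: cartesian_comp (tiso_cartesian ti).
- by rewrite !over_comp oj oe oi !comp_idl.
- move=> K c c' lc olc clc w g og.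
  have [|h [[oh eh] uh]] := U K c c' lc olc clc w (j' • g).
    by rewrite over_comp oj' comp_idl.
  exists h; split; first by split=> //; apply/H.
  by move=> h' [oh' /H eh']; apply: uh.
Qed.

(** The comparison [i] is recorded by how it is evaluated, since the two cones do not
    share their reindexings [d] and [d']. *)
Lemma product_cone_unique (I X : B) (b : E (I × X)) (s s' : E I) (d d' : E (I × X))
    (l : thom d s) (ev : thom d b) (l' : thom d' s') (ev' : thom d' b) :
  product_cone l ev -> product_cone l' ev' ->
  exists i : thom s' s, over i = idc I /\ tiso i /\ evaluates l ev (i • l') (idc _) ev'.
Proof.
move=> P P'; have [ol [cl [oe U]]] := P; have [ol' [cl' [oe' U']]] := P'.
have t1 : times FP (idc I) (idc X) = idc _ := times_id _ _ _.
have [|i [[oi]]] := U _ _ _ l' ol' cl' (idc I) ev'; first by rewrite t1.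
rewrite t1 => ei _.
have [|j [[oj]]] := U' _ _ _ l ol cl (idc I) ev; first by rewrite t1.
rewrite t1 => ej _.
have [q [oq [lq eq]]] := ei; have [r [or [lr er]]] := ej.
exists i; split=> //; split=> //; exists j; split.
- apply: (product_cone_inj (lc := l') (v := ev') P') => //.
  + by rewrite over_comp oi oj comp_idl over_id.
  + rewrite over_comp oi oj comp_idl t1.
    exists (r • q); rewrite over_comp or oq comp_idl; split=> //.
    by rewrite !tcomp_assoc lr er -!tcomp_assoc lq.
  + rewrite over_comp oi oj comp_idl t1.
    by exists (tid _); rewrite over_id !tcomp_idr tcomp_idl.
- apply: (product_cone_inj (lc := l) (v := ev) P) => //.
  + by rewrite over_comp oi oj comp_idl over_id.
  + rewrite over_comp oi oj comp_idl t1.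
    exists (q • r); rewrite over_comp or oq comp_idl; split=> //.
    by rewrite !tcomp_assoc lq eq -!tcomp_assoc lr.
  + rewrite over_comp oi oj comp_idl t1.
    by exists (tid _); rewrite over_id !tcomp_idr tcomp_idl.
Qed.

(** A test of the reindexed cone at [w] is a test of the given cone at
    [over r ∘ w]. *)
Lemma product_cone_stable (I I' X : B) (b : E (I × X)) (s : E I) (d : E (I × X))
    (l : thom d s) (ev : thom d b) (s' : E I') (b' d' : E (I' × X))
    (r : thom s' s) (m : thom b' b) (l' : thom d' s') (q : thom d' d) (ev' : thom d' b') :
  product_cone l ev ->
  is_cartesian r -> is_cartesian m -> over m = times FP (over r) (idc X) ->
  is_cartesian l' -> over l' = p1 ->
  l • q = r • l' -> over q = times FP (over r) (idc X) ->
  m • ev' = ev • q -> over ev' = idc _ ->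
  product_cone l' ev'.
Proof.
move=> [ol [cl [oe U]]] cr cm om cl' ol' lq oq meq oe'.
have H : forall K (c : E K) (t : thom c s') z v,
    over t = p1 ∘ z -> over v = z ->
    evaluates l' ev' t z v <->
    evaluates l ev (r • t) (times FP (over r) (idc X) ∘ z) (m • v).
  move=> K c t z v ot ov; split.
  - move=> [x [ox [lx ex]]]; exists (q • x).
    by rewrite over_comp oq ox !tcomp_assoc lq -meq -!tcomp_assoc lx ex.
  - move=> [y [oy [ly ey]]].
    have [|x [ox lx]] := cart_lift cl' (g := t) (w := z); first by rewrite ol'.
    have qx : q • x = y.
      apply: (cart_inj cl); first by rewrite over_comp oq ox oy.
      by rewrite tcomp_assoc lq -tcomp_assoc lx ly.
    exists x; splits=> //; apply: (cart_inj cm).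
      by rewrite over_comp oe' ox comp_idl ov.
    by rewrite tcomp_assoc meq -tcomp_assoc qx.
rewrite /product_cone; splits=> //.
move=> K c c' lc olc clc w g og.
have tw : times FP (over r) (idc X) ∘ times FP w (idc X) = times FP (over r ∘ w) (idc X).
  exact: times_comp.
have [|h [[oh eh] uh]] := U K c c' lc olc clc (over r ∘ w) (m • g).
  by rewrite over_comp om og tw.
have [h1 [oh1 rh1]] := cart_lift cr oh.
exists h1; split; first split=> //.
- apply/H => //; first by rewrite over_comp oh1 olc p1_times.
  by rewrite tcomp_assoc rh1 tw.
- move=> h2 [oh2 eh2]; apply: (cart_inj cr); first by rewrite oh1.
  rewrite rh1; apply: uh; split; first by rewrite over_comp oh2.
  move/H: eh2 => eh2; rewrite -tcomp_assoc -tw; apply: eh2 => //.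
  by rewrite over_comp oh2 olc p1_times.
Qed.

Lemma product_cone_vertex (I X : B) (b : E (I × X)) (s s' : E I) (d : E (I × X))
    (l : thom d s) (ev : thom d b) (i : thom s s') :
  over i = idc I -> tiso i -> product_cone l ev -> product_cone (i • l) ev.
Proof.
move=> oi ti P; have [ol [cl [oe _]]] := P.
have [j [oj [ji [ij tj]]]] := tiso_inv_vert oi ti.
apply: (product_cone_stable (r := j) (m := tid b) (q := tid d) P).
- exact: tiso_cartesian.
- exact: tiso_cartesian (tiso_id _).
- by rewrite over_id oj times_id.
- exact: cartesian_comp (tiso_cartesian ti) cl.
- by rewrite over_comp oi comp_idl.
- by rewrite tcomp_idr tcomp_assoc ji tcomp_idl.
- by rewrite over_id oj times_id.
- by rewrite tcomp_idl tcomp_idr.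
- exact: oe.
Qed.

Lemma prod_factor_iso (I X : B) (b : E (I × X)) (s : E I) (d : E (I × X))
    (l : thom d s) (ev : thom d b) (A : B) (s' : E A) (r : thom s' s)
    (J : B) (a : E J) (h : thom s' a)
    (g : hom A X) (b' b'' : E A) (m : thom b' b) (k : thom b' a) (x : thom b'' b') :
  over x = idc A -> tiso x ->
  prod_factor l ev r h g m k -> prod_factor l ev r h g (m • x) (k • x).
Proof.
move=> ox tx [cm [om [n [on [en kn]]]]].
have [y [oy [yx [xy ty]]]] := tiso_inv_vert ox tx.
split; first exact: cartesian_comp (tiso_cartesian tx).
split; first by rewrite over_comp om ox comp_idr.
exists (y • n); rewrite over_comp oy on comp_idl.
by rewrite -!tcomp_assoc !(tcomp_assoc x) xy tcomp_idl.
Qed.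

Lemma prod_factor_over (I X : B) (b : E (I × X)) (s : E I) (d : E (I × X))
    (l : thom d s) (ev : thom d b) (A : B) (s' : E A) (r : thom s' s)
    (J : B) (a : E J) (h : thom s' a)
    (g : hom A X) (b' : E A) (m : thom b' b) (k : thom b' a) :
  prod_factor l ev r h g m k -> over k = over h.
Proof.
by move=> [_ [_ [n [on [_ <-]]]]]; rewrite over_comp on comp_idr.
Qed.

(** It allows a product to be replaced by an isomorphic one whose factorizations can
    be computed: [i] and [j] identify the factorizations along the two cones. *)
Lemma unique_prod_factor_cone (I X : B) (b b0 : E (I × X)) (s s0 : E I) (d d0 : E (I × X))
    (l : thom d s) (ev : thom d b) (l0 : thom d0 s0) (ev0 : thom d0 b0)
    (i : thom s s0) (j : thom b b0) (J : B) (a : E J) (h : thom s0 a) :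
  over i = idc I -> tiso i -> over j = idc _ -> tiso j ->
  product_cone l ev -> product_cone l0 ev0 ->
  evaluates l0 ev0 (i • l) (idc _) (j • ev) ->
  unique_prod_factor l0 ev0 (tid s0) h -> unique_prod_factor l ev (tid s) (h • i).
Proof.
move=> oi ti oj tj [ol [cl [oe _]]] [ol0 [cl0 [oe0 _]]] [q [oq [lq eq]]].
have [i' [oi' [i'i [ii' _]]]] := tiso_inv_vert oi ti.
have [j' [oj' [j'j [jj' tj']]]] := tiso_inv_vert oj tj.
have H : forall g b' (m : thom b' b) (k : thom b' a),
    prod_factor l ev (tid s) (h • i) g m k <-> prod_factor l0 ev0 (tid s0) h g (j • m) k.
  move=> g b' m k; rewrite /prod_factor !over_id over_comp oj comp_idl.
  split=> [[cm [om [n [on [[x [ox [lx ex]]] kn]]]]]|[cm [om [n [on [[x [ox [lx ex]]] kn]]]]]].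
    split; first by apply: cartesian_comp cm; apply: tiso_cartesian.
    split=> //; exists (n • i'); split; first by rewrite over_comp on oi' comp_idl.
    split; last by rewrite tcomp_assoc kn -tcomp_assoc ii' tcomp_idr.
    exists (q • x • i'); split; first by rewrite !over_comp oq ox oi' comp_idl comp_idr.
    rewrite !tcomp_assoc lq eq -!(tcomp_assoc _ _ x) -!tcomp_assoc (tcomp_assoc l) lx.
    by rewrite tcomp_idl ii' (tcomp_assoc ev) ex -tcomp_assoc.
  split; first by apply: (cartesian_cancel (tiso_cartesian tj)).
  split=> //; exists (n • i); split; first by rewrite over_comp on oi comp_idl.
  split; last by rewrite tcomp_assoc kn.
  have [|y [oy ey]] := cart_lift cl (g := tid s) (w := ⟨idc I, g⟩).
    by rewrite over_id ol p1_pairing.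
  have qy : q • y = x • i.
    apply: (cart_inj cl0); first by rewrite !over_comp oq oy ox oi comp_idl comp_idr.
    by rewrite !tcomp_assoc lq -tcomp_assoc ey lx tcomp_idl tcomp_idr.
  exists y; do 2!split=> //; apply: (tiso_mono tj).
  by rewrite tcomp_assoc -eq -tcomp_assoc qy !tcomp_assoc ex.
move=> [[g [b' [m [k f]]]] U]; split.
  exists g, b', (j' • m), k; apply/H.
  by rewrite tcomp_assoc jj' tcomp_idl.
move=> g1 b1 m1 k1 g2 b2 m2 k2 /H f1 /H f2.
have [eg [x [ox [e1 e2]]]] := U _ _ _ _ _ _ _ _ f1 f2.
split=> //; exists x; splits=> //.
by apply: (tiso_mono tj); rewrite tcomp_assoc.
Qed.

End Notions.

Section Split.
Variable E : SplitFibration B.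

Lemma product_cone_reindex (I I' X : B) (b : E (I × X)) (s : E I) (d : E (I × X))
    (l : thom d s) (ev : thom d b) (s' : E I') (r : thom s' s) :
  product_cone l ev -> is_cartesian r ->
  exists (b' d' : E (I' × X)) (m : thom b' b) (l' : thom d' s') (q : thom d' d)
      (ev' : thom d' b'),
    is_cartesian m /\ over m = times FP (over r) (idc X) /\
    l • q = r • l' /\ over q = times FP (over r) (idc X) /\
    m • ev' = ev • q /\ product_cone l' ev'.
Proof.
move=> P cr; have [ol [cl [oe _]]] := P.
pose m := lift (times FP (over r) (idc X)) b.
pose l' := lift (p1 : hom (I' × X) I') s'.
have om : over m = _ := over_lift _ _.
have ol' : over l' = _ := over_lift _ _.
have cm : is_cartesian m := lift_cartesian _ _.
have cl' : is_cartesian l' := lift_cartesian _ _.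
have [|q [oq lq]] := cart_lift cl (g := r • l') (w := times FP (over r) (idc X)).
  by rewrite over_comp ol ol' p1_times.
have [|ev' [oe' eq]] := cart_lift cm (g := ev • q) (w := idc _).
  by rewrite over_comp oe oq om comp_idl comp_idr.
exists _, _, m, l', q, ev'; splits=> //.
exact: (product_cone_stable P cr cm om cl' ol' lq oq eq oe').
Qed.

(** Quantifier-freeness against a product is inherited by its reindexings,
    because they are again products. *)
Lemma prod_free_unique_factor (J : B) (a : E J) (I X : B) (b : E (I × X)) (s : E I)
    (d : E (I × X)) (l : thom d s) (ev : thom d b) (A : B) (s' : E A) (r : thom s' s)
    (h : thom s' a) :
  prod_free a -> coprod_free b -> product_cone l ev -> is_cartesian r ->
  unique_prod_factor l ev r h.
Proof.
move=> fa fb P cr; have [ol [cl [oe _]]] := P.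
have [b' [d' [m [l' [q [ev' [cm [om [lq [oq [meq P']]]]]]]]]]] :=
  product_cone_reindex P cr.
have [ol' [cl' [oe' _]]] := P'.
have [[g [b1 [m1 [k1 [cm1 [om1 [n [on [[x [ox [lx ex]]] kn]]]]]]]]] uf] :=
  fa _ _ _ _ _ _ _ (coprod_free_cartesian cm fb) P' h.
rewrite over_id in om1 ox.
split.
  exists g, b1, (m • m1), k1; split; first exact: cartesian_comp.
  split; first by rewrite over_comp om om1 over_graph.
  exists n; splits=> //.
  exists (q • x); rewrite over_comp oq ox over_graph; split=> //.
  by rewrite !tcomp_assoc lq -meq -!tcomp_assoc lx ex tcomp_idr.
have H : forall g2 b2 (m2 : thom b2 b) k2, prod_factor l ev r h g2 m2 k2 ->
    exists m3 : thom b2 b', m • m3 = m2 /\ prod_factor l' ev' (tid s') h g2 m3 k2.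
  move=> g2 b2 m2 k2 [cm2 [om2 [n2 [on2 [[y [oy [ly ey]]] kn2]]]]].
  have [|m3 [om3 em3]] := cart_lift cm (g := m2) (w := ⟨idc _, g2⟩).
    by rewrite om2 om over_graph.
  exists m3; split=> //; split.
    by apply: (cartesian_cancel cm); rewrite em3.
  rewrite over_id; split=> //; exists n2; splits=> //.
  have [|z [oz lz]] := cart_lift cl' (g := tid s') (w := ⟨idc _, g2⟩).
    by rewrite over_id ol' p1_pairing.
  exists z; splits=> //.
  apply: (cart_inj cm); first by rewrite !over_comp oe' oz om3 on2 comp_idr comp_idl.
  rewrite !tcomp_assoc meq em3 -ey -tcomp_assoc; congr (_ • _).
  apply: (cart_inj cl); first by rewrite over_comp oq oz over_graph oy.
  by rewrite tcomp_assoc lq -tcomp_assoc lz tcomp_idr.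
move=> g1 b2 m2 k2 g2 b3 m3 k3 /H [m2' [<- f2]] /H [m3' [<- f3]].
have [eg [y [oy [ey1 ey2]]]] := uf _ _ _ _ _ _ _ _ f2 f3.
by split=> //; exists y; rewrite -tcomp_assoc ey1.
Qed.

(** The form taken by unique factorization in terms of chosen reindexings, where [k]
    is unique on the nose because its domain is determined by [g]. *)
Definition chosen_prod_factor (I X : B) (b : E (I × X)) (s : E I) (d : E (I × X))
    (l : thom d s) (ev : thom d b) (J : B) (a : E J) (h : thom s a) : Prop :=
  exists! gk : {g : hom I X & thom (reindex ⟨idc I, g⟩ b) a},
    exists n : thom s (reindex ⟨idc I, projT1 gk⟩ b),
      over n = idc I /\
      evaluates l ev (tid s) ⟨idc I, projT1 gk⟩ (lift ⟨idc I, projT1 gk⟩ b • n) /\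
      projT2 gk • n = h.

Lemma prod_factor_lift (I X : B) (b : E (I × X)) (s : E I) (d : E (I × X))
    (l : thom d s) (ev : thom d b) (J : B) (a : E J) (h : thom s a)
    (g : hom I X) (k : thom (reindex ⟨idc I, g⟩ b) a) :
  prod_factor l ev (tid s) h g (lift ⟨idc I, g⟩ b) k <->
  exists n : thom s (reindex ⟨idc I, g⟩ b),
    over n = idc I /\ evaluates l ev (tid s) ⟨idc I, g⟩ (lift ⟨idc I, g⟩ b • n) /\ k • n = h.
Proof.
rewrite /prod_factor over_id over_lift; split; first by case=> _ [].
by move=> H; split; first exact: lift_cartesian.
Qed.

Lemma chosen_prod_factorP (I X : B) (b : E (I × X)) (s : E I) (d : E (I × X))
    (l : thom d s) (ev : thom d b) (J : B) (a : E J) (h : thom s a) :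
  chosen_prod_factor l ev h <-> unique_prod_factor l ev (tid s) h.
Proof.
pose C g k := prod_factor l ev (tid s) h g (lift ⟨idc I, g⟩ b) k.
have CE : forall g k, C g k <-> _ := prod_factor_lift l ev h.
have H : forall g2 b2 (m2 : thom b2 b) k2, prod_factor l ev (tid s) h g2 m2 k2 ->
    exists x : thom (reindex ⟨idc I, g2⟩ b) b2, over x = idc I /\ tiso x /\
      m2 • x = lift ⟨idc I, g2⟩ b /\ C g2 (k2 • x).
  move=> g2 b2 m2 k2 f2; have [cm2 [om2 _]] := f2.
  have [|x [ox [ex tx]]] := cartesian_compare cm2 (lift_cartesian ⟨idc I, g2⟩ b).
    by rewrite om2 over_lift over_id.
  by exists x; splits=> //; rewrite /C -ex; apply: prod_factor_iso.
split=> [[[g k] /= [/CE f U]]|[[g [b' [m [k f]]]] U]].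
  split; first by exists g, _, (lift _ _), k.
  move=> g1 b1 m1 k1 g2 b2 m2 k2 /H [x1 [o1 [t1 [e1 /CE f1]]]] /H [x2 [o2 [t2 [e2 /CE f2]]]].
  have e : existT (fun g => thom (reindex ⟨idc I, g⟩ b) a) g1 (k1 • x1) = existT _ g2 (k2 • x2).
    by rewrite -(U (existT _ g1 (k1 • x1)) f1) -(U (existT _ g2 (k2 • x2)) f2).
  have eg : g1 = g2 := f_equal (@projT1 _ _) e.
  subst g2; split=> //.
  have ek : k1 • x1 = k2 • x2 := inj_pair2 _ _ _ _ _ e.
  have [y1 [oy [yx [xy _]]]] := tiso_inv_vert o1 t1.
  exists (x2 • y1); rewrite over_comp o2 oy comp_idl !tcomp_assoc e2 -e1 -ek.
  by rewrite -!tcomp_assoc xy !tcomp_idr.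
have [x [_ [tx [ex f']]]] := H _ _ _ _ f.
exists (existT _ g (k • x)); split; first by apply/CE.
move=> [g2 k2] /= /CE f2.
have [eg [y [oy [e1 e2]]]] := U _ _ _ _ _ _ _ _ f' f2; subst g2.
suff ey : y = tid _ by rewrite -e2 ey tcomp_idr.
by apply: (cart_inj (lift_cartesian _ _)); rewrite ?over_id // e1 tcomp_idr.
Qed.

Lemma unique_prod_factor_intro (I X : B) (b : E (I × X)) (s : E I) (d : E (I × X))
    (l : thom d s) (ev : thom d b) (J : B) (a : E J) (h : thom s a) :
  (exists g (k : thom (reindex ⟨idc I, g⟩ b) a),
     prod_factor l ev (tid s) h g (lift ⟨idc I, g⟩ b) k) ->
  (forall g1 g2 (k1 : thom (reindex ⟨idc I, g1⟩ b) a) (k2 : thom (reindex ⟨idc I, g2⟩ b) a),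
     prod_factor l ev (tid s) h g1 (lift ⟨idc I, g1⟩ b) k1 ->
     prod_factor l ev (tid s) h g2 (lift ⟨idc I, g2⟩ b) k2 ->
     existT (fun g => thom (reindex ⟨idc I, g⟩ b) a) g1 k1 = existT _ g2 k2) ->
  unique_prod_factor l ev (tid s) h.
Proof.
move=> [g [k f]] U; apply/chosen_prod_factorP; exists (existT _ g k).
split; first by apply/prod_factor_lift.
by move=> [g2 k2] f2; apply: U => //; apply/prod_factor_lift.
Qed.

(** Factorizations of [r • h] and of [h] correspond, as [n] is vertical.  Used to pass
    between arrows into [a] over [f] and vertical arrows into [f^*a]. *)
Lemma unique_prod_factor_cartesian (I X : B) (b : E (I × X)) (s : E I) (d : E (I × X))
    (l : thom d s) (ev : thom d b) (J K : B) (a' : E J) (a : E K) (r : thom a' a)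
    (h : thom s a') : is_cartesian r ->
  unique_prod_factor l ev (tid s) (r • h) <-> unique_prod_factor l ev (tid s) h.
Proof.
move=> cr.
have up : forall g b' (m : thom b' b) k, prod_factor l ev (tid s) h g m k ->
    prod_factor l ev (tid s) (r • h) g m (r • k).
  move=> g b' m k [cm [om [n [on [en kn]]]]]; rewrite /prod_factor; splits=> //.
  by exists n; splits=> //; rewrite -tcomp_assoc kn.
have down : forall g b' (m : thom b' b) k, prod_factor l ev (tid s) (r • h) g m k ->
    exists k', r • k' = k /\ prod_factor l ev (tid s) h g m k'.
  move=> g b' m k f; have ok := prod_factor_over f; have [cm [om [n [on [en kn]]]]] := f.
  have [|k' [ok' rk']] := cart_lift cr (g := k) (w := over h); first by rewrite ok over_comp.
  exists k'; split=> //; rewrite /prod_factor; splits=> //; exists n; splits=> //.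
  apply: (cart_inj cr); first by rewrite over_comp ok' on comp_idr.
  by rewrite tcomp_assoc rk'.
split=> [[[g [b' [m [k f]]]] U]|[[g [b' [m [k f]]]] U]]; split.
- by have [k' [_ f']] := down _ _ _ _ f; exists g, b', m, k'.
- move=> g1 b1 m1 k1 g2 b2 m2 k2 f1 f2.
  have [eg [x [ox [e1 e2]]]] := U _ _ _ _ _ _ _ _ (up _ _ _ _ f1) (up _ _ _ _ f2).
  split=> //; exists x; splits=> //.
  apply: (cart_inj cr); last by rewrite tcomp_assoc.
  by rewrite over_comp ox comp_idr (prod_factor_over f1) (prod_factor_over f2).
- by exists g, b', m, (r • k); apply: up.
- move=> g1 b1 m1 k1 g2 b2 m2 k2 /down [k1' [<- f1]] /down [k2' [<- f2]].
  have [eg [x [ox [e1 e2]]]] := U _ _ _ _ _ _ _ _ f1 f2.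
  by split=> //; exists x; rewrite -tcomp_assoc e2.
Qed.

Lemma prod_free_cartesian (I J : B) (a' : E J) (a : E I) (r : thom a' a) :
  is_cartesian r -> prod_free a -> prod_free a'.
Proof.
move=> cr fa K X b s d l ev fb P h.
by apply/(unique_prod_factor_cartesian l ev h cr); apply: fa.
Qed.

(** If [a] is a coproduct of [b] and both are quantifier-free, the identity of
    [a] picks a witness [g], and [a] is the instance of [b] at [g]. *)
Lemma coprod_free_instance (I X : B) (b : E (I × X)) (a : E I) (e : thom b a) :
  coprod_free a -> coprod_free b -> coproduct_arrow e ->
  exists (g : hom I (I × X)) (i : thom a (reindex g b)), over i = idc I /\ tiso i.
Proof.
move=> fa fb ce; have [oe _] := ce.
have [k [ek _]] := fa _ _ _ (tiso_cartesian (tiso_id _)) _ _ _ _ _ ce (tid a).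
pose m := lift (over k) b; have cm : is_cartesian m := lift_cartesian _ _.
have om : over m = over k := over_lift _ _.
have ok : p1 ∘ over k = idc I by rewrite -oe -over_comp ek over_id.
have [|i [oi mi]] := cart_lift cm (g := k) (w := idc I); first by rewrite om comp_idr.
exists (over k), i; split=> //; exists (e • m); split; first by rewrite -tcomp_assoc mi.
apply: (cart_inj cm); first by rewrite !over_comp oi oe om ok comp_idl over_id.
have [x [_ ux]] := fb _ _ _ cm _ _ _ _ _ ce (e • m).
rewrite tcomp_idr -[RHS](ux m) // [RHS](ux (m • (i • (e • m)))) //.
by rewrite (tcomp_assoc m) mi !tcomp_assoc ek tcomp_idl.
Qed.

End Split.
End Intrinsic.

(** * Comparison with the adjoint description *)

Section Transposes.
Variables (C D : Category) (L : Functor C D) (R : Functor D C) (A : Adjunction L R).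

Lemma adjoint_transpose_unit (x : C) (y : D) (g : hom x (R y)) :
  fmap R (adj_counit A y ∘ fmap L g) ∘ adj_unit A x = g.
Proof.
have /= n := nt_natural (adj_unit A) g.
by rewrite fmap_comp -comp_assoc -n comp_assoc adj_triangle_r comp_idl.
Qed.

Lemma adjoint_transpose_counit (x : C) (y : D) (h : hom (L x) y) :
  adj_counit A y ∘ fmap L (fmap R h ∘ adj_unit A x) = h.
Proof.
have /= n := nt_natural (adj_counit A) h.
by rewrite fmap_comp comp_assoc n -comp_assoc adj_triangle_l comp_idr.
Qed.

End Transposes.

Section Comparison.
Variables (B : Category) (FP : FiniteProducts B).
Local Notation "x × y" := (product FP x y) (at level 39, left associativity).
Local Notation "⟨ f , g ⟩" := (pairing (f := FP) f g).

Lemma tiso_isomorphic (E : CatOver B) (I : B) (a b : E I) (f : thom a b) :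
  over f = idc I -> tiso f -> isomorphic (a : Fib E I) b.
Proof.
move=> of0 tf; have [g [og [gf [fg _]]]] := tiso_inv_vert of0 tf.
exists (exist _ f of0 : hom (c := Fib E I) a b), (exist _ g og).
by split; apply: vert_ext.
Qed.

Lemma isomorphic_tiso (E : CatOver B) (I : B) (a b : Fib E I) :
  isomorphic a b -> exists f : thom a b, over f = idc I /\ tiso f.
Proof.
move=> [f [g [gf fg]]]; exists (varr f); split; first exact: over_varr.
by exists (varr g); rewrite -!varr_comp gf fg.
Qed.

Section Fixed.
Variable E : SplitFibration B.

Lemma varr_castv_section (A C : B) (u : hom A C) (v : hom C A) (a : E A)
    (e : reindex u (reindex v a) = a) : v ∘ u = idc A ->
  varr (castv e) = lift v a • lift u (reindex v a).
Proof.
move=> vu; rewrite -[LHS]tcomp_idl; apply: sig_castv.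
by rewrite -split_comp vu split_id.
Qed.

Lemma lift_castv_section (A C : B) (u : hom A C) (v : hom C A) (a : E A)
    (e : a = reindex u (reindex v a)) : v ∘ u = idc A ->
  lift v a • lift u (reindex v a) • varr (castv e) = tid a.
Proof.
move=> vu; apply: sig_castv.
by rewrite -split_comp vu split_id.
Qed.

Section Coproducts.
Variable S : SimpleCoproducts FP E.

Definition coprod_unit (I X : B) (b : E (I × X)) : thom b (scoprod S I X b) :=
  lift p1 _ • varr (adj_unit (coprod_adj S I X) b).

Lemma over_coprod_unit (I X : B) (b : E (I × X)) : over (coprod_unit b) = p1.
Proof. by rewrite over_comp over_lift over_varr comp_idr. Qed.

(** Precomposition with [coprod_unit] is the transposition of the adjunction. *)
Lemma coprod_unit_transpose (I X : B) (b : E (I × X)) (c : E I)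
    (h : hom (c := Fib E I) (scoprod S I X b) c) :
  varr h • coprod_unit b
  = lift p1 _ • varr (fmap (Reidx E p1) h ∘ adj_unit (coprod_adj S I X) b).
Proof.
rewrite /coprod_unit varr_comp !tcomp_assoc; congr (_ • _).
by rewrite [RHS]lift_reindex_map.
Qed.

Lemma coprod_unit_arrow (I X : B) (b : E (I × X)) : coproduct_arrow (coprod_unit b).
Proof.
split; first exact: over_coprod_unit.
move=> K c w g og.
have [|g1 [og1 eg1]] := cart_lift (cartesian_comp (lift_cartesian w c)
    (lift_cartesian (p1 : hom (I × X) I) (reindex w c))) (g := g) (w := idc _).
  by rewrite over_comp !over_lift comp_idr.
pose gv : hom (c := Fib E (I × X)) b (reindex p1 (reindex w c)) := exist _ g1 og1.
exists (lift w c • varr (adj_counit (coprod_adj S I X) _ ∘ fmap (scoprod S I X) gv)).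
split; first split.
- by rewrite over_comp over_lift over_varr comp_idr.
- by rewrite -tcomp_assoc coprod_unit_transpose adjoint_transpose_unit tcomp_assoc.
move=> h [oh eh].
have [|h1 [oh1 eh1]] := cart_lift (lift_cartesian w c) (g := h) (w := idc _).
  by rewrite over_lift comp_idr.
pose hv : hom (c := Fib E I) (scoprod S I X b) (reindex w c) := exist _ h1 oh1.
have e1 : fmap (Reidx E p1) hv ∘ adj_unit (coprod_adj S I X) b = gv.
  apply: vert_ext; apply: (cart_inj (cartesian_comp (lift_cartesian w c)
    (lift_cartesian (p1 : hom (I × X) I) (reindex w c)))).
    by rewrite !over_varr.
  by rewrite -[LHS]tcomp_assoc -coprod_unit_transpose [RHS]eg1 tcomp_assoc [varr hv]/= eh1.
by rewrite -e1 adjoint_transpose_counit.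
Qed.

(** The arrow [e] is the unit for [(u × 1)^*b] followed by the Beck-Chevalley map,
    which is an isomorphism: this is where the condition is used. *)
Lemma coprod_unit_reindex (I J X : B) (u : hom I J) (b : E (J × X))
    (e : thom (reindex (times FP u (idc X)) b) (reindex u (scoprod S J X b))) :
  over e = p1 -> lift u _ • e = coprod_unit b • lift (times FP u (idc X)) b ->
  coproduct_arrow e.
Proof.
move=> oe le; pose bc := coprod_bc (coprod_adj S) u b.
have [f [fb bf]] : is_iso bc := coprod_beck_chevalley S u b.
suff -> : e = varr bc • coprod_unit (reindex (times FP u (idc X)) b).
  apply: coproduct_arrow_comp_l (coprod_unit_arrow _); first exact: over_varr.
  by exists (varr f); rewrite -!varr_comp fb bf.
apply: (cart_inj (lift_cartesian u _)).
  by rewrite oe over_comp over_varr over_coprod_unit comp_idl.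
rewrite le coprod_unit_transpose.
have -> : fmap (Reidx E p1) bc ∘ adj_unit (coprod_adj S I X) (Reidx E (times FP u (idc X)) b) = _
  := adjoint_transpose_unit (coprod_adj S I X) _.
rewrite varr_comp !tcomp_assoc lift_cast_square; first by rewrite p1_times.
by rewrite /coprod_unit -!tcomp_assoc; congr (_ • _); rewrite [RHS]lift_reindex_map.
Qed.

Lemma coprod_unit_at (A X : B) (b : E (A × X)) (g : hom A X) (a : E A)
    (k : hom (c := Fib E A) a (reindex ⟨idc A, g⟩ b)) :
  varr (castv (reindex_graph FP g (scoprod S A X b))
        ∘ fmap (Reidx E ⟨idc A, g⟩) (adj_unit (coprod_adj S A X) b) ∘ k)
  = coprod_unit b • (lift ⟨idc A, g⟩ b • varr k).
Proof.
rewrite !varr_comp varr_castv_section; first by rewrite p1_pairing.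
rewrite /coprod_unit -!tcomp_assoc (tcomp_assoc (lift ⟨idc A, g⟩ _)).
by rewrite [X in _ • (X • _)]lift_reindex_map -!tcomp_assoc.
Qed.

(** [(g, h')] corresponds to [lift ⟨1, g⟩ b • h']. *)
Lemma coprod_qf_factor (A X : B) (a : E A) (b : E (A × X))
    (h : hom (c := Fib E A) a (scoprod S A X b)) :
  (exists! gh : {g : hom A X & hom (c := Fib E A) a (Reidx E ⟨idc A, g⟩ b)},
      let (g, h') := gh in
      h = castv (reindex_graph FP g (scoprod S A X b))
          ∘ fmap (Reidx E ⟨idc A, g⟩) (adj_unit (coprod_adj S A X) b) ∘ h') <->
  exists! k : thom a b, coprod_unit b • k = varr h.
Proof.
have fac : forall k : thom a b, coprod_unit b • k = varr h ->
    exists g (k' : hom (c := Fib E A) a (Reidx E ⟨idc A, g⟩ b)), k = lift ⟨idc A, g⟩ b • varr k'.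
  move=> k ek; exists (p2 ∘ over k).
  have ok : over k = ⟨idc A, p2 ∘ over k⟩.
    by apply: pairing_graph; rewrite -(over_coprod_unit b) -over_comp ek over_varr.
  have [|k' [ok' ek']] := cart_lift (lift_cartesian ⟨idc A, p2 ∘ over k⟩ b) (g := k) (w := idc A).
    by rewrite over_lift comp_idr.
  by exists (exist _ k' ok').
have inj : forall g1 g2 (k1 : hom (c := Fib E A) a (Reidx E ⟨idc A, g1⟩ b))
      (k2 : hom (c := Fib E A) a (Reidx E ⟨idc A, g2⟩ b)),
    lift ⟨idc A, g1⟩ b • varr k1 = lift ⟨idc A, g2⟩ b • varr k2 ->
    existT (fun g => hom (c := Fib E A) a (Reidx E ⟨idc A, g⟩ b)) g1 k1 = existT _ g2 k2.
  move=> g1 g2 k1 k2 e.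
  have eg : g1 = g2.
    have := f_equal (fun x => p2 ∘ over x) e.
    by rewrite !over_comp !over_lift !over_varr !comp_idr !p2_pairing.
  subst g2; congr existT; apply: vert_ext; apply: lift_eq e.
  by rewrite !over_varr.
split=> [[[g h'] [eh U]]|[k [ek U]]].
  exists (lift ⟨idc A, g⟩ b • varr h'); split; first by rewrite eh coprod_unit_at.
  move=> k ek; have [g2 [k' ek']] := fac k ek; rewrite ek'.
  have e : existT _ g h' = existT (fun g => hom (c := Fib E A) a (Reidx E ⟨idc A, g⟩ b)) g2 k'.
    by apply: U; apply: vert_ext; rewrite coprod_unit_at -ek'.
  have eg : g = g2 := f_equal (@projT1 _ _) e.
  by subst g2; rewrite (inj_pair2 _ _ _ _ _ e).
have [g [k' ek']] := fac k ek.
exists (existT _ g k'); split; first by apply: vert_ext; rewrite coprod_unit_at -ek'.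
move=> [g2 k2] e2; apply: inj; rewrite -ek'; apply: U.
by rewrite e2 coprod_unit_at.
Qed.

(** An arrow over [u] into [∐b] is a vertical arrow into [u^*∐b], which by
    [coprod_unit_reindex] is a coproduct of [(u × 1)^*b]. *)
Lemma coprod_qfP (I : B) (a : E I) : coprod_qf S a <-> coprod_free FP a.
Proof.
split=> [qa|fa]; last first.
  move=> A f X b h; apply/coprod_qf_factor.
  exact: fa _ _ _ (lift_cartesian f a) _ _ _ _ _ (coprod_unit_arrow b) (varr h).
move=> A a' r cr J X b s e ce h.
have [i [oi [ti ei]]] := coproduct_arrow_unique ce (coprod_unit_arrow b).
have [|x [ox [ex tx]]] := cartesian_compare cr (lift_cartesian (over r) a).
  by rewrite over_lift.
have [y [yx [xy ty]]] := tiso_inv tx.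
pose h1 := i • h • x; pose u := over h1.
have cu := lift_cartesian u (scoprod S J X b).
have cux := lift_cartesian (times FP u (idc X)) b.
have [|h2 [oh2 eh2]] := cart_lift cu (g := h1) (w := idc A); first by rewrite over_lift comp_idr.
have [|e' [oe' ee']] := cart_lift cu
   (g := coprod_unit b • lift (times FP u (idc X)) b) (w := p1).
  by rewrite over_comp over_coprod_unit !over_lift p1_times.
have [m [om [tm em]]] := coproduct_arrow_unique (coprod_unit_reindex oe' ee') (coprod_unit_arrow _).
have omh : over (m • h2) = idc A by rewrite over_comp om oh2 comp_idl.
have [k1 [ek1 uk1]] := proj1 (coprod_qf_factor (exist _ (m • h2) omh : hom (c := Fib E A) _ _))
  (qa A (over r) X (reindex (times FP u (idc X)) b) _).
move: ek1 uk1; rewrite /= => ek1 uk1.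
have Hk : forall k1' : thom (reindex (over r) a) (reindex (times FP u (idc X)) b),
    over (e' • k1') = idc A ->
    coprod_unit b • (lift (times FP u (idc X)) b • k1') = h1 ->
    coprod_unit _ • k1' = m • h2.
  move=> k2 ok2 ek2; rewrite -em -tcomp_assoc; congr (_ • _).
  apply: (cart_inj cu); first by rewrite ok2.
  by rewrite tcomp_assoc ee' eh2 -tcomp_assoc.
have ek : coprod_unit b • (lift (times FP u (idc X)) b • k1) = h1.
  rewrite tcomp_assoc -ee' -eh2 -tcomp_assoc; congr (_ • _).
  by apply: (tiso_mono tm); rewrite tcomp_assoc em ek1.
exists (lift (times FP u (idc X)) b • k1 • y); split.
  apply: (tiso_mono ti); have -> : i • h = h1 • y by rewrite /h1 -tcomp_assoc xy tcomp_idr.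
  by rewrite -ek !tcomp_assoc ei.
move=> k' ek'; apply: (tiso_epi tx); rewrite -tcomp_assoc yx tcomp_idr.
have ek3 : coprod_unit b • (k' • x) = h1 by rewrite -ei /h1 -ek' !tcomp_assoc.
have ok3 : over (k' • x) = ⟨u, p2 ∘ over (k' • x)⟩.
  by apply: pairing_graph; rewrite -(over_coprod_unit b) -over_comp ek3.
have [|k4 [ok4 ek4]] := cart_lift cux (g := k' • x) (w := ⟨idc A, p2 ∘ over (k' • x)⟩).
  by rewrite over_lift over_graph.
rewrite -ek4; congr (_ • _); apply: uk1; apply: Hk; last by rewrite ek4.
by rewrite over_comp oe' ok4 p1_pairing.
Qed.

End Coproducts.

Section Products.
Variable P : SimpleProducts FP E.

Definition prod_counit (I X : B) (b : E (I × X)) : thom (reindex p1 (sprod P I X b)) b :=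
  varr (adj_counit (prod_adj P I X) b).

(** Evaluating an arrow into [w^*∏b] amounts to composing it with the Beck-Chevalley
    map and transposing, by the definition of that map. *)
Lemma prod_counit_reindex (K I X : B) (c : E K) (w : hom K I) (b : E (I × X))
    (h : hom (c := Fib E K) c (reindex w (sprod P I X b))) :
  evaluates (lift p1 (sprod P I X b)) (prod_counit b)
    (lift w _ • varr h • lift p1 c) (times FP w (idc X))
    (lift (times FP w (idc X)) b
     • varr (adj_counit (prod_adj P K X) (Reidx E (times FP w (idc X)) b)
             ∘ fmap (Reidx E p1) (prod_bc (prod_adj P) w b ∘ h))).
Proof.
pose sq := castv (E := E) (eq_sym (reindex_square (sprod P I X b) (p1_times FP X w))).
exists (lift (times FP w (idc X)) _ • varr (sq ∘ fmap (Reidx E p1) h)); splits.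
- by rewrite over_comp over_lift over_varr comp_idr.
- rewrite varr_comp !tcomp_assoc lift_cast_square; first by rewrite p1_times.
  by rewrite -!tcomp_assoc; congr (_ • _); rewrite [LHS]lift_reindex_map.
- have eb : adj_counit (prod_adj P K X) (Reidx E (times FP w (idc X)) b)
      ∘ fmap (Reidx E p1) (prod_bc (prod_adj P) w b)
    = fmap (Reidx E (times FP w (idc X))) (adj_counit (prod_adj P I X) b) ∘ sq.
    by rewrite /prod_bc adjoint_transpose_counit.
  rewrite (fmap_comp (Reidx E p1)) (comp_assoc (c := Fib E (K × X))) eb.
  rewrite -(comp_assoc (c := Fib E (K × X))) [in RHS]varr_comp !tcomp_assoc.
  by congr (_ • _ • _); rewrite [RHS]lift_reindex_map.
Qed.

(** An arrow over [w] into [∏b] is a vertical arrow into [w^*∏b], which the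
    Beck-Chevalley map identifies with [∏ (w × 1)^*b]. *)
Lemma prod_counit_cone (I X : B) (b : E (I × X)) :
  product_cone (lift p1 (sprod P I X b)) (prod_counit b).
Proof.
apply: product_cone_intro.
- exact: over_lift.
- exact: lift_cartesian.
- exact: over_varr.
move=> K c; exists (reindex p1 c), (lift p1 c); split; first exact: over_lift.
split; first exact: lift_cartesian.
move=> w g og.
have [|g1 [og1 eg1]] := cart_lift (lift_cartesian (times FP w (idc X)) b) (g := g) (w := idc _).
  by rewrite over_lift comp_idr.
pose gv : hom (c := Fib E (K × X)) (Reidx E p1 c) (Reidx E (times FP w (idc X)) b) := exist _ g1 og1.
pose bc := prod_bc (prod_adj P) w b.
have [f [fb bf]] : is_iso bc := prod_beck_chevalley P w b.
pose tr : hom (c := Fib E K) c (sprod P K X (Reidx E (times FP w (idc X)) b)) :=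
  fmap (sprod P K X) gv ∘ adj_unit (prod_adj P K X) c.
split.
  exists (lift w _ • varr (f ∘ tr)); split.
    by rewrite over_comp over_lift over_varr comp_idr.
  have := prod_counit_reindex (f ∘ tr).
  rewrite (comp_assoc (c := Fib E K)) bf comp_idl adjoint_transpose_counit.
  by rewrite [varr gv]/= eg1.
have uniq : forall h : thom c (sprod P I X b), over h = w ->
    evaluates (lift p1 (sprod P I X b)) (prod_counit b) (h • lift p1 c) (times FP w (idc X)) g ->
    h = lift w _ • varr (f ∘ tr).
  move=> h oh eh.
  have [|h1 [oh1 eh1]] := cart_lift (lift_cartesian w (sprod P I X b)) (g := h) (w := idc _).
    by rewrite over_lift comp_idr.
  pose hv : hom (c := Fib E K) c (reindex w (sprod P I X b)) := exist _ h1 oh1.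
  have := prod_counit_reindex hv; rewrite [varr hv]/= eh1.
  move=> /(evaluates_fun (lift_cartesian _ _) eh) eg.
  rewrite -eh1; congr (_ • _); rewrite -[h1]/(varr hv); congr varr.
  suff e : bc ∘ hv = tr by rewrite -e (comp_assoc (c := Fib E K)) fb comp_idl.
  rewrite -[LHS](adjoint_transpose_unit (prod_adj P K X)) /tr; congr (fmap _ _ ∘ _).
  apply: vert_ext; apply: lift_eq; first by rewrite !over_varr.
  by rewrite -eg [varr gv]/= eg1.
by move=> h h' oh oh' eh eh'; rewrite (uniq _ oh eh) (uniq _ oh' eh').
Qed.

Lemma prod_qf_factor (A X : B) (a : E A) (b : E (A × X))
    (h : hom (c := Fib E A) (sprod P A X b) a) :
  (exists! gh : {g : hom A X & hom (c := Fib E A) (Reidx E ⟨idc A, g⟩ b) a},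
      let (g, h') := gh in
      h = h' ∘ fmap (Reidx E ⟨idc A, g⟩) (adj_counit (prod_adj P A X) b)
          ∘ castv (eq_sym (reindex_graph FP g (sprod P A X b)))) <->
  chosen_prod_factor (lift p1 (sprod P A X b)) (prod_counit b) (varr h).
Proof.
pose n g : hom (c := Fib E A) (sprod P A X b) (Reidx E ⟨idc A, g⟩ b) :=
  fmap (Reidx E ⟨idc A, g⟩) (adj_counit (prod_adj P A X) b)
  ∘ castv (eq_sym (reindex_graph FP g (sprod P A X b))).
have En : forall g, evaluates (lift p1 (sprod P A X b)) (prod_counit b) (tid _) ⟨idc A, g⟩
    (lift ⟨idc A, g⟩ b • varr (n g)).
  move=> g; exists (lift ⟨idc A, g⟩ _ • varr (castv (eq_sym (reindex_graph FP g (sprod P A X b))))).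
  splits.
  - by rewrite over_comp over_lift over_varr comp_idr.
  - by rewrite tcomp_assoc lift_castv_section // p1_pairing.
  - by rewrite varr_comp !tcomp_assoc; congr (_ • _); rewrite [RHS]lift_reindex_map.
have Fn : forall g (k : hom (c := Fib E A) (Reidx E ⟨idc A, g⟩ b) a),
    h = k ∘ fmap (Reidx E ⟨idc A, g⟩) (adj_counit (prod_adj P A X) b)
          ∘ castv (eq_sym (reindex_graph FP g (sprod P A X b))) <-> varr k • varr (n g) = varr h.
  move=> g k; rewrite -(comp_assoc (c := Fib E A)) -/(n g) -varr_comp; split=> [->|e] //.
  exact: vert_ext.
have Cn : forall g (k : thom (reindex ⟨idc A, g⟩ b) a),
    (exists n' : thom (sprod P A X b) (reindex ⟨idc A, g⟩ b), over n' = idc A /\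
      evaluates (lift p1 (sprod P A X b)) (prod_counit b) (tid _) ⟨idc A, g⟩
        (lift ⟨idc A, g⟩ b • n') /\ k • n' = varr h) <-> k • varr (n g) = varr h.
  move=> g k; split=> [[n' [on' [En' <-]]]|e]; last first.
    by exists (varr (n g)); splits=> //; exact: over_varr.
  congr (_ • _); apply: lift_eq; first by rewrite on' over_varr.
  exact: evaluates_fun (lift_cartesian _ _) (En g) En'.
have Vk : forall g (k : thom (reindex ⟨idc A, g⟩ b) a), k • varr (n g) = varr h -> over k = idc A.
  move=> g k e; have := f_equal over e.
  by rewrite over_comp !over_varr comp_idr.
split=> [[[g k] [/Fn ek U]]|[[g k] [/= /Cn ek U]]].
  exists (existT _ g (varr k)); split; first by apply/Cn.
  move=> [g2 k2] /= /Cn ek2.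
  pose kv : hom (c := Fib E A) (Reidx E ⟨idc A, g2⟩ b) a := exist _ k2 (Vk _ _ ek2).
  have e := U (existT _ g2 kv) (proj2 (Fn g2 kv) ek2).
  have eg : g = g2 := f_equal (@projT1 _ _) e.
  by subst g2; rewrite (inj_pair2 _ _ _ _ _ e).
pose kv : hom (c := Fib E A) (Reidx E ⟨idc A, g⟩ b) a := exist _ k (Vk _ _ ek).
exists (existT _ g kv); split; first by apply/Fn.
move=> [g2 k2] /Fn ek2.
have e := U (existT _ g2 (varr k2)) (proj2 (Cn g2 (varr k2)) ek2).
have eg : g = g2 := f_equal (@projT1 _ _) e.
subst g2; congr existT; apply: vert_ext; exact: (inj_pair2 _ _ _ _ _ e).
Qed.

End Products.

End Fixed.

Section Goedel.
Variables (E : SplitFibration B) (P : SimpleProducts FP E) (S : SimpleCoproducts FP E).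

(** The chosen products of the subfibration are those of the whole fibration, and
    quantifier-freeness only depends on products up to isomorphism. *)
Lemma prod_qfP (sk : is_Skolem P S) (I : B) (a : coprod_qf_sub S I) :
  prod_qf (coprod_qf_sub_products sk) a <-> prod_free FP (proj1_sig a).
Proof.
split=> [qa|fa].
  move=> A X b s d l ev fb C h.
  pose b0 : coprod_qf_sub S (A × X) := exist _ b (proj2 (coprod_qfP S b) fb).
  have C0 := prod_counit_cone P b.
  have [i [oi [ti Ei]]] := product_cone_unique C0 C.
  have [j [oj [ji [ij tj]]]] := tiso_inv_vert oi ti.
  have -> : h = (h • j) • i by rewrite -tcomp_assoc ji tcomp_idr.
  apply: (unique_prod_factor_cone oi ti (over_id b) (tiso_id b) C C0); first by rewrite tcomp_idl.
  have [|h1 [oh1 <-]] := cart_lift (lift_cartesian (over (h • j)) (proj1_sig a))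
    (g := h • j) (w := idc A).
    by rewrite over_lift comp_idr.
  apply/unique_prod_factor_cartesian; first exact: lift_cartesian.
  apply/chosen_prod_factorP.
  pose h2 : hom (c := Fib (coprod_qf_sub S) A) (sprod (coprod_qf_sub_products sk) A X b0)
    (Reidx (coprod_qf_sub S) (over (h • j)) a) := exist _ h1 oh1.
  exact: (proj1 (prod_qf_factor (P := coprod_qf_sub_products sk)
    (a := Reidx (coprod_qf_sub S) (over (h • j)) a) (b := b0) h2) (qa A _ X b0 h2)).
move=> A f X b h.
apply/(prod_qf_factor (P := coprod_qf_sub_products sk) (a := Reidx (coprod_qf_sub S) f a)).
have fb : coprod_free FP (proj1_sig b) by apply/coprod_qfP; exact: (proj2_sig b).
have H := fa _ _ _ _ _ _ _ fb (prod_counit_cone P (proj1_sig b))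
  (lift f (proj1_sig a) • varr (sub_out h)).
move/(unique_prod_factor_cartesian _ _ _ (lift_cartesian _ _))/chosen_prod_factorP: H.
exact.
Qed.

Lemma is_GoedelP : cartesian_closed FP -> is_Goedel P S <-> intrinsic_Goedel FP E.
Proof.
move=> ccc; split=> [[sk en]|G].
  split.
  - move=> I a; have [X [b [qb /isomorphic_tiso [f [of0 tf]]]]] := Skolem_enough sk a.
    have [g [og [_ [_ tg]]]] := tiso_inv_vert of0 tf.
    exists X, b, (g • coprod_unit S b); split; first exact/coprod_qfP.
    exact: coproduct_arrow_comp_l (coprod_unit_arrow S b).
  - move=> I X b s d l ev fb C.
    have [i [oi [ti _]]] := product_cone_unique (prod_counit_cone P b) C.
    apply: coprod_free_cartesian (tiso_cartesian ti) _.
    by apply/coprod_qfP; apply: (Skolem_stable sk); apply/coprod_qfP.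
  - move=> I a fa.
    pose a0 : coprod_qf_sub S I := exist _ a (proj2 (coprod_qfP S a) fa).
    have [X [b [/prod_qfP qb /isomorphic_tiso [f [of0 tf]]]]] := en I a0.
    have [g [og [_ [_ tg]]]] := tiso_inv_vert of0 tf.
    have C := product_cone_vertex (E := E) og tg (prod_counit_cone P (proj1_sig b)).
    move: (_ • lift _ _) C => l C.
    exists X, (proj1_sig b), _, l, (prod_counit P (proj1_sig b)); splits => //.
    by apply/coprod_qfP; exact: (proj2_sig b).
have sk : is_Skolem P S.
  split=> //.
  - move=> I a; have [X [b [e [fb ce]]]] := enough_coprod_free G a.
    have [i [oi [ti _]]] := coproduct_arrow_unique ce (coprod_unit_arrow S b).
    by exists X, b; split; [exact/coprod_qfP | exact: tiso_isomorphic oi ti].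
  - move=> I X a /coprod_qfP fa; apply/coprod_qfP.
    exact: coprod_free_product G _ _ _ _ _ _ _ fa (prod_counit_cone P a).
exists sk => I a.
have fa : coprod_free FP (proj1_sig a) by apply/coprod_qfP; exact: (proj2_sig a).
have [X [b [d [l [ev [fb [pb C]]]]]]] := enough_prod_free G fa.
pose b0 : coprod_qf_sub S (I × X) := exist _ b (proj2 (coprod_qfP S b) fb).
exists X, b0; split; first exact/prod_qfP.
have [i [oi [ti _]]] := product_cone_unique (prod_counit_cone P b) C.
exact: (tiso_isomorphic (E := coprod_qf_sub S) (a := a)
  (b := sprod (coprod_qf_sub_products sk) I X b0) (f := i) oi ti).
Qed.

End Goedel.
End Comparison.

(** * Equivalences over the base *)

Definition fully_faithful (B : Category) (D E : CatOver B) (F : FunctorOver D E) : Prop :=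
  forall (I J : B) (a : D I) (b : D J) (g : thom (F _ a) (F _ b)),
    exists! f : thom a b, fo_map F f = g.

Definition ess_surjective (B : Category) (D E : CatOver B) (F : FunctorOver D E) : Prop :=
  forall (I : B) (c : E I), exists (a : D I) (i : thom (F _ a) c),
    over i = idc I /\ tiso i.

Lemma equivalence_fully_faithful (C D : Category) (F : Functor C D) :
  is_equivalence F ->
  forall (x y : C) (g : hom (F x) (F y)), exists! f : hom x y, fmap F f = g.
Proof.
move=> [G [s [t [is_ it]]]] x y g.
have sE : forall (u v : C) (f : hom u v) si, si ∘ s v = idc _ -> f = si ∘ fmap G (fmap F f) ∘ s u.
  move=> u v f si e; have /= n := nt_natural s f.
  by rewrite -comp_assoc -n comp_assoc e comp_idl.
have tE : forall (u v : D) (h : hom u v) ti, t u ∘ ti = idc _ -> h = t v ∘ fmap F (fmap G h) ∘ ti.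
  move=> u v h ti e; have /= n := nt_natural t h.
  by rewrite n -comp_assoc e comp_idr.
have [si [e1 e2]] := is_ y; have [ti [e3 e4]] := it (F x).
have inj : forall f f' : hom x y, fmap F f = fmap F f' -> f = f'.
  by move=> f f' e; rewrite (sE _ _ f si) // (sE _ _ f' si) // e.
pose f := si ∘ fmap G g ∘ s x.
have ef : fmap F f = g.
  have eG : fmap G (fmap F f) = fmap G g.
    have [sx [e5 e6]] := is_ x.
    have /= n := nt_natural s f.
    have -> : fmap G (fmap F f) = s y ∘ f ∘ sx by rewrite n -comp_assoc e6 comp_idr.
    by rewrite /f !comp_assoc e2 comp_idl -comp_assoc e6 comp_idr.
  by rewrite (tE _ _ (fmap F f) ti) // eG -(tE _ _ g ti).
exists f; split=> // f' ef'; apply: inj; by rewrite ef.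
Qed.

Section OverEquivalence.
Variables (B : Category) (D E : CatOver B) (F : FunctorOver D E).

Lemma equivalence_over : is_equivalence (totalF F) ->
  fully_faithful F /\ exists G : Functor (total E) (total D), forall x : total E,
    exists i : thom (F _ (projT2 (G x))) (projT2 x), tiso i.
Proof.
move=> eF; split.
  move=> I J a b g.
  exact: (equivalence_fully_faithful eF (x := existT _ I a) (y := existT _ J b) g).
have [G [s [t [is_ it]]]] := eF; exists G => x.
by have [g [e1 e2]] := it x; exists (t x), g.
Qed.

Hypotheses (ff : fully_faithful F) (es : ess_surjective F).

Lemma fo_map_inj I J (a : D I) (b : D J) (f g : thom a b) :
  fo_map F f = fo_map F g -> f = g.
Proof. by move=> e; have [h [_ U]] := ff (fo_map F g); rewrite -(U f) // -(U g). Qed.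

Lemma fo_map_surj I J (a : D I) (b : D J) (g : thom (F _ a) (F _ b)) :
  exists f : thom a b, fo_map F f = g.
Proof. by have [f [e _]] := ff g; exists f. Qed.

Lemma fo_map_tiso I J (a : D I) (b : D J) (f : thom a b) :
  tiso f -> tiso (fo_map F f).
Proof. by move=> [g [gf fg]]; exists (fo_map F g); rewrite -!fo_comp gf fg !fo_id. Qed.

Lemma fo_map_tiso_reflect I J (a : D I) (b : D J) (f : thom a b) :
  tiso (fo_map F f) -> tiso f.
Proof.
move=> [g [gf fg]]; have [g0 eg] := fo_map_surj g; subst g.
by exists g0; split; apply: fo_map_inj; rewrite fo_comp fo_id.
Qed.

(** Test objects can be moved into the image of [F] along vertical isomorphisms, so
    preservation of cartesian arrows is automatic. *)
Lemma fo_map_cartesian : preserves_cartesian F.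
Proof.
move=> I J a b f cf K c w g og; rewrite fo_over in og.
have [c0 [i [oi ti]]] := es c.
have [i' [oi' [i'i [ii' ti']]]] := tiso_inv_vert oi ti.
have [g0 eg] := fo_map_surj (g • i).
have [|h0 [oh eh]] := cart_lift cf (g := g0) (w := w).
  by rewrite -(fo_over F) eg over_comp oi comp_idr.
exists (fo_map F h0 • i'); split; first split.
- by rewrite over_comp fo_over oh oi' comp_idr.
- by rewrite tcomp_assoc -fo_comp eh eg -tcomp_assoc ii' tcomp_idr.
move=> h [oh' eh']; apply: (tiso_epi ti); rewrite -tcomp_assoc i'i tcomp_idr.
have [h1 eh1] := fo_map_surj (h • i); rewrite -eh1; congr fo_map.
have oh1 : over h1 = w by rewrite -(fo_over F) eh1 over_comp oi comp_idr.
apply: (cart_inj cf); first by rewrite oh oh1.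
by apply: fo_map_inj; rewrite eh eg fo_comp eh1 tcomp_assoc eh'.
Qed.

Lemma fo_map_cartesian_reflect I J (a : D I) (b : D J) (f : thom a b) :
  is_cartesian (fo_map F f) -> is_cartesian f.
Proof.
move=> cf K c w g og.
have [|h [oh eh]] := cart_lift cf (g := fo_map F g) (w := w); first by rewrite !fo_over.
have [h0 e0] := fo_map_surj h; subst h.
exists h0; split; first split.
- by rewrite -(fo_over F).
- by apply: fo_map_inj; rewrite fo_comp.
move=> h1 [oh1 eh1]; apply: fo_map_inj; apply: (cart_inj cf).
  by rewrite oh fo_over.
by rewrite eh -fo_comp eh1.
Qed.

Definition preimage I J (a : D I) (b : D J) (g : thom (F _ a) (F _ b)) : thom a b :=
  proj1_sig (constructive_indefinite_description _ (fo_map_surj g)).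

Lemma preimageK I J (a : D I) (b : D J) (g : thom (F _ a) (F _ b)) :
  fo_map F (preimage g) = g.
Proof. exact: proj2_sig (constructive_indefinite_description _ (fo_map_surj g)). Qed.

Definition inverse_ob I (c : E I) : D I :=
  proj1_sig (constructive_indefinite_description _ (es c)).

Lemma inverse_iso_ex I (c : E I) :
  exists i : thom (F _ (inverse_ob c)) c * thom c (F _ (inverse_ob c)),
    over (fst i) = idc I /\ snd i • fst i = tid _ /\ fst i • snd i = tid _.
Proof.
have [i [oi [i' [e1 e2]]]] := proj2_sig (constructive_indefinite_description _ (es c)).
by exists (i, i').
Qed.

Definition inverse_isos I (c : E I) :=
  constructive_indefinite_description _ (inverse_iso_ex c).
Definition inverse_iso I (c : E I) : thom (F _ (inverse_ob c)) c :=
  fst (proj1_sig (inverse_isos c)).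
Definition inverse_isoV I (c : E I) : thom c (F _ (inverse_ob c)) :=
  snd (proj1_sig (inverse_isos c)).

Lemma over_inverse_iso I (c : E I) : over (inverse_iso c) = idc I.
Proof. by case: (proj2_sig (inverse_isos c)). Qed.

Lemma inverse_isoK I (c : E I) : inverse_isoV c • inverse_iso c = tid _.
Proof. by case: (proj2_sig (inverse_isos c)) => _ []. Qed.

Lemma inverse_isoVK I (c : E I) : inverse_iso c • inverse_isoV c = tid _.
Proof. by case: (proj2_sig (inverse_isos c)) => _ []. Qed.

Lemma over_inverse_isoV I (c : E I) : over (inverse_isoV c) = idc I.
Proof.
have := over_id (F _ (inverse_ob c)).
by rewrite -inverse_isoK over_comp over_inverse_iso comp_idr.
Qed.

(** The only choice that makes [inverse_iso] natural. *)
Definition inverse_map I J (a : E I) (b : E J) (g : thom a b) :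
    thom (inverse_ob a) (inverse_ob b) :=
  preimage (inverse_isoV b • g • inverse_iso a).

Lemma inverse_iso_natural I J (a : E I) (b : E J) (g : thom a b) :
  inverse_iso b • fo_map F (inverse_map g) = g • inverse_iso a.
Proof. by rewrite preimageK !tcomp_assoc inverse_isoVK tcomp_idl. Qed.

Definition inverse_over : FunctorOver E D.
Proof.
refine {| fo_ob := inverse_ob; fo_map := inverse_map |}.
- move=> I J a b f; rewrite -(fo_over F) preimageK !over_comp.
  by rewrite over_inverse_iso over_inverse_isoV comp_idl comp_idr.
- by move=> I a; apply: fo_map_inj; rewrite preimageK tcomp_idr inverse_isoK fo_id.
- move=> I J K a b c g f; apply: fo_map_inj; rewrite fo_comp !preimageK -!tcomp_assoc.
  by rewrite (tcomp_assoc _ (inverse_isoV b)) inverse_isoVK tcomp_idl.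
Defined.

Lemma inverse_over_ff : fully_faithful inverse_over.
Proof.
move=> I J a b g.
exists (inverse_iso b • fo_map F g • inverse_isoV a); split.
  apply: fo_map_inj; rewrite preimageK -!tcomp_assoc inverse_isoK tcomp_idr.
  by rewrite tcomp_assoc inverse_isoK tcomp_idl.
move=> f <-; rewrite preimageK -!tcomp_assoc inverse_isoVK tcomp_idr.
by rewrite tcomp_assoc inverse_isoVK tcomp_idl.
Qed.

Lemma inverse_over_es : ess_surjective inverse_over.
Proof.
move=> I a; have [i ei] := fo_map_surj (inverse_iso (F _ a)).
exists (F _ a), i; split; first by rewrite -(fo_over F) ei over_inverse_iso.
apply: fo_map_tiso_reflect; rewrite ei; exists (inverse_isoV (F _ a)).
by rewrite inverse_isoK inverse_isoVK.
Qed.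

Lemma fully_faithful_equivalence : is_equivalence (totalF F).
Proof.
pose s (x : total D) : hom (idF (total D) x) (compF (totalF inverse_over) (totalF F) x) :=
  preimage (inverse_isoV (F _ (projT2 x))).
pose t (x : total E) : hom (compF (totalF F) (totalF inverse_over) x) (idF (total E) x) :=
  inverse_iso (projT2 x).
have ns : forall x y (f : hom x y),
    s y ∘ fmap (idF (total D)) f = fmap (compF (totalF inverse_over) (totalF F)) f ∘ s x.
  move=> x y f; apply: fo_map_inj; rewrite /= !fo_comp !preimageK.
  by rewrite -!tcomp_assoc inverse_isoVK tcomp_idr.
have nt : forall x y (f : hom x y),
    t y ∘ fmap (compF (totalF F) (totalF inverse_over)) f = fmap (idF (total E)) f ∘ t x.
  by move=> x y f; apply: inverse_iso_natural.
exists (totalF inverse_over), (Build_NatTrans ns), (Build_NatTrans nt); split=> x.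
- have [f ef] := fo_map_surj (inverse_iso (F _ (projT2 x))).
  exists f; split; apply: fo_map_inj; rewrite /= fo_comp fo_id preimageK ef.
    exact: inverse_isoVK.
  exact: inverse_isoK.
- by exists (inverse_isoV (projT2 x)); split; [exact: inverse_isoK|exact: inverse_isoVK].
Qed.

End OverEquivalence.

(** An equivalence of total categories reaches [c] from an object over some [K ≅ I];
    reindexing that object along the isomorphism makes it lie over [I]. *)
Lemma equivalent_fibrationsP (B : Category) (D E : SplitFibration B) :
  equivalent_fibrations D E <->
  exists F : FunctorOver D E, fully_faithful F /\ ess_surjective F.
Proof.
split=> [[F [_ eF]]|[F [ff es]]]; last first.
  exists F; split; first exact: fo_map_cartesian.
  exact: fully_faithful_equivalence.
exists F; have [ff [G H]] := equivalence_over eF; split=> // I c.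
have [i [j [ji ij]]] := H (existT _ I c); move: (G _) i j ji ij => [K a] /= i j ji ij.
pose l := lift (over j) a.
exists (reindex (over j) a), (i • fo_map F l).
have o1 : over j ∘ over i = idc K by rewrite -over_comp ji over_id.
have o2 : over i ∘ over j = idc I by rewrite -over_comp ij over_id.
split; first by rewrite over_comp fo_over over_lift.
apply: tiso_comp; first by exists j.
apply: fo_map_tiso; apply: cartesian_tiso; first exact: lift_cartesian.
by rewrite over_lift; exists (over i).
Qed.

(** * Transport along equivalences *)

Section Transport.
Variables (B : Category) (FP : FiniteProducts B).
Local Notation "x × y" := (product FP x y) (at level 39, left associativity).
Local Notation "⟨ f , g ⟩" := (pairing (f := FP) f g).
Variables (D E : SplitFibration B) (F : FunctorOver D E).
Hypotheses (ff : fully_faithful F) (es : ess_surjective F).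

Lemma coproduct_arrow_fo_map (I X : B) (b : D (I × X)) (s : D I) (e : thom b s) :
  coproduct_arrow e -> coproduct_arrow (fo_map F e).
Proof.
move=> ce; have [oe U] := ce; split; first by rewrite fo_over.
move=> K c w g og; have [c0 [i [oi ti]]] := es c.
have [j [oj [ji [ij tj]]]] := tiso_inv_vert oi ti.
have [g0 eg] := fo_map_surj ff (j • g).
have [|h0 [[oh eh] _]] := U K c0 w g0.
  by rewrite -(fo_over F) eg over_comp oj comp_idl.
exists (i • fo_map F h0); split; first split.
- by rewrite over_comp fo_over oi oh comp_idl.
- by rewrite -tcomp_assoc -fo_comp eh eg tcomp_assoc ij tcomp_idl.
move=> h [oh' eh']; apply: (tiso_mono tj); rewrite tcomp_assoc ji tcomp_idl.
have [h1 eh1] := fo_map_surj ff (j • h); rewrite -eh1; congr fo_map.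
apply: (coproduct_arrow_inj ce).
  by rewrite oh -(fo_over F) eh1 over_comp oj comp_idl.
by apply: (fo_map_inj ff); rewrite eh eg fo_comp eh1 -tcomp_assoc eh'.
Qed.

Lemma coproduct_arrow_reflect (I X : B) (b : D (I × X)) (s : D I) (e : thom b s) :
  coproduct_arrow (fo_map F e) -> coproduct_arrow e.
Proof.
move=> ce; have [oe U] := ce; split; first by rewrite -(fo_over F).
move=> K c w g og.
have [|h [[oh eh] _]] := U K (F _ c) w (fo_map F g); first by rewrite fo_over.
have [h0 e0] := fo_map_surj ff h; subst h.
exists h0; split; first split.
- by rewrite -(fo_over F).
- by apply: (fo_map_inj ff); rewrite fo_comp.
move=> h1 [oh1 eh1]; apply: (fo_map_inj ff); apply: (coproduct_arrow_inj ce).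
  by rewrite oh fo_over.
by rewrite eh -fo_comp eh1.
Qed.

Lemma evaluates_fo_map (I X : B) (b : D (I × X)) (s : D I) (d : D (I × X))
    (l : thom d s) (ev : thom d b) (K : B) (c : D K) (r : thom c s) z v :
  evaluates (fo_map F l) (fo_map F ev) (fo_map F r) z (fo_map F v) <->
  evaluates l ev r z v.
Proof.
split=> [[q [oq [lq eq]]]|[q [oq [lq eq]]]].
  have [q0 e0] := fo_map_surj ff q; subst q; exists q0; split.
    by rewrite -(fo_over F).
  by split; apply: (fo_map_inj ff); rewrite fo_comp.
by exists (fo_map F q); rewrite fo_over -!fo_comp lq eq.
Qed.

Lemma product_cone_fo_map (I X : B) (b : D (I × X)) (s : D I) (d : D (I × X))
    (l : thom d s) (ev : thom d b) :
  product_cone l ev -> product_cone (fo_map F l) (fo_map F ev).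
Proof.
move=> P; have [ol [cl [oe U]]] := P.
apply: product_cone_intro; rewrite ?fo_over //; first exact: (fo_map_cartesian ff es).
move=> K c; have [c0 [i [oi ti]]] := es c.
have [j [oj [ji [ij tj]]]] := tiso_inv_vert oi ti.
pose lc := lift (p1 : hom (K × X) K) c0.
have clc : is_cartesian lc := lift_cartesian _ _.
have olc : over lc = p1 := over_lift _ _.
exists (F _ (reindex p1 c0)), (i • fo_map F lc); split.
  by rewrite over_comp fo_over oi olc comp_idl.
split.
  apply: cartesian_comp; first exact: tiso_cartesian.
  exact: (fo_map_cartesian ff es).
move=> w g og; have [g0 eg] := fo_map_surj ff g; subst g.
rewrite fo_over in og.
split.
  have [h0 [[oh eh] _]] := U _ c0 _ lc olc clc w g0 og.
  exists (fo_map F h0 • j); rewrite over_comp fo_over oj comp_idr; split=> //.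
  rewrite -tcomp_assoc (tcomp_assoc j) ji tcomp_idl -fo_comp.
  exact/evaluates_fo_map.
move=> h h' oh oh' eh eh'.
apply: (tiso_epi ti).
have [h0 e0] := fo_map_surj ff (h • i); have [h1 e1] := fo_map_surj ff (h' • i).
have oh0 : over h0 = w by rewrite -(fo_over F) e0 over_comp oi comp_idr.
have oh1 : over h1 = w by rewrite -(fo_over F) e1 over_comp oi comp_idr.
move: eh eh'; rewrite !tcomp_assoc -e0 -e1 -!fo_comp => /evaluates_fo_map eh /evaluates_fo_map eh'.
congr fo_map; apply: (product_cone_inj (v := g0) P olc clc); rewrite oh0 ?oh1 //.
Qed.

Lemma product_cone_reflect (I X : B) (b : D (I × X)) (s : D I) (d : D (I × X))
    (l : thom d s) (ev : thom d b) :
  product_cone (fo_map F l) (fo_map F ev) -> product_cone l ev.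
Proof.
move=> P; have [ol [cl [oe U]]] := P; rewrite /product_cone; splits.
- by rewrite -(fo_over F).
- exact: (fo_map_cartesian_reflect ff).
- by rewrite -(fo_over F).
move=> K c c' lc olc clc w g og.
have olc' : over (fo_map F lc) = p1 by rewrite fo_over.
have clc' := fo_map_cartesian ff es clc.
have [|h [[oh eh] _]] := U _ _ _ _ olc' clc' w (fo_map F g); first by rewrite fo_over.
have [h0 e0] := fo_map_surj ff h; subst h.
move: eh; rewrite -fo_comp => /evaluates_fo_map eh.
rewrite fo_over in oh.
exists h0; split=> //.
move=> h1 [oh1 eh1]; apply: (fo_map_inj ff).
apply: (product_cone_inj (v := fo_map F g) P olc' clc'); rewrite !fo_over oh // -?fo_comp;
  exact/evaluates_fo_map.
Qed.

(** Coproducts and cartesian arrows are preserved, so the factorization can be found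
    in the image of [F]. *)
Lemma coprod_free_reflect (I : B) (a : D I) :
  coprod_free FP (F _ a : E I) -> coprod_free FP a.
Proof.
move=> fa A a' r cr J X b s e ce h.
have [k [ek uk]] := fa _ _ _ (fo_map_cartesian ff es cr) _ _ _ _ _
  (coproduct_arrow_fo_map ce) (fo_map F h).
have [k0 e0] := fo_map_surj ff k; subst k.
exists k0; split; first by apply: (fo_map_inj ff); rewrite fo_comp.
by move=> k1 ek1; apply: (fo_map_inj ff); apply: uk; rewrite -fo_comp ek1.
Qed.

Lemma prod_factor_fo_map (I X : B) (b : D (I × X)) (s : D I) (d : D (I × X))
    (l : thom d s) (ev : thom d b) (A : B) (s' : D A) (r : thom s' s)
    (J : B) (a : D J) (h : thom s' a) g (b' : D A) (m : thom b' b) (k : thom b' a) :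
  prod_factor (fo_map F l) (fo_map F ev) (fo_map F r) (fo_map F h) g (fo_map F m) (fo_map F k)
  <-> prod_factor l ev r h g m k.
Proof.
rewrite /prod_factor !fo_over; split=> [[cm [om [n [on [en kn]]]]]|[cm [om [n [on [en kn]]]]]].
  have [n0 e0] := fo_map_surj ff n; subst n.
  split; first exact: (fo_map_cartesian_reflect ff).
  split=> //; exists n0; split; first by rewrite -(fo_over F).
  split; last by apply: (fo_map_inj ff); rewrite fo_comp.
  by apply/evaluates_fo_map; rewrite fo_comp.
split; first exact: (fo_map_cartesian ff es).
split=> //; exists (fo_map F n); rewrite fo_over -!fo_comp kn; splits=> //.
exact/evaluates_fo_map.
Qed.

Lemma prod_free_reflect (I : B) (a : D I) :
  (forall (J : B) (b : D J), coprod_free FP b -> coprod_free FP (F _ b : E J)) ->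
  prod_free FP (F _ a : E I) -> prod_free FP a.
Proof.
move=> H fa K X b s d l ev fb P h.
have [[g [b' [m [k f]]]] U] := fa _ _ _ _ _ _ _ (H _ _ fb) (product_cone_fo_map P) (fo_map F h).
split.
  have [b0 [i [oi ti]]] := es b'.
  have {}f := prod_factor_iso oi ti f.
  have [m0 em] := fo_map_surj ff (m • i); have [k0 ek] := fo_map_surj ff (k • i).
  exists g, b0, m0, k0; apply/prod_factor_fo_map.
  by rewrite fo_id em ek.
move=> g1 b1 m1 k1 g2 b2 m2 k2 /prod_factor_fo_map f1 /prod_factor_fo_map f2.
rewrite !fo_id in f1 f2.
have [eg [x [ox [e1 e2]]]] := U _ _ _ _ _ _ _ _ f1 f2; split=> //.
have [x0 e0] := fo_map_surj ff x; subst x.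
by exists x0; rewrite -(fo_over F); splits=> //; apply: (fo_map_inj ff); rewrite fo_comp.
Qed.

End Transport.

(** The notions are reflected by fully faithful, essentially surjective functors over
    the base.  Preservation, where needed, follows by reflecting along the inverse. *)
Lemma intrinsic_Goedel_transport (B : Category) (FP : FiniteProducts B)
    (D E : SplitFibration B) :
  equivalent_fibrations D E -> intrinsic_Goedel FP D -> intrinsic_Goedel FP E.
Proof.
move=> /equivalent_fibrationsP [F [ff es]] gD.
pose G := inverse_over ff es.
have gf : fully_faithful G by apply: inverse_over_ff.
have ge : ess_surjective G by apply: inverse_over_es.
have up : forall J (a : E J), coprod_free FP a -> coprod_free FP (G _ a : D J).
  move=> J a fa; apply: (coprod_free_reflect ff es).
  apply: coprod_free_cartesian fa; apply: (tiso_cartesian (f := inverse_iso es a)).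
  by exists (inverse_isoV es a); rewrite inverse_isoK inverse_isoVK.
split.
- move=> I a; have [X [b [e [fb ce]]]] := enough_coprod_free gD (G _ a : D I).
  have [b0 [i [oi ti]]] := ge _ b.
  have [e0 ee] := fo_map_surj gf (e • i).
  exists X, b0, e0; split.
    by apply: (coprod_free_reflect gf ge); apply: coprod_free_cartesian (tiso_cartesian ti) fb.
  by apply: (coproduct_arrow_reflect gf); rewrite ee; apply: coproduct_arrow_comp_r.
- move=> I X b s d l ev fb P; apply: (coprod_free_reflect gf ge).
  exact: coprod_free_product gD _ _ _ _ _ _ _ (up _ _ fb) (product_cone_fo_map gf ge P).
- move=> I a fa.
  have [X [b [d [l [ev [fb [pb P]]]]]]] := enough_prod_free gD (up _ _ fa).
  have [b0 [i [oi ti]]] := ge _ b; have [d0 [j [oj tj]]] := ge _ d.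
  have [i' [oi' [i'i [ii' ti']]]] := tiso_inv_vert oi ti.
  have := product_cone_iso oj tj oi' ti' P.
  have [l0 <-] := fo_map_surj gf (l • j).
  have [e0 <-] := fo_map_surj gf (i' • (ev • j)).
  move=> /(product_cone_reflect gf ge) P0.
  exists X, b0, d0, l0, e0; splits=> //.
    by apply: (coprod_free_reflect gf ge); apply: coprod_free_cartesian (tiso_cartesian ti) fb.
  apply: (prod_free_reflect gf ge up).
  by apply: prod_free_cartesian (tiso_cartesian ti) pb.
Qed.

(** * Arrows of the Dialectica construction *)

Section DialArrows.
Variables (B : Category) (FP : FiniteProducts B) (D : SplitFibration B).
Local Notation "x × y" := (product FP x y) (at level 39, left associativity).
Local Notation "⟨ f , g ⟩" := (pairing (f := FP) f g).

(** An arrow of the Dialectica category is recorded by its components in the base and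
    by an arrow [m] whose domain is any reindexing [a'] of the matrix along
    [⟨π_I, π_X, f1⟩], not only the chosen one.  The freedom in [a'] makes composition
    a pasting of squares, with no identification of iterated reindexings. *)
Definition represents (I J : B) (a : DialOb FP D I) (b : DialOb FP D J) (F : DialHom a b)
    (f : hom I J) (f0 : hom (I × d_X a) (d_X b)) (f1 : hom (I × d_X a × d_U b) (d_U a))
    (a' : D (I × d_X a × d_U b)) (l : thom a' (d_ob a)) (m : thom a' (d_ob b)) : Prop :=
  d_f F = f /\ d_f0 F = f0 /\ d_f1 F = f1 /\ is_cartesian l /\ over l = d_src f1 /\
  exists x : thom a' (reindex (d_src (d_f1 F)) (d_ob a)),
    over x = idc _ /\ lift _ (d_ob a) • x = l /\ d_mate F • x = m.

Section Basic.
Variables (I J : B) (a : DialOb FP D I) (b : DialOb FP D J).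

Lemma represents_over (F : DialHom a b) f f0 f1 a' (l : thom a' (d_ob a)) (m : thom a' (d_ob b)) :
  represents F f f0 f1 l m -> over m = d_tgt (d_U b) f f0.
Proof.
move=> [<- [<- [_ [_ [_ [x [ox [_ <-]]]]]]]].
by rewrite over_comp over_d_mate ox comp_idr.
Qed.

Lemma represents_ex f f0 f1 a' (l : thom a' (d_ob a)) (m : thom a' (d_ob b)) :
  is_cartesian l -> over l = d_src f1 -> over m = d_tgt (d_U b) f f0 ->
  exists F : DialHom a b, represents F f f0 f1 l m.
Proof.
move=> cl ol om.
have [|x [ox [ex tx]]] := cartesian_compare (lift_cartesian (d_src f1) (d_ob a)) cl.
  by rewrite over_lift.
have [y [oy [yx [xy ty]]]] := tiso_inv_vert ox tx.
have [|q [oq eq]] := cart_lift (lift_cartesian (d_tgt (d_U b) f f0) (d_ob b))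
  (g := m • y) (w := idc _).
  by rewrite over_comp om oy over_lift.
exists (@Build_DialHom _ _ _ _ _ a b f f0 f1 (exist _ q oq)); rewrite /represents; splits=> //.
exists x; splits=> //.
by rewrite /d_mate /= eq -tcomp_assoc yx tcomp_idr.
Qed.

Lemma represents_inj (F G : DialHom a b) f f0 f1 a' (l : thom a' (d_ob a)) (m : thom a' (d_ob b)) :
  represents F f f0 f1 l m -> represents G f f0 f1 l m -> F = G.
Proof.
move=> [e [e0 [e1 [cl [ol [x [ox [lx mx]]]]]]]] [e' [e0' [e1' [_ [_ [y [oy [ly my]]]]]]]].
apply: DialHom_ext; rewrite ?e ?e0 ?e1 // => t ot lt.
have ty : tiso y.
  apply: cartesian_tiso; last by rewrite oy; exists (idc _); rewrite comp_idl.
  by apply: (cartesian_cancel (lift_cartesian _ _)); rewrite ly.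
apply: (tiso_epi ty); rewrite my -mx -tcomp_assoc; congr (_ • _).
apply: lift_eq; first by rewrite over_comp ot oy ox comp_idl.
by rewrite tcomp_assoc lt ly lx.
Qed.

Lemma represents_fun (F : DialHom a b) f f0 f1 g g0 g1 a' (l : thom a' (d_ob a))
    (m n : thom a' (d_ob b)) :
  represents F f f0 f1 l m -> represents F g g0 g1 l n -> m = n.
Proof.
move=> [_ [_ [_ [_ [_ [x [ox [lx <-]]]]]]]] [_ [_ [_ [_ [_ [y [oy [ly <-]]]]]]]].
by congr (_ • _); apply: lift_eq; rewrite ?ox ?lx.
Qed.

Lemma represents_self (F : DialHom a b) a' (l : thom a' (d_ob a)) :
  is_cartesian l -> over l = d_src (d_f1 F) ->
  exists m, represents F (d_f F) (d_f0 F) (d_f1 F) l m.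
Proof.
move=> cl ol.
have [|x [ox lx]] := cart_lift (lift_cartesian (d_src (d_f1 F)) (d_ob a)) (g := l) (w := idc _).
  by rewrite over_lift comp_idr.
by exists (d_mate F • x); rewrite /represents; splits=> //; exists x.
Qed.

Lemma represents_eq (F : DialHom a b) f f0 f1 g g0 g1 a' (l k : thom a' (d_ob a))
    (m n : thom a' (d_ob b)) :
  represents F f f0 f1 l m -> f = g -> f0 = g0 -> f1 = g1 -> l = k -> m = n ->
  represents F g g0 g1 k n.
Proof. by move=> R <- <- <- <- <-. Qed.

End Basic.

Lemma represents_comp (I J K : B) (a : DialOb FP D I) (b : DialOb FP D J) (c : DialOb FP D K)
    (F : DialHom a b) f f0 f1 a' (l : thom a' (d_ob a)) (m : thom a' (d_ob b))
    (G : DialHom b c) g g0 g1 b' (l' : thom b' (d_ob b)) (m' : thom b' (d_ob c))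
    a'' (l'' : thom a'' (d_ob a)) (x : thom a'' a') (z : thom a'' b') :
  represents F f f0 f1 l m -> represents G g g0 g1 l' m' ->
  is_cartesian l'' -> over x = d_src (g1 ∘ d_tgt (d_U c) f f0) -> l • x = l'' ->
  over z = d_tgt (d_U c) f f0 -> l' • z = m • x ->
  represents (DialComp G F) (g ∘ f) (g0 ∘ ⟨f ∘ p1, f0⟩)
    (f1 ∘ d_src (g1 ∘ d_tgt (d_U c) f f0)) l'' (m' • z).
Proof.
move=> [<- [<- [<- [cl [ol [y [oy [ly my]]]]]]]] [<- [<- [<- [cl' [ol' [y' [oy' [ly' my']]]]]]]].
move=> cl'' ox lx oz lz.
have ol'' : over l'' = d_src (d_f1 F ∘ d_src (d_f1 G ∘ d_tgt (d_U c) (d_f F) (d_f0 F))).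
  by rewrite -lx over_comp ol ox d_comp_src.
rewrite /represents; splits=> //.
have [x0 [z0 [ox0 [lx0 [oz0 [lz0 E]]]]]] := d_mate_comp_ex G F.
have [|t [ot lt]] := cart_lift (lift_cartesian (d_src (d_f1 (DialComp G F))) (d_ob a))
   (g := l'') (w := idc _).
  by rewrite over_lift comp_idr ol''.
exists t; splits=> //; rewrite E -my'.
move: (d_mate G) => mG; rewrite -!tcomp_assoc; congr (_ • _).
apply: lift_eq; first by rewrite !over_comp oz0 ot oy' oz comp_idr comp_idl.
rewrite !tcomp_assoc lz0 ly' lz -my.
move: (d_mate F) => mF; rewrite -!tcomp_assoc; congr (_ • _).
apply: lift_eq; first by rewrite !over_comp ox0 ot oy ox comp_idr comp_idl.
by rewrite !tcomp_assoc lx0 lt ly lx.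
Qed.

Lemma represents_id (I : B) (a : DialOb FP D I) :
  represents (DialId a) (idc I) p2 p2 (tid (d_ob a)) (tid (d_ob a)).
Proof.
rewrite /represents; splits=> //.
- exact: tiso_cartesian (tiso_id _).
- by rewrite over_id d_src_p2.
have [|x [ox lx]] := cart_lift (lift_cartesian (d_src (d_f1 (DialId a))) (d_ob a))
   (g := tid _) (w := idc _).
  by rewrite over_lift over_id d_src_p2 comp_idr.
by exists x; splits=> //; rewrite d_mate_id.
Qed.

Lemma represents_lift (I J : B) (u : hom I J) (b : DialOb FP D J) :
  represents (d_lift u b) u p2 p2 (tid (d_ob (d_reindex u b)))
    (lift (times FP (times FP u (idc (d_X b))) (idc (d_U b))) (d_ob b)).
Proof.
rewrite /represents; splits=> //.
- exact: tiso_cartesian (tiso_id _).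
- by rewrite over_id d_src_p2.
have [|x [ox lx]] := cart_lift (lift_cartesian (d_src (d_f1 (d_lift u b))) (d_ob (d_reindex u b)))
   (g := tid _) (w := idc _).
  by rewrite over_lift over_id d_src_p2 comp_idr.
exists x; splits=> //; rewrite d_mate_lift -tcomp_assoc.
by rewrite [X in _ • X]lx tcomp_idr.
Qed.

(** Two cases in which composition simplifies: one factor has a trivial third
    component, so that it is given by an arrow between the matrices. *)
Lemma represents_comp_l (I J K Y Z V : B) (a : DialOb FP D I) (b : D (J × Y × V))
    (c : D (K × Z × V)) (F : DialHom a (Build_DialOb b))
    (G : DialHom (Build_DialOb b) (Build_DialOb c))
    f f0 f1 a' (l : thom a' (d_ob a)) (m : thom a' b) g g0 (n : thom b c) :
  represents F f f0 f1 l m -> represents G g g0 p2 (tid b) n ->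
  represents (DialComp G F) (g ∘ f) (g0 ∘ ⟨f ∘ p1, f0⟩) f1 l (n • m).
Proof.
move=> RF RG; have [_ [_ [_ [cl _]]]] := RF.
have om := represents_over RF.
have e : d_src (p2 ∘ d_tgt V f f0) = idc (I × d_X a × V).
  by rewrite /d_tgt p2_pairing d_src_p2.
apply: (represents_eq (represents_comp (b := Build_DialOb b) (c := Build_DialOb c)
  (x := tid a') (z := m) RF RG cl _ _ _ _)) => //.
- by rewrite over_id /= e.
- by rewrite tcomp_idr.
- by rewrite tcomp_idl tcomp_idr.
- by rewrite /= e comp_idr.
Qed.

Lemma represents_comp_r (I J K X Y V : B) (a : D (I × X × V)) (b : D (J × Y × V))
    (c : DialOb FP D K) (F : DialHom (Build_DialOb a) (Build_DialOb b))
    (G : DialHom (Build_DialOb b) c)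
    f f0 (n : thom a b) g g0 g1 b' (l : thom b' b) (m : thom b' (d_ob c))
    a' (x : thom a' a) (z : thom a' b') :
  represents F f f0 p2 (tid a) n -> represents G g g0 g1 l m ->
  is_cartesian x -> over x = d_src (g1 ∘ d_tgt (d_U c) f f0) ->
  over z = d_tgt (d_U c) f f0 -> l • z = n • x ->
  represents (DialComp G F) (g ∘ f) (g0 ∘ ⟨f ∘ p1, f0⟩) (g1 ∘ d_tgt (d_U c) f f0) x (m • z).
Proof.
move=> RF RG cx ox oz lz.
apply: (represents_eq (represents_comp (a := Build_DialOb a) (b := Build_DialOb b)
  (l'' := x) (x := x) (z := z) RF RG _ _ _ _ _)) => //.
- by rewrite tcomp_idl.
- by rewrite /d_src p2_pairing.
Qed.

Lemma represents_tid_ex (I J X Y V : B) (a : D (I × X × V)) (b : D (J × Y × V)) (n : thom a b)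
    f f0 : over n = d_tgt V f f0 ->
  exists e : DialHom (Build_DialOb a) (Build_DialOb b), represents e f f0 p2 (tid a) n.
Proof.
move=> on; apply: represents_ex => //; first exact: tiso_cartesian (tiso_id _).
by rewrite over_id d_src_p2.
Qed.

(** * Coproducts and products in the Dialectica construction *)

(** The coproduct over [X] of [I × X; Y; V; b'] is [I; X × Y; V; b'].  The product
    [X × Y] is replaced by any [Z] isomorphic to it because the case [Y = 1], [Z = X]
    is needed as well. *)
Section Coproduct.
Variables (I X Y Z V : B) (t : hom (X × Y) Z) (t' : hom Z (X × Y)).
Hypotheses (tt' : t ∘ t' = idc Z) (t't : t' ∘ t = idc _).
Variables (b : D (I × Z × V)) (b' : D (I × X × Y × V)) (n : thom b' b).
Local Notation i0 := (t ∘ ⟨p2 ∘ p1, p2⟩ : hom (I × X × Y) Z).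
Hypotheses (tn : tiso n) (on : over n = d_tgt V p1 i0).
Variable e : DialHom (Build_DialOb b') (Build_DialOb b).
Hypothesis Re : represents e p1 i0 p2 (tid b') n.

Let i' : hom (I × Z) (I × X × Y) := ⟨⟨p1, p1 ∘ (t' ∘ p2)⟩, p2 ∘ (t' ∘ p2)⟩.

Let tK W (x : hom W Z) : t ∘ (t' ∘ x) = x.
Proof. by rewrite comp_assoc tt' comp_idl. Qed.

Let tK' W (x : hom W (X × Y)) : t' ∘ (t ∘ x) = x.
Proof. by rewrite comp_assoc t't comp_idl. Qed.

Let ii' : ⟨p1 ∘ p1, i0⟩ ∘ i' = idc (I × Z).
Proof. by rewrite /i'; bsimp; rewrite pairing_unique tK pairing_id. Qed.

Let i'i : i' ∘ ⟨p1 ∘ p1, i0⟩ = idc (I × X × Y).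
Proof.
rewrite /i'; bsimp; rewrite !tK' p1_pairing p2_pairing.
by rewrite pairing_unique pairing_id.
Qed.

Let j W : hom (I × X × Y × W) (I × Z × W) := d_tgt W p1 i0.
Let j' W : hom (I × Z × W) (I × X × Y × W) := ⟨i' ∘ p1, p2⟩.

Let jj' W : j W ∘ j' W = idc _.
Proof.
have -> : j W = ⟨⟨p1 ∘ p1, i0⟩ ∘ p1, p2⟩ by rewrite /j; bsimp.
rewrite /j' pairing_comp p2_pairing -comp_assoc p1_pairing comp_assoc ii' comp_idl.
exact: pairing_id.
Qed.

Let j'j W : j' W ∘ j W = idc _.
Proof.
have -> : j W = ⟨⟨p1 ∘ p1, i0⟩ ∘ p1, p2⟩ by rewrite /j; bsimp.
rewrite /j' pairing_comp p2_pairing -comp_assoc p1_pairing comp_assoc i'i comp_idl.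
exact: pairing_id.
Qed.

Lemma dial_coproduct_reorder (T : B) : is_iso (d_tgt T p1 i0).
Proof. by exists (j' T); split; [exact: j'j | exact: jj']. Qed.

(** [e] only reorders the variables by an isomorphism, so each component of an arrow
    into [c] can be precomposed with the inverse reordering. *)
Lemma dial_coproduct_arrow :
  coproduct_arrow (E := Dial FP D) (b := Build_DialOb b' : Dial FP D (I × X))
    (s := Build_DialOb b : Dial FP D I) e.
Proof.
split; first by case: Re.
move=> K c w g og.
have [mg Rg] := represents_self (lift_cartesian (d_src (d_f1 g)) b') (over_lift _ _).
have omg := represents_over Rg.
move: Rg omg; rewrite [d_f g]og; move: (d_f1 g) (d_f0 g) mg => g1 g0.
set lg := lift _ b' => mg Rg omg.
have olg : over lg = _ := over_lift _ _.
have clg : is_cartesian lg := lift_cartesian _ _.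
pose k := lift (j' (d_U c)) (reindex (d_src g1) b').
have ok : over k = _ := over_lift _ _.
have tk : tiso k.
  apply: cartesian_tiso; first exact: lift_cartesian.
  by rewrite ok; exists (j (d_U c)).
have [k' [k'k [kk' tk']]] := tiso_inv tk.
have ok' : over k' = j (d_U c) by apply: (over_inv k'k); rewrite ok.
(* The matrix part is transported along the isomorphism [k], which inverts the
   reordering of the variables. *)
have [h Rh] : exists h : DialHom (Build_DialOb b) c,
    represents h w (g0 ∘ i') (g1 ∘ j' (d_U c)) (n • lg • k) (mg • k).
  apply: represents_ex.
  - by apply: cartesian_comp (tiso_cartesian tk); apply: cartesian_comp clg; apply: tiso_cartesian.
  - rewrite !over_comp on olg ok /j' /i'; bsimp.
    by rewrite pairing_unique tK -pairing_comp pairing_id comp_idl.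
  - rewrite over_comp omg ok /j' /i'; bsimp => //.
exists h; split; first split.
- by case: Rh.
- apply: represents_inj Rg.
  have R := represents_comp_r (x := lg) (z := k') Re Rh clg.
  apply: (represents_eq (R _ _ _)) => //.
  + by rewrite olg -comp_assoc -/(j _) j'j comp_idr.
  + by rewrite -!tcomp_assoc kk' tcomp_idr.
  + by rewrite -comp_assoc i'i comp_idr.
  + by rewrite -comp_assoc -/(j _) j'j comp_idr.
  + by rewrite -!tcomp_assoc kk' tcomp_idr.
move=> h2 [/= oh2 eh2].
have [_ [eg0 [eg1 _]]] := Rg; have [ef [ef0 [ef1 _]]] := Re.
have e0 : d_f0 h2 = g0 ∘ i'.
  by rewrite -eg0 -eh2 /= ef ef0 -comp_assoc ii' comp_idr.
have e1 : d_f1 h2 = g1 ∘ j' (d_U c).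
  by rewrite -eg1 -eh2 /= ef1 ef ef0 /d_src p2_pairing -comp_assoc -/(j _) jj' comp_idr.
have [_ [_ [_ [cl [ol _]]]]] := Rh.
have [|m2 R2] := represents_self (F := h2) cl; first by rewrite e1.
rewrite oh2 e0 e1 in R2; apply: represents_inj Rh _.
apply: (represents_eq R2) => //; apply: (tiso_epi tk').
rewrite -!tcomp_assoc kk' tcomp_idr; apply: represents_fun Rg.
rewrite -eh2; apply: (represents_comp_r (x := lg) Re R2) => //.
+ by rewrite olg -comp_assoc -/(j _) j'j comp_idr.
+ by rewrite -!tcomp_assoc kk' tcomp_idr.
Qed.

(** The second component of [h] is an arrow from [A × 1], hence from [A], to [X × Y].
    Its first half is the witness; its second half is the second component of [k]. *)
Lemma dial_coproduct_factor (A : B) (U : B) (a : D (A × terminal FP × U))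
    (h : thom (Build_DialOb a : Dial FP D A) (Build_DialOb b : Dial FP D I)) :
  exists! k : thom (Build_DialOb a : Dial FP D A) (Build_DialOb b' : Dial FP D (I × X)),
    (e : thom (Build_DialOb b' : Dial FP D (I × X)) (Build_DialOb b : Dial FP D I)) • k = h.
Proof.
have [n' [n'n [nn' tn']]] := tiso_inv tn.
have on' : over n' = j' V by apply: (over_inv n'n); rewrite on.
have eA1 : ⟨p1, bang FP A ∘ p1⟩ = idc (A × terminal FP).
  by rewrite -pairing_id; congr pairing; exact: terminal_unique.
have eA2 : ⟨p1 ∘ p1, bang FP A ∘ (p1 ∘ p1)⟩ = (p1 : hom (A × terminal FP × V) _).
  by rewrite comp_assoc -pairing_comp eA1 comp_idl.
have [m Rh] := represents_self (lift_cartesian (d_src (d_f1 h)) a) (over_lift _ _).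
have om := represents_over Rh.
have [_ [_ [_ [cl [ol _]]]]] := Rh.
set l := lift _ _ in Rh cl ol.
pose f : hom A (I × X) := ⟨d_f h, p1 ∘ (t' ∘ d_f0 h) ∘ ⟨idc A, bang FP A⟩⟩.
have [k Rk] : exists k : DialHom (Build_DialOb a) (Build_DialOb b'),
    represents k f (p2 ∘ (t' ∘ d_f0 h)) (d_f1 h) l (n' • m).
  apply: represents_ex => //.
  by rewrite over_comp on' om /j' /i' /f; bsimp; rewrite eA2.
exists k; split.
  apply: represents_inj Rh; apply: (represents_eq (represents_comp_l Rk Re)) => //.
  + by rewrite /f p1_pairing.
  + by rewrite /f; bsimp; rewrite eA1 comp_idr pairing_unique tK.
  + by rewrite tcomp_assoc nn' tcomp_idl.
move=> k2 ek2.
have [ef [ef0 [ef1 _]]] := Re.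
have f1_eq : p1 ∘ d_f k2 = d_f h by rewrite -ek2 /= ef.
have t_eq : t ∘ ⟨p2 ∘ (d_f k2 ∘ p1), d_f0 k2⟩ = d_f0 h.
  by rewrite -ek2 /= ef0 -comp_assoc pairing_comp -comp_assoc p1_pairing p2_pairing.
have g1_eq : d_f1 k2 = d_f1 h.
  by rewrite -ek2 /= ef1 /d_tgt p2_pairing d_src_p2 comp_idr.
have f_eq : d_f k2 = f.
  apply: pair_ext; rewrite /f ?p1_pairing // p2_pairing -t_eq tK' p1_pairing.
  by rewrite -!comp_assoc p1_pairing comp_idr.
have f0_eq : d_f0 k2 = p2 ∘ (t' ∘ d_f0 h) by rewrite -t_eq tK' p2_pairing.
have [|m2 R2] := represents_self (F := k2) cl; first by rewrite g1_eq.
rewrite f_eq f0_eq g1_eq in R2; apply: represents_inj Rk _.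
apply: (represents_eq R2) => //; apply: (tiso_mono tn).
rewrite tcomp_assoc nn' tcomp_idl; apply: represents_fun Rh.
by have := represents_comp_l R2 Re; rewrite [DialComp e k2]ek2; exact.
Qed.

End Coproduct.

End DialArrows.

(** The product over [X] of [I × X; 1; U; a'] is [I; 1; X × U; a'].  As for coproducts,
    [X × U] is replaced by an isomorphic [W] to cover the case [U = 1], [W = X]. *)
Section DialProduct.
Variables (B : Category) (FP : FiniteProducts B) (D : SplitFibration B).
Local Notation "x × y" := (product FP x y) (at level 39, left associativity).
Local Notation "⟨ f , g ⟩" := (pairing (f := FP) f g).
Local Notation "1" := (terminal FP).

Variables (I X U W : B) (t : hom (X × U) W) (t' : hom W (X × U)).
Hypotheses (tt' : t ∘ t' = idc W) (t't : t' ∘ t = idc _).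
Variables (a : D (I × 1 × W)) (a' : D (I × X × 1 × U)) (n : thom a' a).
Local Notation i1 := (t ∘ ⟨p2 ∘ (p1 ∘ p1), p2⟩ : hom (I × X × 1 × U) W).
Hypotheses (tn : tiso n) (on : over n = ⟨⟨p1 ∘ (p1 ∘ p1), bang FP _⟩, i1⟩).

Local Notation s := (Build_DialOb a : Dial FP D I).
Local Notation b := (Build_DialOb a' : Dial FP D (I × X)).
Local Notation d := (d_reindex p1 (Build_DialOb a) : Dial FP D (I × X)).
Local Notation l := (d_lift p1 (Build_DialOb a) : thom d s).
Local Notation r := (times FP (times FP (p1 : hom (I × X) I) (idc 1)) (idc W)).

(** The counit plugs the bound variable of the product into the third component. *)
Lemma dial_evaluation_ex : exists (ev : thom d b) (m : thom a' (reindex r a)),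
  represents ev (idc _) p2 i1 m (tid a') /\ lift r a • m = n.
Proof.
have [|m [om em]] := cart_lift (lift_cartesian r a) (g := n) (w := d_src i1).
  rewrite on over_lift; bsimp; congr ⟨⟨_, _⟩, _⟩; exact: terminal_unique.
have [|//||ev Rev] := @represents_ex B FP D _ _ d b (idc _) p2 i1 a' m (tid a').
- apply: (cartesian_cancel (lift_cartesian r a)); rewrite em; exact: tiso_cartesian.
- by rewrite over_id d_tgt_p2.
by exists ev, m.
Qed.

Variables (ev : thom d b) (m : thom a' (reindex r a)).
Hypothesis Rev : represents ev (idc _) p2 i1 m (tid a').
Hypothesis em : lift r a • m = n.

Let tK Z (x : hom Z W) : t ∘ (t' ∘ x) = x.
Proof. by rewrite comp_assoc tt' comp_idl. Qed.

Let tK' Z (x : hom Z (X × U)) : t' ∘ (t ∘ x) = x.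
Proof. by rewrite comp_assoc t't comp_idl. Qed.

Let bangE (Z : B) (f : hom Z 1) : f = bang FP Z.
Proof. exact: bang_unique. Qed.

Let R_l : represents l p1 p2 p2 (tid _) (lift r a).
Proof. exact: represents_lift. Qed.

Let om : over m = d_src i1.
Proof. by case: Rev => [_ [_ [_ [_ []]]]]. Qed.

Let jn' : hom (I × 1 × W) (I × X × 1 × U) :=
  ⟨⟨⟨p1 ∘ p1, p1 ∘ (t' ∘ p2)⟩, bang FP _⟩, p2 ∘ (t' ∘ p2)⟩.

Let j : hom (I × X × 1 × U) (I × 1 × W) := ⟨⟨p1 ∘ (p1 ∘ p1), bang FP _⟩, i1⟩.

Let jjn' : j ∘ jn' = idc _.
Proof.
rewrite /j /jn'; bsimp; rewrite pairing_unique tK pairing_terminal.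
exact: pairing_id.
Qed.

Lemma dial_product_reorder : is_iso j.
Proof.
exists jn'; split; last exact: jjn'.
rewrite /j /jn'; bsimp; rewrite !tK' p1_pairing p2_pairing !pairing_unique.
by rewrite (terminal_unique (bang FP _ ∘ _) (p2 ∘ p1)) !pairing_unique pairing_id.
Qed.

Section Test.
Variables (K Y V : B) (c0 : D (K × Y × V)).
Local Notation c := (Build_DialOb c0 : Dial FP D K).
Local Notation c' := (d_reindex (p1 : hom (K × X) K) (Build_DialOb c0) : Dial FP D (K × X)).
Local Notation lc := (d_lift p1 (Build_DialOb c0) : thom c' c).

Local Notation rc := (times FP (times FP (p1 : hom (K × X) K) (idc Y)) (idc V)).

Let q : hom (K × X × Y × U) (K × Y × W) :=
  ⟨⟨p1 ∘ (p1 ∘ p1), p2 ∘ p1⟩, t ∘ ⟨p2 ∘ (p1 ∘ p1), p2⟩⟩.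
Let q' : hom (K × Y × W) (K × X × Y × U) :=
  ⟨⟨⟨p1 ∘ p1, p1 ∘ (t' ∘ p2)⟩, p2 ∘ p1⟩, p2 ∘ (t' ∘ p2)⟩.

Let qq' : q ∘ q' = idc _.
Proof.
by rewrite /q /q'; bsimp; rewrite !pairing_unique tK pairing_id.
Qed.

Let q'q : q' ∘ q = idc _.
Proof.
by rewrite /q /q'; bsimp; rewrite !tK'; bsimp; rewrite !pairing_unique pairing_id.
Qed.


(** The third components [h1] and [g1], and with them the matrix parts, differ by the
    reordering [q] of the variables. *)
Lemma dial_product_transpose (w : hom K I) (h : DialHom c s) h0 h1 c1
    (lh : thom c1 c0) (mh : thom c1 a)
    c2 (y : thom c2 c1) (lg : thom c2 (reindex rc c0)) (mg : thom c2 a') g0 g1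
    (g : DialHom c' b) :
  represents h w h0 h1 lh mh -> over y = q -> lh • y = lift rc c0 • lg ->
  n • mg = mh • y -> g1 = h1 ∘ q ->
  represents g (times FP w (idc X)) g0 g1 lg mg ->
  evaluates l ev ((h : thom c s) • lc)
     (times FP w (idc X)) g.
Proof.
move=> Rh oy ey nmg eg1; subst g1; rewrite (bangE g0) => Rg.
have omh := represents_over Rh.
have [_ [_ [_ [clh [olh _]]]]] := Rh.
have [_ [_ [_ [clg [olg _]]]]] := Rg.
have omg := represents_over Rg.
pose p := d_tgt W (p1 : hom (K × X) K) (p2 : hom (K × X × Y) Y).
pose z := lift p c1.
have oz : over z = p := over_lift _ _.
have cz : is_cartesian z := lift_cartesian _ _.
have crc : is_cartesian (lift rc c0) := lift_cartesian _ _.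
have [|x [ox ex]] := cart_lift crc (g := lh • z) (w := d_src (h1 ∘ p)).
  by rewrite over_comp olh oz over_lift /p; bsimp.
have cx : is_cartesian x.
  by apply: (cartesian_cancel crc); rewrite ex; apply: cartesian_comp.
have Rhl := represents_comp_r (represents_lift p1 (Build_DialOb c0)) Rh cx ox oz (eq_sym ex).
pose w1 := times FP w (idc X).
have [|mq [omq emq]] := cart_lift (lift_cartesian r a) (g := mh • z)
   (w := d_tgt W w1 (bang FP (K × X × Y))).
  rewrite over_comp omh oz over_lift /p /w1; bsimp; congr ⟨⟨_, _⟩, _⟩.
  exact: terminal_unique.
have [qh Rq] : exists qh : DialHom c' d,
    represents qh w1 (bang FP (K × X × Y)) (h1 ∘ p) x mq.
  exact: represents_ex.
exists qh; split; first by case: Rq.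
split.
  apply: represents_inj Rhl; apply: (represents_eq (represents_comp_l Rq R_l)) => //.
  - by rewrite /w1 p1_times.
  - exact: terminal_unique.
pose k := d_src (i1 ∘ d_tgt U w1 (bang FP (K × X × Y))).
have [|x' [ox' ex']] := cart_lift cz (g := y) (w := k).
  by rewrite oy oz /q /p /k /w1; bsimp.
have exx : x • x' = lg.
  apply: (cart_inj crc).
    by rewrite over_comp ox ox' olg /q /p /k /w1; bsimp.
  by rewrite tcomp_assoc ex -ey -tcomp_assoc ex'.
have mx : m • mg = mq • x'.
  apply: (cart_inj (lift_cartesian r a)).
    by rewrite !over_comp om omq ox' omg /k /w1; bsimp.
  by rewrite !tcomp_assoc em nmg emq -tcomp_assoc ex'.
apply: represents_inj Rg.
have R := represents_comp Rq Rev clg ox' exx omg mx.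
apply: (represents_eq R) => //.
- exact: comp_idl.
- by rewrite -comp_assoc; congr (_ ∘ _); rewrite /q /p /w1; bsimp.
- exact: tcomp_idl.
Qed.

Let cr : is_cartesian (lift rc c0) := lift_cartesian _ _.

Lemma dial_product_transpose_ex (w : hom K I) (h : DialHom c s) h0 h1 c1
    (lh : thom c1 c0) (mh : thom c1 a)
    c2 (y : thom c2 c1) (lg : thom c2 (reindex rc c0)) (mg : thom c2 a') :
  represents h w h0 h1 lh mh -> over y = q -> lh • y = lift rc c0 • lg ->
  n • mg = mh • y -> is_cartesian lg -> over lg = d_src (h1 ∘ q) ->
  exists g : DialHom c' b, represents g (times FP w (idc X)) (bang FP (K × X × Y)) (h1 ∘ q) lg mg /\
    evaluates l ev ((h : thom c s) • lc) (times FP w (idc X)) g.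
Proof.
move=> Rh oy ey nmg clg olg.
have [n' [n'n [nn' tn']]] := tiso_inv tn.
have on' : over n' = jn'.
  by apply: (over_inv n'n); rewrite on; exact: jjn'.
have emg : mg = n' • (mh • y) by rewrite -nmg tcomp_assoc n'n tcomp_idl.
have [g Rg] : exists g : DialHom c' b,
    represents g (times FP w (idc X)) (bang FP (K × X × Y)) (h1 ∘ q) lg mg.
  apply: represents_ex => //.
  rewrite emg !over_comp on' (represents_over Rh) oy /jn' /q; bsimp.
  rewrite tK' p1_pairing p2_pairing; congr ⟨⟨_, _⟩, _⟩; exact: terminal_unique.
exists g; split=> //; exact: dial_product_transpose Rh oy ey nmg _ Rg.
Qed.

(** [g] determines [h] because the reordering [q] of the variables is invertible. *)
Lemma dial_product_test (w : hom K I) (g : DialHom c' b) :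
  d_f g = times FP w (idc X) ->
  (exists h : thom c s, over h = w /\ evaluates l ev (h • lc) (times FP w (idc X)) g) /\
  forall h h' : thom c s, over h = w -> over h' = w ->
    evaluates l ev (h • lc) (times FP w (idc X)) g ->
    evaluates l ev (h' • lc) (times FP w (idc X)) g -> h = h'.
Proof.
move=> og.
have clI : is_cartesian (l : thom d s) := lift_cartesian (s := Dial FP D) p1 s.
pose y0 := d_ob c'.
have [mg Rg] := represents_self (lift_cartesian (d_src (d_f1 g)) y0) (over_lift _ _).
rewrite og in Rg.
have [_ [_ [_ [clg [olg _]]]]] := Rg.
set lg := lift _ _ in Rg clg olg.
have [k [k' [ok [ok' [kk' [tk tk']]]]]] :
  exists (k : thom (reindex q' (reindex (d_src (d_f1 g)) y0)) (reindex (d_src (d_f1 g)) y0)) k',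
    over k = q' /\ over k' = q /\ k • k' = tid _ /\ tiso k /\ tiso k'.
  have tk : tiso (lift q' (reindex (d_src (d_f1 g)) y0)).
    apply: cartesian_tiso; first exact: lift_cartesian.
    by rewrite over_lift; exists q.
  have [k' [k'k [kk' tk']]] := tiso_inv tk.
  exists (lift q' _), k'; splits=> //; first exact: over_lift.
  by apply: (over_inv k'k); rewrite over_lift.
have omg := represents_over Rg.
pose lh := lift rc c0 • (lg • k); pose mh := n • (mg • k).
have clh : is_cartesian lh.
  by apply: cartesian_comp cr _; apply: cartesian_comp clg _; apply: tiso_cartesian.
have olh : over lh = d_src (d_f1 g ∘ q').
  by rewrite !over_comp over_lift olg ok /q'; bsimp; rewrite pairing_unique.
have ey : lh • k' = lift rc c0 • lg by rewrite /lh -!tcomp_assoc kk' tcomp_idr.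
have em' : n • mg = mh • k' by rewrite /mh -!tcomp_assoc kk' tcomp_idr.
have [h Rh] : exists h : DialHom c s, represents h w (bang FP (K × Y)) (d_f1 g ∘ q') lh mh.
  apply: represents_ex => //.
  rewrite !over_comp on omg ok /q'; bsimp; rewrite pairing_unique tK.
  by congr ⟨⟨_, _⟩, _⟩; exact: terminal_unique.
split.
  exists h; split; first by case: Rh.
  apply: dial_product_transpose Rh ok' ey em' _ Rg.
  by rewrite -comp_assoc q'q comp_idr.
have exn : forall Z (c2 : D Z) (x : thom c2 a), exists mg', n • mg' = x.
  move=> Z c2 x; have [n' [_ [nn' _]]] := tiso_inv tn.
  by exists (n' • x); rewrite tcomp_assoc nn' tcomp_idl.
have uniq : forall h' : DialHom c s, d_f h' = w ->
    evaluates l ev ((h' : thom c s) • lc) (times FP w (idc X)) g ->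
    represents h' w (bang FP (K × Y)) (d_f1 g ∘ q') lh mh.
  move=> h' oh' eh'.
  (* The transpose of [h'] is [g], and its third component is [d_f1 h' ∘ q]. *)
  have e1 : d_f1 h' = d_f1 g ∘ q'.
    have [m' R'] := represents_self (lift_cartesian (d_src (d_f1 h')) c0) (over_lift _ _).
    rewrite oh' in R'.
    have [_ [_ [_ [clh' [olh' _]]]]] := R'.
    pose y := lift q (reindex (d_src (d_f1 h')) c0).
    have oy : over y = q := over_lift _ _.
    have [|lg2 [olg2 elg2]] := cart_lift cr (g := lift _ c0 • y) (w := d_src (d_f1 h' ∘ q)).
      by rewrite over_comp over_lift oy over_lift /q; bsimp.
    have clg2 : is_cartesian lg2.
      by apply: (cartesian_cancel cr); rewrite elg2; apply: cartesian_comp (lift_cartesian _ _).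
    have [mg2 emg2] := exn _ _ (m' • y).
    have [g2 [R2 E2]] := dial_product_transpose_ex R' oy (eq_sym elg2) emg2 clg2 olg2.
    have eg : g = g2 := evaluates_fun clI eh' E2.
    have [_ [_ [e1 _]]] := R2.
    by rewrite eg e1 -comp_assoc qq' comp_idr.
  have [|m2 R2] := represents_self (F := h') clh; first by rewrite e1.
  rewrite oh' e1 (bangE (d_f0 h')) in R2.
  apply: (represents_eq R2) => //.
  have [mg2 emg2] := exn _ _ (m2 • k').
  have [|g2 [R3 E3]] := dial_product_transpose_ex R2 ok' ey emg2 clg.
    by rewrite -comp_assoc q'q comp_idr.
  have eg : g = g2 := evaluates_fun clI eh' E3.
  subst g2; apply: (tiso_epi tk').
  by rewrite -emg2 -em' (represents_fun R3 Rg).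
move=> h1 h2 o1 o2 E1 E2.
exact: represents_inj (uniq _ o1 E1) (uniq _ o2 E2).
Qed.

End Test.
Lemma dial_product_cone : product_cone l ev.
Proof.
apply: product_cone_intro.
- by [].
- exact: (lift_cartesian (s := Dial FP D) p1 s).
- by case: Rev.
move=> K [Y V c0]; exists (d_reindex p1 (Build_DialOb c0)), (d_lift p1 (Build_DialOb c0)).
split=> //; split; first exact: (lift_cartesian (s := Dial FP D) p1 (Build_DialOb c0)).
exact: dial_product_test.
Qed.

Section Graph.
Variable g : hom I X.
Local Notation rg := (times FP (times FP ⟨idc I, g⟩ (idc 1)) (idc U)).
Local Notation bg := (d_reindex ⟨idc I, g⟩ (Build_DialOb a') : Dial FP D I).
Local Notation mg := (d_lift ⟨idc I, g⟩ (Build_DialOb a') : thom bg b).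
Local Notation z := (lift rg a').

Variable ng : thom s bg.
Hypothesis Rng : represents ng (idc I) p2 (t ∘ ⟨g ∘ (p1 ∘ p1), p2⟩) (n • z)
  (tid (reindex rg a')).

(** [ng] is the instantiation at [g]. *)
Lemma dial_evaluates_graph : evaluates l ev (tid s) ⟨idc I, g⟩ (mg • ng).
Proof.
pose u := times FP (times FP ⟨idc I, g⟩ (idc 1)) (idc W).
have [|v [ov ev']] := cart_lift (lift_cartesian r a) (g := tid a) (w := u).
  rewrite over_id over_lift /u; bsimp; rewrite pairing_unique.
  by rewrite pairing_id.
have [sg Rs] : exists sg : DialHom (Build_DialOb a) d,
    represents sg ⟨idc I, g⟩ p2 p2 (tid a) v.
  apply: represents_ex.
  - exact: tiso_cartesian (tiso_id _).
  - by rewrite over_id d_src_p2.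
  - by rewrite ov /u; bsimp.
exists sg; split; first by case: Rs.
split.
  apply: represents_inj (represents_id _).
  apply: (represents_eq (represents_comp_l Rs R_l)) => //.
  - by rewrite p1_pairing.
  - by rewrite p2_pairing.
have [_ [_ [_ [cnz _]]]] := Rng.
have oz : over z = rg := over_lift _ _.
have R := @represents_comp_r B FP D I _ _ 1 1 W a _ b sg ev _ _ v _ _ _ a' m (tid a') _ (n • z) z
  Rs Rev cnz.
apply: represents_inj (represents_comp_l Rng (represents_lift _ _)).
apply: (represents_eq (R _ _ _)) => //.
- by rewrite over_comp on oz; bsimp; rewrite pairing_terminal.
- by rewrite oz; bsimp.
- apply: (cart_inj (lift_cartesian r a)).
    rewrite !over_comp om on oz ov /u; bsimp; congr ⟨⟨_, _⟩, _⟩.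
    exact: terminal_unique.
  by rewrite tcomp_assoc em tcomp_assoc ev' tcomp_idl.
- by bsimp.
- by bsimp.
- by bsimp.
- by rewrite tcomp_idl tcomp_idr.
Qed.

Lemma dial_prod_factor (J : B) (c : Dial FP D J) (h : thom s c) (k : thom bg c) :
  prod_factor l ev (tid s) h g mg k <-> k • ng = h.
Proof.
have clI : is_cartesian (l : thom d s) := lift_cartesian (s := Dial FP D) p1 s.
have cmg : is_cartesian mg := lift_cartesian (s := Dial FP D) _ _.
split=> [[_ [_ [n1 [on1 [en1 kn1]]]]]|kn].
  rewrite -kn1; congr (_ • _).
  apply: (cart_inj cmg); last exact: evaluates_fun clI dial_evaluates_graph en1.
  by rewrite on1; case: Rng.
split=> //; split=> //; exists ng; split; first by case: Rng.
by split=> //; exact: dial_evaluates_graph.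
Qed.

Variables (J : B) (c0 : D (J × 1 × 1)).
Local Notation c := (Build_DialOb c0 : Dial FP D J).

Lemma represents_comp_graph (k : DialHom bg c) f f0 k1 c1
    (lk : thom c1 (reindex rg a')) (mk : thom c1 c0) :
  represents k f f0 k1 lk mk ->
  represents (DialComp k ng) f f0 (t ∘ ⟨g ∘ (p1 ∘ p1), k1⟩) (n • z • lk) mk.
Proof.
move=> Rk; have [_ [_ [_ [cnz _]]]] := Rng; have [_ [_ [_ [clk [olk _]]]]] := Rk.
have e1 : d_tgt 1 (idc I) (p2 : hom (I × 1) 1) = idc _ by rewrite d_tgt_p2.
have R := @represents_comp B FP D I I J s bg c ng _ _ _ _ (n • z) (tid _) k _ _ _ c1 lk mk
  c1 (n • z • lk) lk (tid c1) Rng Rk.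
apply: (represents_eq (R _ _ _ _ _)) => //.
- exact: cartesian_comp.
- by rewrite olk /= e1 comp_idr.
- by rewrite over_id /= e1.
- by rewrite tcomp_idl tcomp_idr.
- by rewrite comp_idr.
- by bsimp; rewrite pairing_id comp_idr.
- by rewrite /= e1 comp_idr; bsimp.
- by rewrite tcomp_idr.
Qed.

End Graph.

Lemma dial_graph_ex (g : hom I X) :
  exists ng : thom s (d_reindex ⟨idc I, g⟩ (Build_DialOb a') : Dial FP D I),
  represents ng (idc I) p2 (t ∘ ⟨g ∘ (p1 ∘ p1), p2⟩)
    (n • lift (times FP (times FP ⟨idc I, g⟩ (idc 1)) (idc U)) a') (tid _).
Proof.
apply: represents_ex.
- by apply: cartesian_comp (tiso_cartesian tn) (lift_cartesian _ _).
- by rewrite over_comp on over_lift; bsimp; rewrite pairing_terminal.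
- by rewrite over_id d_tgt_p2.
Qed.

(** The third component of [h] is an arrow from [I × 1 × 1], hence from [I], to
    [X × U].  Its first half is the instance [g] that is used, its second half the
    third component of [k]. *)
Lemma dial_unique_prod_factor (J : B) (c0 : D (J × 1 × 1))
    (h : thom s (Build_DialOb c0 : Dial FP D J)) :
  unique_prod_factor l ev (tid s) h.
Proof.
pose v : hom I (I × 1 × 1) := ⟨⟨idc I, bang FP I⟩, bang FP I⟩.
have ve : v ∘ (p1 ∘ p1) = idc (I × 1 × 1).
  rewrite /v; bsimp; rewrite pairing_terminal -[RHS]pairing_id.
  by rewrite (terminal_unique (bang FP I ∘ (p1 ∘ p1)) p2).
have pv : p1 ∘ p1 ∘ v = idc I by rewrite /v; bsimp.
apply: unique_prod_factor_intro.
  have [mh Rh] := represents_self (lift_cartesian (d_src (d_f1 h)) a) (over_lift _ _).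
  have [_ [_ [_ [clh [olh _]]]]] := Rh.
  have omh := represents_over Rh.
  set lh := lift _ _ in Rh clh olh.
  pose g := p1 ∘ (t' ∘ d_f1 h) ∘ v.
  have eh1 : t ∘ ⟨g ∘ (p1 ∘ p1), p2 ∘ (t' ∘ d_f1 h)⟩ = d_f1 h.
    by rewrite /g -(comp_assoc _ v) ve comp_idr pairing_unique tK.
  clearbody g.
  have [ng Rng] := dial_graph_ex g.
  have [_ [_ [_ [cnz [onz _]]]]] := Rng.
  have [|lk [olk elk]] := cart_lift cnz (g := lh) (w := d_src (p2 ∘ (t' ∘ d_f1 h))).
    by rewrite olh onz -[in LHS]eh1; bsimp.
  have clk : is_cartesian lk by apply: (cartesian_cancel cnz); rewrite elk.
  have [k Rk] : exists k : DialHom (d_reindex ⟨idc I, g⟩ (Build_DialOb a')) (Build_DialOb c0),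
      represents k (d_f h) (d_f0 h) (p2 ∘ (t' ∘ d_f1 h)) lk mh.
    exact: represents_ex.
  exists g, k; apply/(dial_prod_factor Rng).
  apply: represents_inj Rh; apply: (represents_eq (represents_comp_graph Rng Rk)) => //.
move=> g1 g2 k1 k2; have [n1 R1] := dial_graph_ex g1; have [n2 R2] := dial_graph_ex g2.
move=> /(dial_prod_factor R1) e1 /(dial_prod_factor R2) e2.
have [mk1 Rk1] := represents_self (lift_cartesian (d_src (d_f1 k1)) _) (over_lift _ _).
have [mk2 Rk2] := represents_self (lift_cartesian (d_src (d_f1 k2)) _) (over_lift _ _).
have C1 := represents_comp_graph R1 Rk1; have C2 := represents_comp_graph R2 Rk2.
have f1 : ⟨g1 ∘ (p1 ∘ p1), d_f1 k1⟩ = ⟨g2 ∘ (p1 ∘ p1), d_f1 k2⟩.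
  rewrite -[LHS]tK' -[RHS]tK'; congr (_ ∘ _).
  have [_ [_ [<- _]]] := C1; have [_ [_ [<- _]]] := C2.
  by rewrite [DialComp k1 n1]e1 [DialComp k2 n2]e2.
have eg : g1 = g2.
  have := f_equal (fun x => p1 ∘ x ∘ v) f1.
  by rewrite !p1_pairing -!comp_assoc (comp_assoc p1 p1) pv !comp_idr.
have ek1 : d_f1 k1 = d_f1 k2 by have := f_equal (fun x => p2 ∘ x) f1; rewrite !p2_pairing.
subst g2; congr existT.
have e3 : DialComp k1 n1 = DialComp k2 n1.
  by rewrite [LHS]e1 -e2 (represents_inj R2 R1).
have [_ [_ [_ [clk [olk _]]]]] := Rk1.
have [|mk3 Rk3] := represents_self (F := k2) clk; first by rewrite -ek1.
have D1 := represents_comp_graph R1 Rk1; have D3 := represents_comp_graph R1 Rk3.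
rewrite -e3 in D3.
have ef : d_f k1 = d_f k2 by have [<- _] := D1; have [<- _] := D3.
have ef0 : d_f0 k1 = d_f0 k2 by have [_ [<- _]] := D1; have [_ [<- _]] := D3.
rewrite -ef -ef0 -ek1 in Rk3.
apply: represents_inj Rk1 (represents_eq Rk3 _ _ _ _ _) => //.
rewrite -ek1 in D3; exact: represents_fun D3 D1.
Qed.

End DialProduct.

(** * The Dialectica construction is a Goedel fibration *)

Section DialGoedel.
Variables (B : Category) (FP : FiniteProducts B) (D : SplitFibration B).
Local Notation "x × y" := (product FP x y) (at level 39, left associativity).
Local Notation "⟨ f , g ⟩" := (pairing (f := FP) f g).
Local Notation "1" := (terminal FP).

Lemma reindex_iso_arrow (A C : B) (u : hom A C) (a : D A) : is_iso u ->
  exists (b : D C) (n : thom a b), over n = u /\ tiso n.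
Proof.
move=> [v [vu uv]]; pose m := lift v a.
have om : over m = v := over_lift _ _.
have tm : tiso m.
  by apply: cartesian_tiso; [exact: lift_cartesian | rewrite om; exists u].
have [n [nm [mn tn]]] := tiso_inv tm.
exists (reindex v a), n; split=> //; apply: (over_inv nm); by rewrite om.
Qed.

Lemma iso_reindex_arrow (A C : B) (u : hom A C) (b : D C) : is_iso u ->
  exists (a : D A) (n : thom a b), over n = u /\ tiso n.
Proof.
move=> iu; exists (reindex u b), (lift u b); split; first exact: over_lift.
by apply: cartesian_tiso; [exact: lift_cartesian | rewrite over_lift].
Qed.

Lemma times_terminal_iso (X : B) :
  (p1 : hom (X × 1) X) ∘ ⟨idc X, bang FP X⟩ = idc X /\
  ⟨idc X, bang FP X⟩ ∘ (p1 : hom (X × 1) X) = idc _.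
Proof.
split; first by rewrite p1_pairing.
rewrite pairing_comp comp_idl -pairing_id; congr pairing; exact: terminal_unique.
Qed.

(** Coproducts are unique up to isomorphism, so it suffices to test quantifier-freeness
    against these. *)
Lemma dial_coproduct_of (I X : B) (b : Dial FP D (I × X)) :
  exists (Z V : B) (b1 : D (I × Z × V)) (e : thom b (Build_DialOb b1 : Dial FP D I)),
    coproduct_arrow e /\
    forall (A U : B) (a : D (A × 1 × U))
      (h : thom (Build_DialOb a : Dial FP D A) (Build_DialOb b1 : Dial FP D I)),
      exists! k : thom (Build_DialOb a : Dial FP D A) b, e • k = h.
Proof.
case: b => Y V b'.
have i1 : idc (X × Y) ∘ idc _ = idc _ := comp_idl _.
have [b1 [n [on tn]]] := reindex_iso_arrow b' (dial_coproduct_reorder I i1 i1 V).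
have [e Re] := represents_tid_ex on.
exists (X × Y), V, b1, e; split; first exact: (dial_coproduct_arrow i1 i1 tn on Re).
move=> A U a h; exact: (dial_coproduct_factor i1 i1 tn on Re).
Qed.

Lemma dial_coprod_free (A U : B) (a : D (A × 1 × U)) :
  coprod_free FP (Build_DialOb a : Dial FP D A).
Proof.
move=> A' a' r cr J X b s e ce h.
have cl : is_cartesian (d_lift (over r) (Build_DialOb a)
    : thom (d_reindex (over r) (Build_DialOb a) : Dial FP D A') (Build_DialOb a : Dial FP D A)).
  exact: (lift_cartesian (s := Dial FP D)).
have [|x [ox [ex tx]]] := cartesian_compare cr cl; first by [].
have [Z [V [b1 [e1 [ce1 U1]]]]] := dial_coproduct_of b.
have [i [oi [ti ei]]] := coproduct_arrow_unique ce ce1.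
have [k [ek uk]] := U1 _ _ _ (i • h • x).
have [y [yx [xy ty]]] := tiso_inv tx.
exists (k • y); split.
  apply: (tiso_mono ti); rewrite !tcomp_assoc ei ek -!tcomp_assoc xy.
  by rewrite tcomp_idr.
move=> k' ek'; apply: (tiso_epi tx); rewrite -tcomp_assoc yx tcomp_idr; apply: uk.
by rewrite -ei -ek' !tcomp_assoc.
Qed.

Lemma dial_enough_coprod_free (I : B) (a : Dial FP D I) :
  exists (X U : B) (b : D (I × X × 1 × U)) (e : thom (Build_DialOb b : Dial FP D (I × X)) a),
    coproduct_arrow e.
Proof.
case: a => X U a; have [tt' t't] := times_terminal_iso X.
have [b [n [on tn]]] := iso_reindex_arrow a (dial_coproduct_reorder I tt' t't U).
have [e Re] := represents_tid_ex on.
by exists X, U, b, e; exact: (dial_coproduct_arrow tt' t't tn on Re).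
Qed.

(** By [coprod_free_instance], a quantifier-free object is an instance of the one of
    which it is a coproduct, and instances preserve the form of the latter. *)
Lemma dial_coprod_free_form (I : B) (a : Dial FP D I) : coprod_free FP a ->
  exists (U : B) (b : D (I × 1 × U)) (i : thom a (Build_DialOb b : Dial FP D I)),
    over i = idc I /\ tiso i.
Proof.
move=> fa; have [X [U [b [e ce]]]] := dial_enough_coprod_free a.
have [g [i [oi ti]]] := coprod_free_instance fa (dial_coprod_free (a := b)) ce.
by eexists U, _, i.
Qed.

Lemma dial_prod_free (J : B) (c : D (J × 1 × 1)) :
  prod_free FP (Build_DialOb c : Dial FP D J).
Proof.
move=> I X b s d l ev fb P h.
have [U [b0 [j [oj tj]]]] := dial_coprod_free_form fb.
have i1 : idc (X × U) ∘ idc _ = idc _ := comp_idl _.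
have [a [n [on tn]]] := reindex_iso_arrow b0 (dial_product_reorder I i1 i1).
have [ev0 [m [Rev em]]] := dial_evaluation_ex tn on.
have P0 := dial_product_cone i1 i1 tn on Rev em.
have P1 := product_cone_iso (over_id d) (tiso_id d) oj tj P.
have [i [oi [ti Ei]]] := product_cone_unique P0 P1.
rewrite !tcomp_idr in Ei.
have [i' [oi' [i'i [ii' _]]]] := tiso_inv_vert oi ti.
have -> : h = (h • i') • i by rewrite -tcomp_assoc i'i tcomp_idr.
apply: (unique_prod_factor_cone oi ti oj tj P P0 Ei).
exact: (dial_unique_prod_factor i1 i1 tn on Rev em).
Qed.

Lemma dial_intrinsic_Goedel : intrinsic_Goedel FP (Dial FP D).
Proof.
split.
- move=> I a; have [X [U [b [e ce]]]] := dial_enough_coprod_free a.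
  by exists X, (Build_DialOb b), e; split=> //; exact: dial_coprod_free.
- move=> I X b s d l ev fb P.
  have [U [b0 [j [oj tj]]]] := dial_coprod_free_form fb.
  have i1 : idc (X × U) ∘ idc _ = idc _ := comp_idl _.
  have [a [n [on tn]]] := reindex_iso_arrow b0 (dial_product_reorder I i1 i1).
  have [ev0 [m [Rev em]]] := dial_evaluation_ex tn on.
  have P0 := dial_product_cone i1 i1 tn on Rev em.
  have P1 := product_cone_iso (over_id d) (tiso_id d) oj tj P.
  have [i [oi [ti _]]] := product_cone_unique P0 P1.
  exact: coprod_free_cartesian (tiso_cartesian ti) (dial_coprod_free (a := a)).
- move=> I a fa; have [U [a0 [i [oi ti]]]] := dial_coprod_free_form fa.
  have [i' [oi' [i'i [ii' ti']]]] := tiso_inv_vert oi ti.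
  have [tt' t't] := times_terminal_iso U.
  have [b [n [on tn]]] := iso_reindex_arrow a0 (dial_product_reorder I tt' t't).
  have [ev0 [m [Rev em]]] := dial_evaluation_ex tn on.
  have P0 := dial_product_cone tt' t't tn on Rev em.
  have P1 := product_cone_vertex oi' ti' P0.
  move: (i' • _) P1 => l1 P1.
  exists U, (Build_DialOb b), _, l1, ev0; splits; last exact: P1.
    exact: dial_coprod_free.
  exact: dial_prod_free.
Qed.

End DialGoedel.

(** * Reconstruction of a Goedel fibration *)

Section Reconstruction.
Variables (B : Category) (FP : FiniteProducts B).
Local Notation "x × y" := (product FP x y) (at level 39, left associativity).
Local Notation "⟨ f , g ⟩" := (pairing (f := FP) f g).
Variables (E : SplitFibration B) (P : SimpleProducts FP E) (S : SimpleCoproducts FP E).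
Hypothesis G : intrinsic_Goedel FP E.

Definition quantifier_free I (a : E I) : Prop := coprod_free FP a /\ prod_free FP a.

Lemma quantifier_free_reindex (A C : B) (u : hom A C) (a : E C) :
  quantifier_free a -> quantifier_free (reindex u a).
Proof.
move=> [fa pa]; split.
- exact: coprod_free_cartesian (lift_cartesian u a) fa.
- exact: prod_free_cartesian (lift_cartesian u a) pa.
Qed.

Definition qf_fibration : SplitFibration B := full_sub quantifier_free_reindex.
Local Notation D := qf_fibration.

Section Object.
Variables (I : B) (x : DialOb FP D I).

Definition matrix : E (I × d_X x × d_U x) := proj1_sig (d_ob x).
Definition prod_part : E (I × d_X x) := sprod P (I × d_X x) (d_U x) matrix.
(** [I; X; U; α] read as [∐_X ∏_U α]. *)
Definition interpretation : E I := scoprod S I (d_X x) prod_part.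
Definition cone_lift : thom (reindex (p1 : hom (I × d_X x × d_U x) _) prod_part) prod_part :=
  lift p1 prod_part.
Definition cone_eval : thom (reindex (p1 : hom (I × d_X x × d_U x) _) prod_part) matrix :=
  prod_counit P matrix.
Definition injection : thom prod_part interpretation := coprod_unit S prod_part.
Definition weaken (V : B) : thom (reindex (p1 : hom (I × d_X x × V) _) prod_part) prod_part :=
  lift p1 prod_part.

Lemma cone_of : product_cone cone_lift cone_eval.
Proof. exact: prod_counit_cone. Qed.

Lemma injection_arrow : coproduct_arrow injection.
Proof. exact: coprod_unit_arrow. Qed.

Lemma matrix_coprod_free : coprod_free FP matrix.
Proof. exact: (proj1 (proj2_sig (d_ob x))). Qed.

Lemma matrix_prod_free : prod_free FP matrix.
Proof. exact: (proj2 (proj2_sig (d_ob x))). Qed.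

Lemma prod_part_coprod_free : coprod_free FP prod_part.
Proof. exact: coprod_free_product G _ _ _ _ _ _ _ matrix_coprod_free cone_of. Qed.

Lemma cone_lift_cartesian : is_cartesian cone_lift.
Proof. exact: lift_cartesian. Qed.

Lemma weaken_cartesian V : is_cartesian (weaken V).
Proof. exact: lift_cartesian. Qed.

Lemma over_weaken V : over (weaken V) = p1.
Proof. exact: over_lift. Qed.

(** [n] instantiates the product at [f1]. *)
Lemma instance_ex (V : B) (f1 : hom (I × d_X x × V) (d_U x)) :
  exists n : thom (reindex p1 prod_part) (reindex (d_src f1) matrix),
    over n = idc _ /\
    evaluates cone_lift cone_eval (weaken V) (d_src f1) (lift (d_src f1) matrix • n).
Proof.
have [ol [cl [oe _]]] := cone_of.
have [|v ev] := @evaluates_ex _ _ _ _ _ _ _ _ _ cone_eval _ _ (weaken V) (d_src f1) ol cl.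
  by rewrite over_weaken p1_pairing.
have [|n [on en]] := cart_lift (lift_cartesian (d_src f1) matrix) (g := v) (w := idc _).
  by rewrite (evaluates_over oe ev) over_lift comp_idr.
by exists n; rewrite en.
Qed.

End Object.

Arguments cone_lift_cartesian {I} x.
Arguments weaken_cartesian {I} x V.
Arguments prod_part_coprod_free {I} x.
Arguments matrix_coprod_free {I} x.
Arguments matrix_prod_free {I} x.

Section Realizes.
Variables (I J : B) (x : DialOb FP D I) (y : DialOb FP D J).

Definition matrix_arrow (F : DialHom x y) :
  thom (reindex (d_src (d_f1 F)) (matrix x)) (matrix y) := d_mate F.

(** [k] realizes [F] if evaluating [k] at a variable of [d_U y] is instantiating
    [prod_part x] at [d_f1 F] and then applying the arrow of matrices.  Unlike the
    resulting arrow between interpretations, this can be checked without eliminating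
    coproducts. *)
Definition realizes (F : DialHom x y) (k : thom (prod_part x) (prod_part y)) : Prop :=
  over k = ⟨d_f F ∘ p1, d_f0 F⟩ /\
  exists n : thom (reindex p1 (prod_part x)) (reindex (d_src (d_f1 F)) (matrix x)),
    over n = idc _ /\
    evaluates (cone_lift x) (cone_eval x) (weaken x (d_U y)) (d_src (d_f1 F))
      (lift (d_src (d_f1 F)) (matrix x) • n) /\
    evaluates (cone_lift y) (cone_eval y) (k • weaken x (d_U y))
      (d_tgt (d_U y) (d_f F) (d_f0 F)) (matrix_arrow F • n).

Lemma times_d_tgt (V Y : B) (X : B) (f : hom I J) (f0 : hom (I × X) Y) :
  times FP ⟨f ∘ p1, f0⟩ (idc V) = d_tgt V f f0.
Proof. by bsimp. Qed.

Lemma over_matrix_arrow (F : DialHom x y) :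
  over (matrix_arrow F) = d_tgt (d_U y) (d_f F) (d_f0 F).
Proof. exact: over_d_mate. Qed.

Lemma realizes_ex (F : DialHom x y) : exists k, realizes F k.
Proof.
have [n [on en]] := instance_ex (x := x) (d_f1 F).
have [ol [cl [oe U]]] := cone_of y.
have [|k [[ok ek] _]] := U _ _ _ (weaken x (d_U y)) (over_weaken _ _) (weaken_cartesian _ _)
  ⟨d_f F ∘ p1, d_f0 F⟩ (matrix_arrow F • n).
  by rewrite over_comp on comp_idr over_matrix_arrow times_d_tgt.
exists k; split=> //; exists n; splits=> //.
by rewrite -times_d_tgt.
Qed.

Lemma realizes_fun (F : DialHom x y) k k' : realizes F k -> realizes F k' -> k = k'.
Proof.
move=> [ok [n [on [en ek]]]] [ok' [n' [on' [en' ek']]]].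
have nn : n = n'.
  apply: lift_eq; first by rewrite on on'.
  exact: evaluates_fun (cone_lift_cartesian x) en en'.
subst n'; apply: (product_cone_inj (cone_of y) (over_weaken x (d_U y)) (weaken_cartesian _ _)
  (v := matrix_arrow F • n)); first by rewrite ok.
- by rewrite ok times_d_tgt.
- by rewrite ok times_d_tgt.
Qed.

End Realizes.

Lemma realizes_id (I : B) (x : DialOb FP D I) : realizes (DialId x) (tid (prod_part x)).
Proof.
split; first by rewrite over_id /= comp_idl pairing_id.
have [n [on en]] := instance_ex (x := x) (d_f1 (DialId x)).
exists n; splits=> //; rewrite tcomp_idl /matrix_arrow d_mate_id.
have -> // : d_tgt (d_U x) (d_f (DialId x)) (d_f0 (DialId x)) = d_src (d_f1 (DialId x)).
by rewrite /= d_src_p2 d_tgt_p2.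
Qed.

Lemma matrix_arrow_comp (I J K : B) (x : DialOb FP D I) (y : DialOb FP D J)
    (w : DialOb FP D K) (F : DialHom x y) (H : DialHom y w)
    (m := d_tgt (d_U w) (d_f F) (d_f0 F)) (u := d_src (d_f1 H ∘ m)) :
  exists (x0 : thom (reindex (d_src (d_f1 (DialComp H F))) (matrix x))
                    (reindex (d_src (d_f1 F)) (matrix x)))
         (z0 : thom (reindex (d_src (d_f1 (DialComp H F))) (matrix x))
                    (reindex (d_src (d_f1 H)) (matrix y))),
    over x0 = u /\
    lift (d_src (d_f1 F)) (matrix x) • x0 = lift (d_src (d_f1 (DialComp H F))) (matrix x) /\
    over z0 = m /\
    lift (d_src (d_f1 H)) (matrix y) • z0 = matrix_arrow F • x0 /\
    matrix_arrow (DialComp H F) = matrix_arrow H • z0.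
Proof. exact (d_mate_comp_ex H F). Qed.

(** Evaluating [k' • k] is evaluating [k'] along the reindexing [kW] of [k], which by
    the hypothesis on [k] factors through the instance at [d_f1 F]. *)
Lemma realizes_comp (I J K : B) (x : DialOb FP D I) (y : DialOb FP D J) (w : DialOb FP D K)
    (F : DialHom x y) (H : DialHom y w) k k' :
  realizes F k -> realizes H k' -> realizes (DialComp H F) (k' • k).
Proof.
move=> [ok [n [on [en ek]]]] [ok' [n' [on' [en' ek']]]].
split; first by rewrite over_comp ok ok' pairing_comp -!comp_assoc p1_pairing.
have [q [oq eq]] := instance_ex (x := x) (d_f1 (DialComp H F)).
exists q; splits=> //.
have [x0 [z0 [ox0 [lx0 [oz0 [lz0 em]]]]]] := matrix_arrow_comp F H.
rewrite em; move: (matrix_arrow F) (matrix_arrow H) ek ek' lz0 {em} => mF mH ek ek' lz0.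
set m := d_tgt (d_U w) (d_f F) (d_f0 F) in ox0 oz0.
set u := d_src (d_f1 H ∘ m) in ox0.
have [|kW [okW ekW]] := cart_lift (weaken_cartesian y (d_U w)) (g := k • weaken x (d_U w)) (w := m).
  by rewrite over_comp ok !over_weaken /m; bsimp.
have [|t [ot et]] := cart_lift (weaken_cartesian x (d_U y)) (g := weaken x (d_U w)) (w := u).
  by rewrite !over_weaken /u p1_pairing.
have E1 := evaluates_comp kW ek'.
have E2 := evaluates_comp kW en'.
have E3 := evaluates_comp t ek.
have E4 := evaluates_comp t en.
rewrite -!tcomp_assoc ?ekW ?et ?okW ?ot in E1 E2 E3 E4.
have e1 : n • t = x0 • q.
  apply: lift_eq; first by rewrite !over_comp on ot ox0 oq comp_idl comp_idr.
  apply: (evaluates_fun (cone_lift_cartesian x) E4).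
  by rewrite tcomp_assoc lx0 /u /m d_comp_src.
have e2 : n' • kW = z0 • q.
  apply: lift_eq; first by rewrite !over_comp on' okW oz0 oq comp_idl comp_idr.
  apply: (evaluates_fun (cone_lift_cartesian y) E2).
  rewrite tcomp_assoc lz0 -tcomp_assoc -e1.
  by move: E3; rewrite /u /m d_comp_mid.
by move: E1; rewrite e2 /m d_comp_tgt -!tcomp_assoc.
Qed.

Definition interprets (I J : B) (x : DialOb FP D I) (y : DialOb FP D J) (F : DialHom x y)
    (h : thom (interpretation x) (interpretation y)) : Prop :=
  over h = d_f F /\
  exists k, realizes F k /\ h • injection x = injection y • k.

Lemma interprets_ex (I J : B) (x : DialOb FP D I) (y : DialOb FP D J) (F : DialHom x y) :
  exists! h, interprets F h.
Proof.
have [k rk] := realizes_ex F; have [ok _] := rk.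
have [ox U] := injection_arrow x; have [oy _] := injection_arrow y.
have [|h [[oh eh] _]] := U _ _ (d_f F) (injection y • k).
  by rewrite over_comp oy ok p1_pairing.
exists h; split; first by split=> //; exists k.
move=> h' [oh' [k' [rk' eh']]]; apply: (coproduct_arrow_inj (injection_arrow x)).
  by rewrite oh.
by rewrite eh eh' (realizes_fun rk rk').
Qed.

Definition interpret (I J : B) (x : DialOb FP D I) (y : DialOb FP D J) (F : DialHom x y) :
    thom (interpretation x) (interpretation y) :=
  proj1_sig (constructive_definite_description _ (interprets_ex F)).

Lemma interpretP (I J : B) (x : DialOb FP D I) (y : DialOb FP D J) (F : DialHom x y) :
  interprets F (interpret F).
Proof. exact: proj2_sig (constructive_definite_description _ (interprets_ex F)). Qed.

Lemma interpret_unique (I J : B) (x : DialOb FP D I) (y : DialOb FP D J) (F : DialHom x y) h :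
  interprets F h -> interpret F = h.
Proof.
move=> H; have [h' [_ U]] := interprets_ex F.
by rewrite -(U _ (interpretP F)) (U _ H).
Qed.

Definition interpret_over : FunctorOver (Dial FP D) E.
Proof.
refine {| fo_ob := fun I (x : Dial FP D I) => interpretation x;
          fo_map := fun I J (x : Dial FP D I) (y : Dial FP D J) F => interpret F |}.
- by move=> I J x y F; case: (interpretP F).
- move=> I x; apply: interpret_unique; split; first exact: over_id.
  by exists (tid _); rewrite tcomp_idl tcomp_idr; split=> //; exact: realizes_id.
- move=> I J K x y w H F; apply: interpret_unique.
  have [oF [k [rk ek]]] := interpretP F; have [oH [k' [rk' ek']]] := interpretP H.
  split; first by rewrite over_comp oF oH.
  exists (k' • k); split; first exact: realizes_comp.
  by rewrite -tcomp_assoc ek (tcomp_assoc (interpret H)) ek' (tcomp_assoc (injection w)).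
Defined.

Lemma matrix_factor (I J : B) (x : DialOb FP D I) (y : DialOb FP D J)
    (g : thom (reindex p1 (prod_part x)) (matrix y)) :
  unique_prod_factor (cone_lift x) (cone_eval x) (weaken x (d_U y)) g.
Proof.
exact: prod_free_unique_factor (matrix_prod_free y) (matrix_coprod_free x) (cone_of x)
  (weaken_cartesian x (d_U y)).
Qed.

(** A realizer of [F] determines the third component and the matrix part of [F] by
    uniqueness of factorizations. *)
Lemma realizes_prod_factor (I J : B) (x : DialOb FP D I) (y : DialOb FP D J)
    (F : DialHom x y) k : realizes F k ->
  exists g, evaluates (cone_lift y) (cone_eval y) (k • weaken x (d_U y))
      (d_tgt (d_U y) (d_f F) (d_f0 F)) g /\
    prod_factor (cone_lift x) (cone_eval x) (weaken x (d_U y)) g (d_f1 F)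
      (lift (d_src (d_f1 F)) (matrix x)) (matrix_arrow F).
Proof.
move=> [ok [n [on [en ek]]]]; exists (matrix_arrow F • n); split=> //.
split; first exact: lift_cartesian.
rewrite over_weaken; split; first exact: over_lift.
by exists n.
Qed.

Lemma interpret_faithful (I J : B) (x : DialOb FP D I) (y : DialOb FP D J)
    (F F' : DialHom x y) h : interprets F h -> interprets F' h -> F = F'.
Proof.
move=> [oh [k [rk ek]]] [oh' [k' [rk' ek']]].
have [k0 [_ U]] := prod_part_coprod_free x _ _ _ (tiso_cartesian (tiso_id _)) _ _ _ _ _
  (injection_arrow y) (h • injection x).
have kk : k = k' by rewrite -(U k) ?ek // -(U k') ?ek'.
subst k'.
have [g [Eg fg]] := realizes_prod_factor rk; have [g' [Eg' fg']] := realizes_prod_factor rk'.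
have [ok _] := rk; have [ok' _] := rk'.
have ef : d_f F = d_f F' by rewrite -oh.
have ef0 : d_f0 F = d_f0 F'.
  by rewrite -(p2_pairing FP (d_f F ∘ p1) (d_f0 F)) -ok ok' p2_pairing.
rewrite -ef -ef0 in Eg'.
have gg : g = g' := evaluates_fun (cone_lift_cartesian y) Eg Eg'.
subst g'.
have [ef1 [q [oq [eq1 eq2]]]] := proj2 (matrix_factor g) _ _ _ _ _ _ _ _ fg fg'.
apply: DialHom_ext => // t ot et.
have qt : q • t = tid _.
  apply: lift_eq; first by rewrite over_comp oq comp_idl over_id; exact: ot.
  by rewrite tcomp_assoc eq1 tcomp_idr; exact: et.
change (tcomp (c := E) (matrix_arrow F) t = matrix_arrow F').
rewrite -eq2; move: (matrix_arrow F') => mF.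
by rewrite -tcomp_assoc qt tcomp_idr.
Qed.

Lemma interpret_full (I J : B) (x : DialOb FP D I) (y : DialOb FP D J)
    (h : thom (interpretation x) (interpretation y)) :
  exists F : DialHom x y, interprets F h.
Proof.
have [ox _] := injection_arrow x; have [oy _] := injection_arrow y.
have [k [ek _]] := prod_part_coprod_free x _ _ _ (tiso_cartesian (tiso_id _)) _ _ _ _ _
  (injection_arrow y) (h • injection x).
have ok : over k = ⟨over h ∘ p1, p2 ∘ over k⟩.
  by apply: pairing_graph; rewrite -oy -over_comp ek over_comp ox.
have [f [f0 [oh {}ok]]] : exists f f0, over h = f /\ over k = ⟨f ∘ p1, f0⟩.
  by exists (over h), (p2 ∘ over k).
have [ol [cl [oe _]]] := cone_of y.
have [|g Eg] := @evaluates_ex _ _ _ _ _ _ _ _ _ (cone_eval y) _ _ (k • weaken x (d_U y))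
  (d_tgt (d_U y) f f0) ol cl.
  by rewrite over_comp ok over_weaken; bsimp.
have og := evaluates_over oe Eg.
have [[f1 [b' [m [k2 fac]]]] _] := matrix_factor g.
have [cm [om _]] := fac; rewrite over_weaken in om.
have [|t [ot [et tt]]] := cartesian_compare cm (lift_cartesian (d_src f1) (matrix x)).
  by rewrite om over_lift.
have fac' := prod_factor_iso ot tt fac; rewrite et in fac'.
have okt := prod_factor_over fac'; rewrite og in okt.
have [_ [_ [n [on [En kn]]]]] := fac'; rewrite over_weaken in En.
have [|phi [ophi ephi]] := cart_lift (lift_cartesian (d_tgt (d_U y) f f0) (matrix y))
  (g := k2 • t) (w := idc _).
  by rewrite okt over_lift comp_idr.
exists (@Build_DialHom B FP D I J x y f f0 f1 (exist _ phi ophi)); split; first by [].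
exists k; split; last by [].
split; first by [].
exists n; splits=> //.
have -> : matrix_arrow (@Build_DialHom B FP D I J x y f f0 f1 (exist _ phi ophi)) = k2 • t.
  exact: ephi.
by rewrite kn.
Qed.

Lemma interpret_over_ff : fully_faithful interpret_over.
Proof.
move=> I J x y h; have [F HF] := interpret_full h.
exists F; split; first exact: interpret_unique.
by move=> F' eF'; apply: interpret_faithful HF _; rewrite -[h]eF'; exact: interpretP.
Qed.

Lemma interpret_over_es : ess_surjective interpret_over.
Proof.
move=> I c; have [X [b [e [fb ce]]]] := enough_coprod_free G c.
have [U [a [d [l [ev [fa [pa C]]]]]]] := enough_prod_free G fb.
pose x : DialOb FP D I := Build_DialOb (exist _ a (conj fa pa) : D (I × X × U)).
have [i [oi [ti _]]] := product_cone_unique C (cone_of x).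
have [j [oj [tj _]]] := coproduct_arrow_unique (injection_arrow x) (coproduct_arrow_comp_r oi ti ce).
by exists x, j.
Qed.

Lemma dialectica_reconstruction : equivalent_fibrations (Dial FP D) E.
Proof.
apply/equivalent_fibrationsP; exists interpret_over; split.
- exact: interpret_over_ff.
- exact: interpret_over_es.
Qed.

End Reconstruction.

Theorem theorem4p7 (B : Category) (FP : FiniteProducts B)
    (p : SplitFibration B)
    (P : SimpleProducts FP p) (S : SimpleCoproducts FP p)
    (ccc : cartesian_closed FP) :
  (exists p' : SplitFibration B, equivalent_fibrations (Dial FP p') p)
  <-> is_Goedel P S.
Proof.
rewrite is_GoedelP //; split=> [[p' e]|G].
  exact: intrinsic_Goedel_transport e (dial_intrinsic_Goedel FP p').
by exists (qf_fibration FP p); exact: dialectica_reconstruction.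
Qed.
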